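(* Let $q$ be a power of $2$ and let $n\ge4$. Let $G$ be the group generated by $\{\sigma,\tau,\delta,z,U,V\}$ subject to the following relations. Then $G$ is isomorphic to $\Omega^-(2n,q)$. (i) Defining relations for $S_{n-1}$ on $\{U,V\}$, with $U=(1,2)$, $V=(1,2,\dots,n-1)$, but omitting the relation $U^2=1$ (that is, a set of relations which together with $U^2=1$ presents $S_{n-1}$ on $\{U,V\}$); $[z,U^V]=1$; $[z,VU]=1$ if $n>4$; $[\delta,U^V]=1$; $[\delta,VU]=1$ if $n>4$. (ii) Relations stating that $\sigma$ is centralised by: $U^{V^2}$ if $n>4$; $VUU^V$ if $n>5$; $z^{V^2}$; $\delta^{V^2}$. (iii) Relations stating that $\tau$ is centralised by: $\delta^{V^2}\delta^{-V}$; $U^V$; $VU$ if $n>4$. (iv) Relations that present $\Omega^-(6,q)$ on $\{\sigma,\tau,\delta,z,U\}$. (v) $[\sigma,\sigma^V]=\sigma^{VU}$; $[\sigma,\sigma^{VU}]=1$; $[\sigma,\sigma^W]=1$, where $W=U^{VU}$; and if $n>4$ then $[\sigma,\sigma^{V^2}]=1$. (vi) $[\sigma^V,\tau]=1$.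
   Context: Conventions: $x^y=y^{-1}xy$, $[x,y]=x^{-1}y^{-1}xy$, $x^{-y}=(x^{-1})^y$. Linear maps act on the right and fix unmentioned basis vectors. Generators of the presented group are denoted by the same symbols as the corresponding matrices. ''Relations that present (defining relations for) a group on given elements $g_1,\dots,g_k$'' means any set of relators in the free group on $k$ letters whose normal closure is the kernel of the natural map onto $\langle g_1,\dots,g_k\rangle$. Matrices: $\omega$ is a primitive element of $\mathrm{GF}(q^2)$, $\omega_0=\omega^{q+1}$. The natural module of $\Omega^-(2n,q)$ over $\mathrm{GF}(q)$ has basis $(e_1,f_1,\dots,e_{n-1},f_{n-1},w_1,w_2)$ with quadratic form $Q$ satisfying $Q(e_i)=Q(f_i)=0$, $Q(w_1)=1$, $Q(w_2)=\omega_0$, whose polar form has $e_i.f_i=1$, $w_1.w_2=\omega+\omega^q$ and all other products of distinct basis vectors zero; $\Omega^-(2n,q)$ is the index $2$ subgroup (kernel of the Dickson invariant) of the full isometry group. With $A=\omega^{q-1}+\omega^{1-q}+1$, $B=\omega+\omega^q$, $C=\omega^{-1}+\omega^{-q}$: $\sigma=(e_1\mapsto e_1+e_2,\ f_2\mapsto f_2+f_1)$; $\tau=(e_1\mapsto e_1+f_1+w_1,\ w_2\mapsto w_2+(\omega+\omega^q)f_1)$; $\delta=(e_1\mapsto\omega_0^{-1}e_1,\ f_1\mapsto\omega_0f_1,\ w_1\mapsto Aw_1+Cw_2,\ w_2\mapsto Bw_1+w_2)$; $z=(e_1\mapsto f_1,\ f_1\mapsto e_1,\ w_2\mapsto w_2+Bw_1)$;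 $U$ interchanges $e_1,e_2$ and $f_1,f_2$; $V=(e_1,\dots,e_{n-1})(f_1,\dots,f_{n-1})$ cyclically permutes the $e_i$ and the $f_i$. In (iv), the five matrices $\sigma,\tau,\delta,z,U$ generate a copy of $\Omega^-(6,q)$, acting naturally on $\langle e_1,f_1,e_2,f_2,w_1,w_2\rangle$ and fixing the remaining basis vectors. *)

(* Defs.v *)
From HB Require Import structures.
From mathcomp Require Import all_boot all_order all_algebra all_fingroup.
From mathcomp Require Import finfield ring.
From mathcomp Require Import boolp classical_sets.

Set Implicit Arguments.
Unset Strict Implicit.
Unset Printing Implicit Defensive.

Import GRing.Theory.

Section FreeGroup.
Local Open Scope group_scope.
Variable k : nat.

(* A letter is [(i, b)], standing for the [i]-th generator when [b = false]   *)
(* and for its inverse when [b = true].                                       *)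
Definition word := seq ('I_k * bool).

Inductive free_eq : word -> word -> Prop :=
| free_eq_cancel u i b v :
    free_eq (u ++ [:: (i, b), (i, ~~ b) & v]) (u ++ v)
| free_eq_refl u : free_eq u u
| free_eq_sym u v : free_eq u v -> free_eq v u
| free_eq_trans u v w : free_eq u v -> free_eq v w -> free_eq u w.

Definition free_rel : rel word := fun u v => `[< free_eq u v >].

Lemma free_rel_equiv : equiv_class_of free_rel.
Proof.
split=> [u|u v|v u w].
- exact/asboolP/free_eq_refl.
- by apply/asboolP/asboolP => /free_eq_sym.
- by move=> /asboolP uv /asboolP vw; apply/asboolP/(free_eq_trans uv).
Qed.

Canonical free_equiv := EquivRelPack free_rel_equiv.

Definition free_group := {eq_quot free_equiv}%qT.
HB.instance Definition _ := EqQuotient.on free_group.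
HB.instance Definition _ := Choice.on free_group.

Definition free_word (w : word) : free_group := (\pi_(free_group) w)%qT.
Definition free_repr (x : free_group) : word := generic_quotient.repr x.

Definition word_inv (w : word) : word := rev [seq (p.1, ~~ p.2) | p <- w].

Lemma free_reprK x : free_word (free_repr x) = x.
Proof. exact: reprK. Qed.

Lemma free_wordP u v : free_word u = free_word v <-> free_eq u v.
Proof.
by split => [/(eqmodP free_equiv)/asboolP|uv];
  last by apply/(eqmodP free_equiv)/asboolP.
Qed.

Lemma free_repr_word w : free_eq (free_repr (free_word w)) w.
Proof. by apply/free_wordP; rewrite free_reprK. Qed.

Lemma free_eq_cat2l w u v : free_eq u v -> free_eq (w ++ u) (w ++ v).
Proof.
elim=> {u v} [u i b v|u|u v _ /free_eq_sym//|u v t _ uv _ vt].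
- by rewrite !catA; exact: free_eq_cancel.
- exact: free_eq_refl.
- exact: free_eq_trans uv vt.
Qed.

Lemma free_eq_cat2r w u v : free_eq u v -> free_eq (u ++ w) (v ++ w).
Proof.
elim=> {u v} [u i b v|u|u v _ /free_eq_sym//|u v t _ uv _ vt].
- by rewrite -!catA; exact: free_eq_cancel.
- exact: free_eq_refl.
- exact: free_eq_trans uv vt.
Qed.

Lemma free_eq_cat u u' v v' :
  free_eq u u' -> free_eq v v' -> free_eq (u ++ v) (u' ++ v').
Proof.
by move=> uu' vv'; apply: free_eq_trans (free_eq_cat2l _ vv') ;
  exact: free_eq_cat2r.
Qed.

Lemma word_invK : involutive word_inv.
Proof.
move=> w; rewrite /word_inv map_rev revK -map_comp -[RHS]map_id.
by apply: eq_map => -[i b] /=; rewrite negbK.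
Qed.

Lemma free_eq_inv u v : free_eq u v -> free_eq (word_inv u) (word_inv v).
Proof.
elim=> {u v} [u i b v|u|u v _ /free_eq_sym//|u v t _ uv _ vt].
- rewrite /word_inv !map_cat /= !rev_cat !rev_cons !cat_rcons negbK.
  exact: free_eq_cancel.
- exact: free_eq_refl.
- exact: free_eq_trans uv vt.
Qed.

Lemma free_eq_invl w : free_eq (word_inv w ++ w) [::].
Proof.
elim: w => [|[i b] w IHw]; first exact: free_eq_refl.
rewrite /word_inv /= rev_cons cat_rcons.
apply: free_eq_trans IHw.
by rewrite -{2}[b]negbK; exact: free_eq_cancel.
Qed.

Lemma free_eq_invr w : free_eq (w ++ word_inv w) [::].
Proof. by rewrite -{1}[w]word_invK; exact: free_eq_invl. Qed.

Definition free_mul (x y : free_group) :=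
  free_word (free_repr x ++ free_repr y).
Definition free_inv (x : free_group) := free_word (word_inv (free_repr x)).

Lemma free_wordM u v :
  free_mul (free_word u) (free_word v) = free_word (u ++ v).
Proof. by apply/free_wordP/free_eq_cat; exact: free_repr_word. Qed.

Lemma free_wordV u : free_inv (free_word u) = free_word (word_inv u).
Proof. by apply/free_wordP/free_eq_inv/free_repr_word. Qed.

Fact free_mulA : associative free_mul.
Proof.
move=> x y z; rewrite -[x]free_reprK -[y]free_reprK -[z]free_reprK.
by rewrite !free_wordM catA.
Qed.
Fact free_mul1 : left_id (free_word [::]) free_mul.
Proof. by move=> x; rewrite -[x]free_reprK free_wordM. Qed.
Fact free_mulr1 : right_id (free_word [::]) free_mul.
Proof. by move=> x; rewrite -[x]free_reprK free_wordM cats0. Qed.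
Fact free_mulV : left_inverse (free_word [::]) free_inv free_mul.
Proof.
move=> x; rewrite -[x]free_reprK free_wordV free_wordM.
exact/free_wordP/free_eq_invl.
Qed.
Fact free_mulrV : right_inverse (free_word [::]) free_inv free_mul.
Proof.
move=> x; rewrite -[x]free_reprK free_wordV free_wordM.
exact/free_wordP/free_eq_invr.
Qed.

HB.instance Definition _ :=
  isGroup.Build free_group free_mulA free_mul1 free_mulr1 free_mulV free_mulrV.

Definition free_gen (i : 'I_k) : free_group := free_word [:: (i, false)].

Section Lift.
Variables (H : groupType) (g : k.-tuple H).

Definition word_eval (w : word) : H :=
  \prod_(p <- w) (if p.2 then (tnth g p.1)^-1 else tnth g p.1).

(* The homomorphism from the free group sending the generators to [g].        *)
Definition free_lift (x : free_group) : H := word_eval (free_repr x).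

Lemma word_eval_cat u v : word_eval (u ++ v) = word_eval u * word_eval v.
Proof. by rewrite /word_eval big_cat. Qed.

Lemma word_eval_eq u v : free_eq u v -> word_eval u = word_eval v.
Proof.
elim=> {u v} [u i b v|//|//|u v t _ -> //].
rewrite !word_eval_cat /word_eval !big_cons /=.
by case: b; rewrite /= ?mulVKg ?mulKg ?mulVg ?mulKVg.
Qed.

Lemma free_lift_word w : free_lift (free_word w) = word_eval w.
Proof. exact/word_eval_eq/free_repr_word. Qed.

Lemma free_lift_gen i : free_lift (free_gen i) = tnth g i.
Proof. by rewrite free_lift_word /word_eval big_seq1. Qed.

Fact free_lift_morph : {morph free_lift : x y / x * y}.
Proof.
move=> x y; rewrite -[x]free_reprK -[y]free_reprK.
have -> (u v : word) : free_word u * free_word v = free_word (u ++ v).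
  exact: free_wordM.
by rewrite !free_lift_word word_eval_cat.
Qed.

HB.instance Definition _ :=
  isMultiplicative.Build free_group H free_lift free_lift_morph.
End Lift.
End FreeGroup.

Section NormalClosure.
Local Open Scope group_scope.
Local Open Scope classical_set_scope.
Variable G : groupType.

Definition normal_subgroup (N : set G) : Prop :=
  [/\ N 1, forall x y, N x -> N y -> N (x * y), forall x, N x -> N x^-1
    & forall x y, N x -> N (x ^ y)].

Definition normal_closure (R : set G) : set G := smallest normal_subgroup R.

Lemma normal_closureP R : normal_subgroup (normal_closure R).
Proof.
split=> [N [[]]//|x y Rx Ry N NR|x Rx N NR|x y Rx N NR];
  have [[N1 NM NV NJ] _] := NR.
- by apply: NM; [exact: Rx|exact: Ry].
- by apply: NV; exact: Rx.
- by apply: NJ; exact: Rx.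
Qed.

Variable R : set G.

Definition presented_rel : rel G :=
  fun x y => `[< normal_closure R (x * y^-1) >].

Lemma presented_rel_equiv : equiv_class_of presented_rel.
Proof.
have [N1 NM NV NJ] := normal_closureP R.
split=> [x|x y|y x z].
- by apply/asboolP; rewrite mulgV.
- by apply/asboolP/asboolP => /NV; rewrite invgM invgK.
- move=> /asboolP xy /asboolP yz; apply/asboolP.
  by have := NM _ _ xy yz; rewrite mulgA mulgVK.
Qed.

Canonical presented_equiv := EquivRelPack presented_rel_equiv.

(* The quotient of [G] by the normal closure of [R].                          *)
Definition presented := {eq_quot presented_equiv}%qT.
HB.instance Definition _ := EqQuotient.on presented.
HB.instance Definition _ := Choice.on presented.

Definition presented_pi (x : G) : presented := (\pi_(presented) x)%qT.
Definition presented_repr (a : presented) : G := generic_quotient.repr a.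

Lemma presented_reprK a : presented_pi (presented_repr a) = a.
Proof. exact: reprK. Qed.

Lemma presented_piP x y :
  presented_pi x = presented_pi y <-> normal_closure R (x * y^-1).
Proof.
by split => [/(eqmodP presented_equiv)/asboolP|xy];
  last by apply/(eqmodP presented_equiv)/asboolP.
Qed.

Definition presented_mul (a b : presented) :=
  presented_pi (presented_repr a * presented_repr b).
Definition presented_inv (a : presented) :=
  presented_pi (presented_repr a)^-1.

Lemma presented_piM x y :
  presented_mul (presented_pi x) (presented_pi y) = presented_pi (x * y).
Proof.
have [N1 NM NV NJ] := normal_closureP R.
have /presented_piP Nx := presented_reprK (presented_pi x).
have /presented_piP Ny := presented_reprK (presented_pi y).
apply/presented_piP.
move: (presented_repr _) (presented_repr _) Nx Ny => y' x' Nx Ny.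
have := NM _ _ (NJ _ x'^-1 Ny) Nx.
by rewrite /conjg invgK invgM !mulgA mulgVK.
Qed.

Lemma presented_piV x :
  presented_inv (presented_pi x) = presented_pi x^-1.
Proof.
have [N1 NM NV NJ] := normal_closureP R.
have /presented_piP/NV Nx := presented_reprK (presented_pi x).
apply/presented_piP; move: (presented_repr _) Nx => x' Nx.
by have := NJ _ x' Nx; rewrite /conjg invgM invgK !mulgA mulgVK.
Qed.

Fact presented_mulA : associative presented_mul.
Proof.
move=> a b c.
rewrite -[a]presented_reprK -[b]presented_reprK -[c]presented_reprK.
by rewrite !presented_piM mulgA.
Qed.
Fact presented_mul1 : left_id (presented_pi 1) presented_mul.
Proof. by move=> a; rewrite -[a]presented_reprK presented_piM mul1g. Qed.
Fact presented_mulr1 : right_id (presented_pi 1) presented_mul.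
Proof. by move=> a; rewrite -[a]presented_reprK presented_piM mulg1. Qed.
Fact presented_mulV :
  left_inverse (presented_pi 1) presented_inv presented_mul.
Proof.
by move=> a; rewrite -[a]presented_reprK presented_piV presented_piM mulVg.
Qed.
Fact presented_mulrV :
  right_inverse (presented_pi 1) presented_inv presented_mul.
Proof.
by move=> a; rewrite -[a]presented_reprK presented_piV presented_piM mulgV.
Qed.

HB.instance Definition _ :=
  isGroup.Build presented presented_mulA presented_mul1 presented_mulr1
    presented_mulV presented_mulrV.
End NormalClosure.

(* [R] is a set of defining relators for the subgroup generated by [g].       *)
Definition presents (k : nat) (H : groupType) (R : set (free_group k))
    (g : k.-tuple H) : Prop :=
  forall w, normal_closure R w <-> free_lift g w = 1%g.

(* [H] is given as a subset of the finite group [gT].                         *)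
Definition isomorphic_to (G : groupType) (gT : finGroupType) (H : {set gT}) :=
  exists f : {multiplicative G -> gT},
    injective f /\ forall y, y \in H <-> exists x, f x = y.

Section SymmetricGenerators.
Variable n : nat.

Definition sym_swap : 'S_(n.-2.+1) := tperm (inord 0) (inord 1).
Definition sym_cycle : 'S_(n.-2.+1) := perm (@ordS_inj n.-2.+1).
Definition sym_gens : 2.-tuple 'S_(n.-2.+1) := [tuple sym_swap; sym_cycle].
End SymmetricGenerators.

Section OmegaMinus.
Local Open Scope ring_scope.
Variables (F : finFieldType) (n : nat) (omega0 A B C : F).

(* The dimension 2n, in a shape for which square matrices form a ring. The    *)
(* basis is ordered (e_1, f_1, ..., e_(n-1), f_(n-1), w_1, w_2); vectors are  *)
(* rows, so that matrices act on the right. Indices of e and f start at 0.    *)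
Notation dim := (n.-1.*2.+2).

Definition ei (i : nat) : 'I_dim := inord i.*2.
Definition fi (i : nat) : 'I_dim := inord i.*2.+1.
Definition w1i : 'I_dim := inord n.-1.*2.
Definition w2i : 'I_dim := inord n.-1.*2.+1.

Definition bv (i : 'I_dim) : 'rV[F]_dim := delta_mx 0 i.

(* The linear map sending the [i]-th basis vector to [v i].                   *)
Definition linmx (v : 'I_dim -> 'rV[F]_dim) : 'M[F]_dim := \matrix_i v i.

Definition Qform (v : 'rV[F]_dim) : F :=
  \sum_(i < n.-1) v 0 (ei i) * v 0 (fi i)
  + v 0 w1i ^+ 2 + omega0 * v 0 w2i ^+ 2 + B * v 0 w1i * v 0 w2i.

(* In characteristic 2 the Dickson invariant of an isometry [g] is the parity *)
(* of the rank of [g - 1].                                                    *)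
Definition Omega_minus : {set {'GL_dim[F]}} :=
  [set g : {'GL_dim[F]} | [forall v, Qform (v *m GLval g) == Qform v]
                        & ~~ odd (\rank (GLval g - 1%:M))].

Definition sigma_mx : 'M[F]_dim :=
  linmx [eta bv with ei 0 |-> bv (ei 0) + bv (ei 1),
                     fi 1 |-> bv (fi 1) + bv (fi 0)].
Definition tau_mx : 'M[F]_dim :=
  linmx [eta bv with ei 0 |-> bv (ei 0) + bv (fi 0) + bv w1i,
                     w2i |-> bv w2i + B *: bv (fi 0)].
Definition delta_mat : 'M[F]_dim :=
  linmx [eta bv with ei 0 |-> omega0^-1 *: bv (ei 0),
                     fi 0 |-> omega0 *: bv (fi 0),
                     w1i |-> A *: bv w1i + C *: bv w2i,
                     w2i |-> B *: bv w1i + bv w2i].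
Definition z_mx : 'M[F]_dim :=
  linmx [eta bv with ei 0 |-> bv (fi 0),
                     fi 0 |-> bv (ei 0),
                     w2i |-> bv w2i + B *: bv w1i].
Definition U_mx : 'M[F]_dim :=
  linmx [eta bv with ei 0 |-> bv (ei 1),
                     ei 1 |-> bv (ei 0),
                     fi 0 |-> bv (fi 1),
                     fi 1 |-> bv (fi 0)].
(* The matrix [M] as an element of GL; 1 if [M] is singular. The matrices     *)
(* above are invertible in the intended situation.                            *)
Definition toGL (M : 'M[F]_dim) : {'GL_dim[F]} := insubd (1%g : {'GL_dim[F]}) M.

Definition omega6_gens : 5.-tuple {'GL_dim[F]} :=
  [tuple toGL sigma_mx; toGL tau_mx; toGL delta_mat; toGL z_mx; toGL U_mx].

Lemma toGLK M : M \in unitmx -> GLval (toGL M) = M.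
Proof. by move=> Mu; exact: (insubdK (1%g : {'GL_dim[F]}) Mu). Qed.

Lemma bv_linmx v i : bv i *m linmx v = v i.
Proof. by rewrite -rowE rowK. Qed.

Lemma linmx_unit v w : (forall i, v i *m linmx w = bv i) ->
  linmx v \in unitmx.
Proof.
move=> vw; suff /mulmx1_unit[] : linmx v *m linmx w = 1%:M by [].
by apply/row_matrixP => i; rewrite row_mul rowK vw row1.
Qed.

Hypothesis n_ge4 : (4 <= n)%N.

Lemma basis_val : ((ei 0 = 0%N :> nat) * (ei 1 = 2%N :> nat) *
  (fi 0 = 1%N :> nat) * (fi 1 = 3%N :> nat) *
  (w1i = n.-1.*2 :> nat) * (w2i = n.-1.*2.+1 :> nat))%type.
Proof.
by do !split; rewrite /ei /fi /w1i /w2i inordK //; case: n n_ge4 => [|[|[]]].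
Qed.

Lemma basis_neq :
  (((ei 0 == ei 1) = false) * ((ei 1 == ei 0) = false) *
  ((fi 0 == fi 1) = false) * ((fi 1 == fi 0) = false) *
  ((ei 0 == fi 0) = false) * ((fi 0 == ei 0) = false) *
  ((ei 0 == fi 1) = false) * ((fi 1 == ei 0) = false) *
  ((ei 1 == fi 0) = false) * ((fi 0 == ei 1) = false) *
  ((ei 1 == fi 1) = false) * ((fi 1 == ei 1) = false) *
  ((ei 0 == w1i) = false) * ((w1i == ei 0) = false) *
  ((fi 0 == w1i) = false) * ((w1i == fi 0) = false) *
  ((ei 0 == w2i) = false) * ((w2i == ei 0) = false) *
  ((fi 0 == w2i) = false) * ((w2i == fi 0) = false) *
  ((w1i == w2i) = false) * ((w2i == w1i) = false))%type.
Proof.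
do !split; rewrite -val_eqE /= !basis_val //;
  move: n_ge4; case: n => [|[|[|k]]] //= _;
  by [rewrite ltn_eqF | rewrite gtn_eqF].
Qed.

Hypothesis F2 : 2%N \in [pchar F].

Lemma addvv (x : 'rV[F]_dim) : x + x = 0.
Proof. by apply/rowP => j; rewrite !mxE addrr_pchar2. Qed.

Lemma addvK (x y : 'rV[F]_dim) : x + y + y = x.
Proof. by rewrite -addrA addvv addr0. Qed.

Lemma sigma_unit : sigma_mx \in unitmx.
Proof.
apply: (@linmx_unit _ [eta bv with ei 0 |-> bv (ei 0) + bv (ei 1),
                                   fi 1 |-> bv (fi 1) + bv (fi 0)]) => i /=.
case: (altP (i =P ei 0)) => [->|i1].
  by rewrite mulmxDl !bv_linmx /= eqxx !basis_neq addvK.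
case: (altP (i =P fi 1)) => [->|i2].
  by rewrite mulmxDl !bv_linmx /= eqxx !basis_neq addvK.
by rewrite bv_linmx /= (negPf i1) (negPf i2).
Qed.

Lemma tau_unit : tau_mx \in unitmx.
Proof.
apply: (@linmx_unit _ [eta bv with
    ei 0 |-> bv (ei 0) + bv (fi 0) + bv w1i,
    w2i |-> bv w2i + B *: bv (fi 0)]) => i /=.
case: (altP (i =P ei 0)) => [->|i1].
  by rewrite !mulmxDl !bv_linmx /= eqxx !basis_neq addrAC addvK addvK.
case: (altP (i =P w2i)) => [->|i2].
  by rewrite mulmxDl -scalemxAl !bv_linmx /= eqxx !basis_neq addvK.
by rewrite bv_linmx /= (negPf i1) (negPf i2).
Qed.

Lemma z_unit : z_mx \in unitmx.
Proof.
apply: (@linmx_unit _ [eta bv with ei 0 |-> bv (fi 0), fi 0 |-> bv (ei 0),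
                                   w2i |-> bv w2i + B *: bv w1i]) => i /=.
case: (altP (i =P ei 0)) => [->|i1].
  by rewrite bv_linmx /= eqxx !basis_neq.
case: (altP (i =P fi 0)) => [->|i2].
  by rewrite bv_linmx /= eqxx.
case: (altP (i =P w2i)) => [->|i3].
  by rewrite mulmxDl -scalemxAl !bv_linmx /= eqxx !basis_neq addvK.
by rewrite bv_linmx /= (negPf i1) (negPf i2) (negPf i3).
Qed.

Lemma U_unit : U_mx \in unitmx.
Proof.
apply: (@linmx_unit _ [eta bv with ei 0 |-> bv (ei 1), ei 1 |-> bv (ei 0),
                                   fi 0 |-> bv (fi 1), fi 1 |-> bv (fi 0)])
  => i /=.
case: (altP (i =P ei 0)) => [->|i1].
  by rewrite bv_linmx /= eqxx !basis_neq.
case: (altP (i =P ei 1)) => [->|i2].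
  by rewrite bv_linmx /= eqxx.
case: (altP (i =P fi 0)) => [->|i3].
  by rewrite bv_linmx /= eqxx !basis_neq.
case: (altP (i =P fi 1)) => [->|i4].
  by rewrite bv_linmx /= eqxx !basis_neq.
by rewrite bv_linmx /= (negPf i1) (negPf i2) (negPf i3) (negPf i4).
Qed.

Lemma delta_unit : omega0 != 0 -> A + B * C = 1 -> delta_mat \in unitmx.
Proof.
move=> w0 ABC.
apply: (@linmx_unit _ [eta bv with ei 0 |-> omega0 *: bv (ei 0),
                     fi 0 |-> omega0^-1 *: bv (fi 0),
                     w1i |-> bv w1i + C *: bv w2i,
                     w2i |-> B *: bv w1i + A *: bv w2i]) => i /=.
case: (altP (i =P ei 0)) => [->|i1].
  by rewrite -scalemxAl !bv_linmx /= eqxx scalerA mulVf // scale1r.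
case: (altP (i =P fi 0)) => [->|i2].
  by rewrite -scalemxAl !bv_linmx /= !eqxx !basis_neq scalerA mulfV // scale1r.
case: (altP (i =P w1i)) => [->|i3].
  rewrite mulmxDl -!scalemxAl !bv_linmx /= !eqxx !basis_neq !scalerDr !scalerA.
  rewrite addrACA -!scalerDl [C * B]mulrC ABC scale1r [C * A]mulrC.
  by rewrite addrr_pchar2 // scale0r addr0.
case: (altP (i =P w2i)) => [->|i4].
  rewrite mulmxDl -!scalemxAl !bv_linmx /= !eqxx !basis_neq !scalerDr !scalerA.
  by rewrite addrACA addvv add0r -scalerDl [B * C + A]addrC ABC scale1r.
by rewrite bv_linmx /= (negPf i1) (negPf i2) (negPf i3) (negPf i4).
Qed.

End OmegaMinus.

Section Descent.
Local Open Scope ring_scope.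
Variables (e q : nat) (F L : finFieldType) (iota : {rmorphism F -> L}).
Variables (omega : L) (omega0 A B C : F).
Hypotheses (q2 : q = (2 ^ e)%N) (cardF : #|F| = q).
Hypothesis omegaP : ((q ^ 2).-1).-primitive_root omega.
Hypothesis omega0E : iota omega0 = omega ^+ q.+1.
Hypothesis AE : iota A = omega ^+ q.-1 + omega ^- q.-1 + 1.
Hypothesis BE : iota B = omega + omega ^+ q.
Hypothesis CE : iota C = omega^-1 + omega ^- q.

Lemma pchar_GFq : 2%N \in [pchar F].
Proof. by apply: (@card_finPcharP _ _ e); rewrite ?cardF. Qed.

Lemma omega_neq0 : omega != 0.
Proof.
apply/eqP => w0; have := prim_expr_order omegaP.
rewrite w0 expr0n; have := prim_order_gt0 omegaP.
by case: (_.-1) => // m _ /eqP; rewrite eq_sym oner_eq0.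
Qed.

Lemma omega0_neq0 : omega0 != 0.
Proof. by rewrite -(fmorph_eq0 iota) omega0E expf_neq0 // omega_neq0. Qed.

Lemma ABC1 : A + B * C = 1.
Proof.
have w0 := omega_neq0; have wq0 := expf_neq0 q w0.
have L2 : 2%N \in [pchar L] by rewrite (fmorph_pchar iota) pchar_GFq.
have q0 : (0 < q)%N by rewrite q2 expn_gt0.
apply: (fmorph_inj iota).
rewrite rmorphD rmorphM AE BE CE rmorph1 mulrDl !mulrDr !mulfV //.
have -> : omega / omega ^+ q = omega ^- q.-1.
  by rewrite -{1}(prednK q0) exprS invfM mulVKf.
have -> : omega ^+ q / omega = omega ^+ q.-1.
  by rewrite -{1}(prednK q0) exprSr mulfK.
set a := _ ^+ _; set b := _ ^- _.
have -> : a + b + 1 + (1 + b + (a + 1)) = (a + a) + (b + b) + (1 + 1) + 1.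
  by ring.
by rewrite !(addrr_pchar2 L2) !add0r.
Qed.

Lemma omega6_gens_mx (n : nat) : (4 <= n)%N ->
  [tuple of map GLval (omega6_gens n omega0 A B C)] =
  [tuple sigma_mx F n; tau_mx n B; delta_mat n omega0 A B C; z_mx n B;
         U_mx F n].
Proof.
move=> n4; have F2 := pchar_GFq; apply: val_inj => /=.
rewrite !toGLK ?sigma_unit ?tau_unit ?z_unit ?U_unit //.
exact: (delta_unit n4 F2 omega0_neq0 ABC1).
Qed.
End Descent.

Section Relators.
Local Open Scope group_scope.
Variable n : nat.

Definition gsigma : free_group 6 := free_gen (inord 0).
Definition gtau : free_group 6 := free_gen (inord 1).
Definition gdelta : free_group 6 := free_gen (inord 2).
Definition gz : free_group 6 := free_gen (inord 3).
Definition gU : free_group 6 := free_gen (inord 4).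
Definition gV : free_group 6 := free_gen (inord 5).

Local Notation sigma := gsigma.
Local Notation tau := gtau.
Local Notation delta := gdelta.
Local Notation z := gz.
Local Notation U := gU.
Local Notation V := gV.

Definition explicit_relators : seq (free_group 6) :=
     [:: [~ z, U ^ V]; [~ delta, U ^ V]]
  ++ (if 4 < n then [:: [~ z, V * U]; [~ delta, V * U]] else [::])
  ++ (if 4 < n then [:: [~ sigma, U ^ (V ^+ 2)]] else [::])
  ++ (if 5 < n then [:: [~ sigma, V * U * U ^ V]] else [::])
  ++ [:: [~ sigma, z ^ (V ^+ 2)]; [~ sigma, delta ^ (V ^+ 2)]]
  ++ [:: [~ tau, delta ^ (V ^+ 2) * (delta^-1) ^ V]; [~ tau, U ^ V]]
  ++ (if 4 < n then [:: [~ tau, V * U]] else [::])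
  ++ [:: [~ sigma, sigma ^ V] * (sigma ^ (V * U))^-1;
         [~ sigma, sigma ^ (V * U)];
         [~ sigma, sigma ^ (U ^ (V * U))]]
  ++ (if 4 < n then [:: [~ sigma, sigma ^ (V ^+ 2)]] else [::])
  ++ [:: [~ sigma ^ V, tau]].

(* [RS] is a set of relators in (U, V) and [RO] one in                        *)
(* (sigma, tau, delta, z, U).                                                 *)
Definition relators (RS : set (free_group 2)) (RO : set (free_group 5)) :
    set (free_group 6) :=
  (free_lift [tuple U; V] @` RS
   `|` free_lift [tuple sigma; tau; delta; z; U] @` RO
   `|` [set` explicit_relators])%classic.
End Relators.

(* Main.v *)
Require Import Defs.
From HB Require Import structures.
From mathcomp Require Import all_boot all_order all_algebra all_fingroup.
From mathcomp Require Import finfield ring zify.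
From mathcomp Require Import boolp classical_sets.

Set Implicit Arguments.
Unset Strict Implicit.
Unset Printing Implicit Defensive.
Import GRing.Theory.

(** Let [G] be the presented group and [M] the homomorphism from [G] to the
general linear group that sends each generator to its matrix; it exists because
the relators die in the matrix group ([ev_relators]). The theorem says that [M]
is injective and that its image is [Omega_minus].

The matrices. Write [e_i], [f_i] for the hyperbolic basis, and [siegel u v] for
the Siegel transformation attached to a singular [u] and a [v] orthogonal to [u].
Then [sigma = siegel f_1 e_2], [tau = siegel f_1 w_1], the matrices [U] and [V]
permute the indices, and [z], [delta] are products of two and of four
reflections. Since [siegel u v ^ g = siegel (u g) (v g)] for an isometry [g],
identities between these matrices are read off from the action on the basis.
Multiplying by a reflection changes the parity of the rank of [g - 1] ([oddr_R]),
so products of an even number of reflections form a group in which that rank is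
even; all generators lie in it ([mx_even]).

The relations. The presentation gives relations between root elements with
coefficient 1 only. The torus elements [delta_i] act transitively on the nonzero
coefficients of a root ([omega0_pow], [wact_trans]), the elements [z_i] exchange
[e_i] with [f_i], and the symmetric group moves the indices. Conjugating by these
spreads the given relations to all pairs of root elements. This is
unambiguous because elements of [G] that involve at most two indices lie in a conjugate
of the subgroup presented as [Omega^-(6,q)], where they are determined by their
matrices ([on_pair_inj]): so there is in [G] one root element [xe p r a] or
[ye p w] for each of the matrices [Ex p r a], [Ey p w].

Injectivity. Let [levi i] be the subgroup generated by the root and torus
elements with all indices at least [i]; [levi 0] is all of [G]. Inside [levi i],
let [parab i] be generated by [levi i.+1], by the root elements at [f_i] and by
[delta_i]. It fixes the line of [f_i], and [levi i] is the union of the double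
cosets of [parab i] that contain 1, [z_i] and the transposition [(i, i+1)],
because that union is stable under multiplication by generators ([levi_cells]). The
last two representatives move the line of [f_i], so an element with trivial
matrix lies in [parab i] ([cells_ker]). Its unipotent part is recovered from the
image of [e_i] ([unip_inj]), so the element lies in [levi i.+1] ([parab_ker]).
Descending along [i] leaves an element with a single index, and such an element
is trivial by the presentation of [Omega^-(6,q)] ([levi_inj], [gens_inj]).

Surjectivity. As in Witt's theorem, the images of [e_i] and [f_i] under an
isometry are moved back one pair at a time by root elements, torus elements and
the [z_i]. What remains is an isometry of the anisotropic plane, which the torus
reduces to 1 or to the reflection in [w_1] ([iso_decomp]). The reflection is
excluded by parity. *)

(** * Homomorphisms, presentations and permutations *)

Section Homomorphisms.
Local Open Scope group_scope.
Lemma hom_one (G H : groupType) (f : G -> H) :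
  {morph f : x y / x * y} -> f 1 = 1.
Proof. by move=> fM; apply: (mulgI (f 1)); rewrite -fM !mulg1. Qed.
Lemma hom_inv (G H : groupType) (f : G -> H) x :
  {morph f : x y / x * y} -> f x^-1 = (f x)^-1.
Proof. by move=> fM; apply: (mulgI (f x)); rewrite -fM !mulgV (hom_one fM). Qed.
Lemma hom_conj (G H : groupType) (f : G -> H) x y :
  {morph f : x y / x * y} -> f (x ^ y) = f x ^ f y.
Proof. by move=> fM; rewrite !conjgE !fM (hom_inv _ fM). Qed.
Lemma hom_comm (G H : groupType) (f : G -> H) x y :
  {morph f : x y / x * y} -> f [~ x, y] = [~ f x, f y].
Proof. by move=> fM; rewrite /commg fM (hom_inv _ fM) (hom_conj _ _ fM). Qed.
End Homomorphisms.

Section Gen.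
Local Open Scope group_scope.
Variable G : groupType.
Implicit Types (S : G -> Prop) (x y : G).
Inductive gen S : G -> Prop :=
| gen_in x : S x -> gen S x
| gen_1 : gen S 1
| gen_M x y : gen S x -> gen S y -> gen S (x * y)
| gen_V x : gen S x -> gen S x^-1.
Lemma gen_X S x k : gen S x -> gen S (x ^+ k).
Proof. by move=> gx; elim: k => [|k IH]; [exact: gen_1|rewrite expgS; exact: gen_M]. Qed.
Lemma gen_J S x y : gen S x -> gen S y -> gen S (x ^ y).
Proof. by move=> gx gy; rewrite conjgE; apply: gen_M; [exact: gen_V|exact: gen_M]. Qed.
Lemma gen_sub S T x : (forall y, S y -> gen T y) -> gen S x -> gen T x.
Proof.
move=> ST; elim=> {x} [x|||]; [exact: ST|exact: gen_1| |].
  by move=> x y _ gx _ gy; exact: gen_M.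
by move=> x _ gx; exact: gen_V.
Qed.
Lemma gen_fix S x y : (forall y', S y' -> y' ^ y = y') -> gen S x -> x ^ y = x.
Proof.
move=> ST; elim=> {x} [x|||]; [exact: ST|by rewrite conj1g| |].
  by move=> u v _ gu _ gv; rewrite conjMg gu gv.
by move=> u _ gu; rewrite conjVg gu.
Qed.
Lemma gen_conj S T y x : (forall x, S x -> gen T (x ^ y)) -> gen S x -> gen T (x ^ y).
Proof.
move=> ST; elim=> {x} [x|||]; [exact: ST|by rewrite conj1g; exact: gen_1| |].
  by move=> u v _ gu _ gv; rewrite conjMg; exact: gen_M.
by move=> u _ gu; rewrite conjVg; exact: gen_V.
Qed.
(** When the generators have finite order, their inverses are products of
generators, so an induction on a generated subgroup may forget inverses. *)
Lemma gen_ind_fin S (R : G -> Prop) x :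
  (forall x, S x -> exists m : nat, x^-1 = x ^+ m) -> R 1 ->
  (forall x y, R x -> R y -> R (x * y)) -> (forall x, S x -> R x) -> gen S x -> R x.
Proof.
move=> SV R1 RM RS gx; suff [] : R x /\ R x^-1 by [].
elim: gx => {x} [x Sx||x y _ [Rx Rx'] _ [Ry Ry']|x _ [Rx Rx']].
- split; first exact: RS.
  have [m ->] := SV x Sx; elim: m => [|m IH] //; rewrite expgS.
  by apply: RM => //; apply: RS.
- by rewrite invg1.
- by rewrite invgM; split; apply: RM.
by rewrite invgK.
Qed.
Lemma prod_single (T : eqType) (s : seq T) (P : pred T) (f : T -> G) r :
  uniq s -> r \in s -> P r -> (forall u, P u -> u != r -> f u = 1) ->
  \prod_(u <- s | P u) f u = f r.
Proof.
move=> us rs Pr f1; case/splitPr: rs us => s1 s2.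
rewrite cat_uniq /= negb_or => /and3P[_ /andP[r1 _] /andP[r2 _]].
rewrite big_cat big_cons Pr /= !big1_seq ?mul1g ?mulg1 // => u /andP[Pu us];
  by apply: f1 => //; apply: contraTneq us => ->.
Qed.
Lemma commute_fix x y : commute x y <-> x ^ y = x.
Proof.
split=> [c|e]; first by rewrite conjgE c mulKg.
by rewrite /commute -[in RHS]e conjgE mulKVg.
Qed.
Lemma commuteJ x y z : commute x y -> commute (x ^ z) (y ^ z).
Proof. by move=> c; rewrite /commute -!conjMg c. Qed.
End Gen.

Section FreeLift.
Local Open Scope group_scope.

Lemma free_liftM k (G : groupType) (g : k.-tuple G) : {morph free_lift g : x y / x * y}.
Proof. exact: free_lift_morph. Qed.

Lemma hom_free_lift (G H : groupType) (f : G -> H) k (g : k.-tuple G) x :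
  {morph f : x y / x * y} -> f (free_lift g x) = free_lift [tuple of map f g] x.
Proof.
move=> fM; rewrite /free_lift /word_eval (big_morph f fM (hom_one fM)).
by apply: eq_bigr => -[i b] _; rewrite tnth_map; case: b; rewrite //= (hom_inv _ fM).
Qed.

Lemma free_liftE k (x : free_group k) : free_lift [tuple free_gen i | i < k] x = x.
Proof.
rewrite /free_lift -[RHS]free_reprK; move: (free_repr x) => w; rewrite /word_eval.
elim: w => [|[i b] w IH]; first by rewrite big_nil.
rewrite big_cons IH tnth_mktuple /=.
have e : (if b then (free_gen i)^-1 else free_gen i) = free_word [:: (i, b)].
  by case: b => //; apply: free_wordV.
by rewrite e; apply: free_wordM.
Qed.

Lemma gen_free_lift (G : groupType) (S : G -> Prop) k (g : k.-tuple G) x :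
  (forall i, S (tnth g i)) -> gen S (free_lift g x).
Proof.
move=> Sg; rewrite /free_lift /word_eval; elim/big_rec: _ => [|[i b] y _ Sy].
  exact: gen_1.
by apply: gen_M => //; case: b; [apply: gen_V|]; apply: gen_in.
Qed.
Lemma gen_free (G : groupType) (S : G -> Prop) k (g : k.-tuple G) x :
  (forall y, S y -> exists i, y = tnth g i) -> gen S x -> exists w, x = free_lift g w.
Proof.
move=> Sg; elim=> {x} [x /Sg[i ->]||x y _ [u ->] _ [v ->]|x _ [u ->]].
- by exists (free_gen i); rewrite free_lift_gen.
- by exists 1; rewrite (hom_one (free_liftM g)).
- by exists (u * v); rewrite free_liftM.
by exists u^-1; rewrite (hom_inv _ (free_liftM g)).
Qed.

Lemma normal_closure_kernel (G H : groupType) (f : G -> H) (R : set G) x :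
  {morph f : x y / x * y} -> (forall r, R r -> f r = 1) -> normal_closure R x -> f x = 1.
Proof.
move=> fM fR Rx; apply: (Rx [set y | f y = 1]%classic); split; last exact: fR.
split=> [|u v /= fu fv|u /= fu|u v /= fu] /=.
- exact: hom_one.
- by rewrite fM fu fv mulg1.
- by rewrite (hom_inv _ fM) fu invg1.
by rewrite (hom_conj _ _ fM) fu conj1g.
Qed.

Lemma normal_closure_sub (G : groupType) (R : set G) x : R x -> normal_closure R x.
Proof. by move=> Rx N [_ NR]; apply: NR. Qed.

(** A homomorphism that kills a set of defining relators depends on the element
presented and not on the word that represents it. *)
Lemma presents_lift k (G H : groupType) (R : set (free_group k)) (g : k.-tuple H)
    (h : k.-tuple G) u v :
  presents R g -> (forall r, R r -> free_lift h r = 1) ->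
  free_lift g u = free_lift g v -> free_lift h u = free_lift h v.
Proof.
move=> pR hR uv; apply: (mulIg (free_lift h v)^-1); rewrite mulgV.
rewrite -(hom_inv _ (free_liftM h)) -free_liftM.
apply: (normal_closure_kernel (free_liftM h) hR); apply/pR.
by rewrite free_liftM (hom_inv _ (free_liftM g)) uv mulgV.
Qed.

Lemma presented_pi_morph (G : groupType) (R : set G) :
  {morph presented_pi R : x y / x * y}.
Proof. by move=> x y; rewrite -presented_piM. Qed.
Lemma presented_pi_rel (G : groupType) (R : set G) r : R r -> presented_pi R r = 1.
Proof.
by move=> Rr; apply/presented_piP; rewrite invg1 mulg1; apply: normal_closure_sub.
Qed.
End FreeLift.

Section Permutations.
Local Open Scope group_scope.
Variable m : nat.
Variable Pr : {perm 'I_m} -> Prop.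
Hypothesis Pr1 : Pr 1.
Hypothesis PrM : forall s t, Pr s -> Pr t -> Pr (s * t).
Hypothesis PrV : forall s, Pr s -> Pr s^-1.

(** A transposition of distant points is a shorter one conjugated by an adjacent
one; and a permutation fixing the points below [c] becomes one that also fixes
[c] after multiplication by a transposition. *)
Lemma adjacent_gen c : (forall i j : 'I_m, (c <= i)%N -> j = i.+1 :> nat -> Pr (tperm i j)) ->
  forall s : {perm 'I_m}, (forall i : 'I_m, (i < c)%N -> s i = i) -> Pr s.
Proof.
move=> adj.
have tr (i j : 'I_m) : (c <= i)%N -> (i < j)%N -> Pr (tperm i j).
  move=> ci; have [k] := ubnP j; elim: k j => // k IH j jk ij.
  have [e|e] := eqVneq (j : nat) i.+1; first exact: adj.
  have lt : (j.-1 < m)%N by apply: leq_ltn_trans (leq_pred _) (ltn_ord j).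
  pose l := Ordinal lt.
  have jl : j = l.+1 :> nat by rewrite /= prednK // (leq_ltn_trans _ ij).
  have il : (i < l)%N by rewrite -ltnS -jl ltn_neqAle eq_sym e ij.
  have -> : tperm i j = tperm i l ^ tperm l j.
    rewrite tpermJ tpermL tpermD // -val_eqE /= ?gtn_eqF //.
  rewrite conjgE; apply: PrM; first by apply: PrV; apply: adj => //; rewrite (leq_trans ci) // ltnW.
  apply: PrM; last by apply: adj => //; rewrite (leq_trans ci) // ltnW.
  by apply: IH => //; rewrite -ltnS -jl.
move=> s; have [k] := ubnP (m - c); elim: k c s {adj} tr => // k IH c s tr.
move=> mk sc; have [mc|cm] := leqP m c.
  have -> // : s = 1 by apply/permP => i; rewrite perm1 sc // (leq_trans _ mc).
pose i := Ordinal cm; have ci : (c <= s i)%N.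
  rewrite leqNgt; apply/negP => lt; have := sc _ lt; move/perm_inj => e.
  by move: lt; rewrite e ltnn.
have Pt : Pr (tperm i (s i)).
  move: ci; rewrite leq_eqVlt => /orP[/eqP e|lt]; last exact: tr.
  by have <- : i = s i; [exact: val_inj|rewrite tperm1].
have -> : s = s * tperm i (s i) * tperm i (s i) by rewrite -mulgA tperm2 mulg1.
apply: PrM => //; apply: (IH c.+1).
- by move=> j l cj; apply: tr; apply: ltnW.
- by rewrite -ltnS (leq_trans _ mk) // ltnS ltn_sub2l.
move=> j; rewrite ltnS leq_eqVlt permM => /orP[/eqP e|jc].
  by have -> : j = i; [exact: val_inj|rewrite tpermR].
rewrite (sc j) // tpermD // -val_eqE /= ?gtn_eqF //.
exact: leq_trans ci.
Qed.

(** Conjugation by [rho] shifts the base transposition to all adjacent ones.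
Membership of [rho] is required only when there is a transposition to shift,
that is when three points are at least [c]: for few points the relation that
names [rho] is missing. *)
Lemma cycle_gen c (rho : {perm 'I_m}) :
  (forall i j : 'I_m, i = c :> nat -> j = c.+1 :> nat -> Pr (tperm i j)) ->
  (forall i j l : 'I_m, (c <= i)%N -> j = i.+1 :> nat -> l = j.+1 :> nat ->
    [/\ Pr rho, rho i = j & rho j = l]) ->
  forall s : {perm 'I_m}, (forall i : 'I_m, (i < c)%N -> s i = i) -> Pr s.
Proof.
move=> base stp; apply: adjacent_gen => i j ci ji.
have [k] := ubnP (i : nat); elim: k i j ci ji => // k IH i j ci ji ik.
move: ci; rewrite leq_eqVlt => /orP[/eqP e|lt]; first by apply: base; rewrite // ji -e.
have lti : (i.-1 < m)%N by apply: leq_ltn_trans (leq_pred _) (ltn_ord i).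
pose l := Ordinal lti.
have il : i = l.+1 :> nat by rewrite /= prednK // (leq_ltn_trans _ lt).
have cl : (c <= l)%N by rewrite -ltnS -il.
have [Pro e1 e2] := stp l i j cl il ji.
rewrite -e2 -{1}e1 -tpermJ conjgE; apply: PrM; first exact: PrV.
by apply: PrM => //; apply: IH => //; rewrite -il.
Qed.
End Permutations.

(** * The orthogonal space and its isometries *)

Local Open Scope ring_scope.

Section Geometry.
Variables (F : finFieldType) (N : nat) (omega0 B : F).
Local Notation n := N.+4.
Local Notation dim := (n.-1.*2.+2).
Local Notation V := 'rV[F]_dim.
Local Notation I := 'I_N.+3.
Local Notation GL := {'GL_dim[F]}.
Local Notation Q := (@Qform F n omega0 B).
Implicit Types (x y u v : V) (i j : I) (g h : GL).

Lemma ei_val i : ei n i = i.*2 :> nat.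
Proof. by rewrite /ei inordK //; have := ltn_ord i; lia. Qed.
Lemma fi_val i : fi n i = i.*2.+1 :> nat.
Proof. by rewrite /fi inordK //; have := ltn_ord i; lia. Qed.
Lemma w1_val : w1i n = (N.+3).*2 :> nat.
Proof. by rewrite /w1i inordK. Qed.
Lemma w2_val : w2i n = (N.+3).*2.+1 :> nat.
Proof. by rewrite /w2i inordK. Qed.

Lemma idxP (k : 'I_dim) :
  [\/ exists i, k = ei n i, exists i, k = fi n i, k = w1i n | k = w2i n].
Proof.
have Hk : (k < (N.+3).*2.+2)%N := ltn_ord k; have Ek := odd_double_half k.
have [kl|kg] := ltnP (k./2)%N N.+3.
  case: (odd k) Ek => /= Ek; [apply: Or42|apply: Or41]; exists (Ordinal kl);
    apply: ord_inj; rewrite ?(ei_val (Ordinal kl)) ?(fi_val (Ordinal kl));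
    exact: (esym Ek).
have k3 : (k./2 = N.+3)%N.
  by apply/eqP; rewrite eqn_leq kg andbT -ltnS -ltn_double doubleS;
    apply: leq_ltn_trans Hk; rewrite -[leqRHS]Ek leq_addl.
rewrite k3 in Ek.
case: (odd k) Ek => /= Ek; [apply: Or44|apply: Or43];
  by apply: ord_inj; rewrite ?w1_val ?w2_val -Ek.
Qed.

(** The basis vector [e_i] is [sv (i, false)] and [f_i] is [sv (i, true)]; the
coordinates along these vectors are [cs], those in the anisotropic plane
[<w1, w2>] are [cw]. Sealing the value keeps unification from unfolding a vector
into a matrix; the matrices below are sealed for the same reason. *)
Fact sv_seal : {f : I * bool -> V |
  forall p, f p = bv F (if p.2 then fi n p.1 else ei n p.1)}.
Proof. by exists (fun p : I * bool => bv F (if p.2 then fi n p.1 else ei n p.1)). Qed.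
Definition sv := sval sv_seal.
Lemma svE p : sv p = bv F (if p.2 then fi n p.1 else ei n p.1).
Proof. exact: svalP sv_seal p. Qed.
Fact wv_seal : {f : F * F -> V |
  forall w, f w = w.1 *: bv F (w1i n) + w.2 *: bv F (w2i n)}.
Proof. by exists (fun w => w.1 *: bv F (w1i n) + w.2 *: bv F (w2i n)). Qed.
Definition wv := sval wv_seal.
Lemma wvE w : wv w = w.1 *: bv F (w1i n) + w.2 *: bv F (w2i n).
Proof. exact: svalP wv_seal w. Qed.
(** The other vector of the hyperbolic pair. *)
Definition np (p : I * bool) := (p.1, ~~ p.2).
Definition cw1 x : F := x 0 (w1i n).
Definition cw2 x : F := x 0 (w2i n).
Definition cw x : F * F := (cw1 x, cw2 x).

Definition cs x (p : I * bool) : F := x 0 (if p.2 then fi n p.1 else ei n p.1).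

Arguments cw1 : simpl never.
Arguments cw2 : simpl never.
Arguments cs : simpl never.

Lemma npK : involutive np.
Proof. by case=> i b; rewrite /np /= negbK. Qed.

Lemma sidx_inj (p q : I * bool) :
  ((if p.2 then fi n p.1 else ei n p.1) == (if q.2 then fi n q.1 else ei n q.1))
  = (p == q).
Proof.
case: p q => [i b] [j c] /=; apply/idP/idP => [/eqP/(congr1 val)/=|/eqP[-> ->] //].
case: b; case: c; rewrite ?ei_val ?fi_val => E.
- by move: E => [/double_inj/val_inj->].
- by have := congr1 odd E; rewrite /= !odd_double.
- by have := congr1 odd E; rewrite /= !odd_double.
- by move/double_inj/val_inj: E => ->.
Qed.

Lemma sidx_w (p : I * bool) :
  (((if p.2 then fi n p.1 else ei n p.1) == w1i n) = false) *
  (((if p.2 then fi n p.1 else ei n p.1) == w2i n) = false).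
Proof.
have lt : (((if p.2 then fi n p.1 else ei n p.1) : nat) < (N.+3).*2)%N.
  case: p => i [] /=; rewrite ?ei_val ?fi_val ?ltn_double //.
  by rewrite ltn_Sdouble.
by split; rewrite -val_eqE /= ?w1_val ?w2_val ltn_eqF // ltnW.
Qed.

Lemma w1w2 : (w1i n == w2i n) = false.
Proof. by rewrite -val_eqE /= w1_val w2_val ltn_eqF. Qed.

Lemma bvE (k l : 'I_dim) : bv F k 0 l = (l == k)%:R.
Proof. by rewrite mxE. Qed.

Lemma cs_sv p q : cs (sv p) q = (q == p)%:R.
Proof. by rewrite /cs svE bvE sidx_inj. Qed.
Lemma cs_wv w q : cs (wv w) q = 0.
Proof. by rewrite /cs wvE !mxE !sidx_w /= !mulr0 addr0. Qed.
Lemma cw_sv p : cw (sv p) = (0, 0).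
Proof. by rewrite /cw /cw1 /cw2 svE !bvE ![w1i n == _]eq_sym ![w2i n == _]eq_sym !sidx_w. Qed.
Lemma cw_wv w : cw (wv w) = w.
Proof.
rewrite /cw /cw1 /cw2 wvE !mxE !eqxx w1w2 eq_sym w1w2 /= !mulr0 !mulr1 add0r addr0.
by case: w.
Qed.
Lemma csD x y p : cs (x + y) p = cs x p + cs y p.
Proof. by rewrite /cs mxE. Qed.
Lemma csZ a x p : cs (a *: x) p = a * cs x p.
Proof. by rewrite /cs mxE. Qed.
Lemma cwD x y : cw (x + y) = ((cw x).1 + (cw y).1, (cw x).2 + (cw y).2).
Proof. by rewrite /cw /cw1 /cw2 !mxE. Qed.
Lemma cwZ a x : cw (a *: x) = (a * (cw x).1, a * (cw x).2).
Proof. by rewrite /cw /cw1 /cw2 !mxE. Qed.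
Lemma wvD w w' : wv (w.1 + w'.1, w.2 + w'.2) = wv w + wv w'.
Proof. by rewrite !wvE !scalerDl addrACA. Qed.
Lemma wvZ a w : wv (a * w.1, a * w.2) = a *: wv w.
Proof. by rewrite !wvE scalerDr !scalerA. Qed.
Lemma wv0 : wv (0, 0) = 0.
Proof. by rewrite !wvE !scale0r addr0. Qed.

Lemma vecP x y : (forall p, cs x p = cs y p) -> cw x = cw y -> x = y.
Proof.
move=> ec ew; apply/rowP => k.
case: (idxP k) => [[i ->]|[i ->]|->|->].
- exact: (ec (i, false)).
- exact: (ec (i, true)).
- exact: (congr1 fst ew).
- exact: (congr1 snd ew).
Qed.

Lemma cs_sum (J : Type) (r : seq J) (P : pred J) (f : J -> V) p :
  cs (\sum_(k <- r | P k) f k) p = \sum_(k <- r | P k) cs (f k) p.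
Proof. by rewrite /cs summxE. Qed.
Lemma cw_sum (J : Type) (r : seq J) (P : pred J) (f : J -> V) :
  (forall k, P k -> cw (f k) = (0, 0)) -> cw (\sum_(k <- r | P k) f k) = (0, 0).
Proof.
by move=> f0; rewrite /cw /cw1 /cw2 !summxE !big1 // => k /f0; case.
Qed.

Lemma vec_sum x : x = \sum_p cs x p *: sv p + wv (cw x).
Proof.
apply: vecP => [q|].
  rewrite csD cs_wv addr0 cs_sum (bigD1 q) //= csZ cs_sv eqxx mulr1 big1 ?addr0 //.
  by move=> p; rewrite eq_sym csZ cs_sv => /negPf->; rewrite mulr0.
rewrite cwD cw_wv cw_sum ?add0r -?surjective_pairing // => p _.
by rewrite cwZ cw_sv /= mulr0.
Qed.

Hypothesis F2 : 2%N \in [pchar F].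

Lemma addFF (a : F) : a + a = 0.
Proof. exact: addrr_pchar2. Qed.
Lemma addVV (x : V) : x + x = 0.
Proof. by apply/rowP => j; rewrite !mxE addFF. Qed.
Lemma addVK (x y : V) : x + y + y = x.
Proof. by rewrite -addrA addVV addr0. Qed.
(** Reduces an identity that holds in characteristic 2 to one that holds in any
commutative ring, once the doubled terms are collected in [c]. *)
Lemma eqF (a b c : F) : a = b + (c + c) -> a = b.
Proof. by rewrite addFF addr0. Qed.
Lemma addF_eq0 (a b : F) : a + b = 0 -> a = b.
Proof. by move=> /(congr1 (fun t => t + b)); rewrite -addrA addFF addr0 add0r. Qed.

(** The polar form of the quadratic form, see [QD]. *)
Definition bf x y : F :=
  \sum_i (cs x (i, false) * cs y (i, true) + cs x (i, true) * cs y (i, false))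
  + B * ((cw x).1 * (cw y).2 + (cw x).2 * (cw y).1).

Lemma bfC x y : bf x y = bf y x.
Proof.
rewrite /bf; congr (_ + _); last by ring.
by apply: eq_bigr => i _; ring.
Qed.
Lemma bfDl x y v : bf (x + y) v = bf x v + bf y v.
Proof.
rewrite /bf addrACA -big_split cwD -mulrDr /=; congr (_ + _ * _); last by ring.
by apply: eq_bigr => i _; rewrite !csD; ring.
Qed.
Lemma bfZl a x v : bf (a *: x) v = a * bf x v.
Proof.
rewrite /bf [RHS]mulrDr mulr_sumr cwZ /=; congr (_ + _); last by ring.
by apply: eq_bigr => i _; rewrite !csZ; ring.
Qed.
Lemma bfDr x y v : bf v (x + y) = bf v x + bf v y.
Proof. by rewrite bfC bfDl ![bf _ v]bfC. Qed.
Lemma bfZr a x v : bf v (a *: x) = a * bf v x.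
Proof. by rewrite bfC bfZl [bf _ v]bfC. Qed.
Lemma bf0l v : bf 0 v = 0.
Proof. by rewrite -[0](scale0r 0) bfZl mul0r. Qed.
Lemma bf0r v : bf v 0 = 0.
Proof. by rewrite bfC bf0l. Qed.

Lemma QE x : Q x = \sum_i cs x (i, false) * cs x (i, true)
  + (cw x).1 ^+ 2 + omega0 * (cw x).2 ^+ 2 + B * (cw x).1 * (cw x).2.
Proof. by []. Qed.

Lemma QD x y : Q (x + y) = Q x + Q y + bf x y.
Proof.
rewrite !QE /bf cwD /=; set s := \sum_i cs (x + y) _ * _.
have -> : s = \sum_i cs x (i, false) * cs x (i, true)
  + \sum_i cs y (i, false) * cs y (i, true)
  + \sum_i (cs x (i, false) * cs y (i, true) + cs x (i, true) * cs y (i, false)).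
  by rewrite -!big_split; apply: eq_bigr => i _; rewrite !csD /=; ring.
set a := \sum_i _; set b := \sum_i _; set c := \sum_i _.
apply: (@eqF _ _ ((cw x).1 * (cw y).1 + omega0 * ((cw x).2 * (cw y).2))).
rewrite /=; ring.
Qed.
Lemma QZ a x : Q (a *: x) = a ^+ 2 * Q x.
Proof.
rewrite !QE cwZ /= !mulrDr mulr_sumr; congr (_ + _ + _ + _); try by ring.
by apply: eq_bigr => i _; rewrite !csZ; ring.
Qed.
Lemma Q0 : Q 0 = 0.
Proof. by rewrite -[0](scale0r 0) QZ expr0n mul0r. Qed.
Lemma bfxx x : bf x x = 0.
Proof. by have := QD x x; rewrite addVV Q0 addFF add0r. Qed.

Lemma bf_sv x p : bf x (sv p) = cs x (np p).
Proof.
case: p => j b; rewrite /bf cw_sv /= !mulr0 addr0 mulr0 addr0.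
rewrite (bigD1 j) //= !cs_sv big1 ?addr0; last first.
  move=> i ij; rewrite !cs_sv !xpair_eqE (negPf ij) /=; ring.
by rewrite !xpair_eqE eqxx; case: b => /=; ring.
Qed.
Lemma bf_svsv p q : bf (sv p) (sv q) = (np q == p)%:R.
Proof. by rewrite bf_sv cs_sv. Qed.
Lemma bf_svwv p w : bf (sv p) (wv w) = 0.
Proof. by rewrite bfC bf_sv cs_wv. Qed.
Lemma bf_wvsv p w : bf (wv w) (sv p) = 0.
Proof. by rewrite bf_sv cs_wv. Qed.
Lemma bf_wv x w : bf x (wv w) = B * ((cw x).1 * w.2 + (cw x).2 * w.1).
Proof. by rewrite /bf cw_wv big1 ?add0r // => i _; rewrite !cs_wv; ring. Qed.
Lemma Q_sv p : Q (sv p) = 0.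
Proof.
rewrite QE cw_sv /= expr0n !mulr0 !addr0 big1 // => i _.
by rewrite !cs_sv; case: p => j []; rewrite !xpair_eqE /= ?andbF ?andbT /= ?mulr0n ?mul0r ?mulr0.
Qed.
Definition qw (w : F * F) := w.1 ^+ 2 + omega0 * w.2 ^+ 2 + B * w.1 * w.2.
Lemma Q_wv w : Q (wv w) = qw w.
Proof. by rewrite QE cw_wv big1 ?add0r // => i _; rewrite !cs_wv; ring. Qed.

Lemma qw10 : qw (1, 0) = 1.
Proof. by rewrite /qw /= expr1n expr0n /= !mulr0 !addr0. Qed.

Definition vact v g : V := v *m GLval g.
Local Notation "v '##' g" := (vact v g) (at level 39, left associativity).

Lemma vactM v g h : v ## (g * h)%g = v ## g ## h.
Proof. by rewrite /vact GL_MxE mulmxA. Qed.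
Lemma vact1 v : v ## 1%g = v.
Proof. by rewrite /vact GL_1E mulmx1. Qed.
Lemma vactK g v : v ## g ## g^-1%g = v.
Proof. by rewrite -vactM mulgV vact1. Qed.
Lemma vactVK g v : v ## g^-1%g ## g = v.
Proof. by rewrite -vactM mulVg vact1. Qed.
Lemma vactD g x y : (x + y) ## g = x ## g + y ## g.
Proof. exact: mulmxDl. Qed.
Lemma vactZ g a x : (a *: x) ## g = a *: (x ## g).
Proof. by rewrite /vact scalemxAl. Qed.
Lemma vact0 g : 0 ## g = 0.
Proof. exact: mul0mx. Qed.
Lemma vact_sum g (J : Type) (r : seq J) (P : pred J) (f : J -> V) :
  (\sum_(k <- r | P k) f k) ## g = \sum_(k <- r | P k) (f k ## g).
Proof. exact: mulmx_suml. Qed.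

Lemma gl_actP g h : (forall v, v ## g = v ## h) -> g = h.
Proof.
move=> E; apply: val_inj => /=; apply/row_matrixP => i; rewrite !rowE; exact: E.
Qed.

Lemma vact_ext g h : (forall p, sv p ## g = sv p ## h) ->
  (forall w, wv w ## g = wv w ## h) -> g = h.
Proof.
move=> es ew; apply: gl_actP => v; rewrite [v]vec_sum !vactD !vact_sum ew.
by congr (_ + _); apply: eq_bigr => p _; rewrite !vactZ es.
Qed.

Definition fmx (f : V -> V) : 'M[F]_dim := linmx (fun k => f (bv F k)).

Definition lin (f : V -> V) :=
  (forall x y, f (x + y) = f x + f y) /\ (forall a x, f (a *: x) = a *: f x).

Lemma mul_fmx f x : lin f -> x *m fmx f = f x.
Proof.
move=> [fD fZ]; have f0 : f 0 = 0 by have := fZ 0 0; rewrite !scale0r.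
rewrite [in RHS](row_sum_delta x) [in LHS](row_sum_delta x) mulmx_suml.
rewrite (big_morph f fD f0); apply: eq_bigr => k _.
by rewrite fZ -scalemxAl (bv_linmx _ k).
Qed.

Lemma fmx_unit f f' : lin f -> lin f' -> (forall x, f' (f x) = x) ->
  fmx f \in unitmx.
Proof.
move=> lf lf' K; suff /mulmx1_unit[] : fmx f *m fmx f' = 1%:M by [].
by apply/row_matrixP => i; rewrite !rowE mulmxA !mul_fmx // mulmx1.
Qed.

Lemma act_toGL f f' x : lin f -> lin f' -> (forall x, f' (f x) = x) ->
  x ## toGL (fmx f) = f x.
Proof. by move=> lf lf' K; rewrite /vact toGLK ?(fmx_unit lf lf') // mul_fmx. Qed.

(** The Siegel transformation of a singular [u] and a [v] orthogonal to [u], and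
the reflection in a nonsingular [u]; signs disappear in characteristic 2. *)
Definition Ef u v x := x + bf x u *: v + (bf x v + Q v * bf x u) *: u.
Definition Rf u x := x + (bf x u / Q u) *: u.

Lemma Ef_lin u v : lin (Ef u v).
Proof.
split=> [x y|a x]; apply/rowP => j; rewrite !mxE ?bfDl ?bfZl; ring.
Qed.
Lemma Rf_lin u : lin (Rf u).
Proof. by split=> [x y|a x]; apply/rowP => j; rewrite !mxE ?bfDl ?bfZl; ring. Qed.

Lemma EfK u v x : Q u = 0 -> bf u v = 0 -> Ef u v (Ef u v x) = x.
Proof.
move=> Qu uv; rewrite /Ef !bfDl !bfZl !bfxx (bfC v u) uv.
apply/rowP => j; rewrite !mxE.
set a := bf x u; set b := bf x v; set c := Q v.
by apply: (@eqF _ _ (a * v 0 j + (b + c * a) * u 0 j)); ring.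
Qed.
Lemma RfK u x : Q u != 0 -> Rf u (Rf u x) = x.
Proof.
move=> Qu; rewrite /Rf !bfDl !bfZl !bfxx; apply/rowP => j; rewrite !mxE.
by apply: (@eqF _ _ ((bf x u / Q u) * u 0 j)); ring.
Qed.

Fact E_seal : {f : V -> V -> GL | forall u v, f u v = toGL (fmx (Ef u v))}.
Proof. by exists (fun u v => toGL (fmx (Ef u v))). Qed.
Definition siegel := sval E_seal.
Local Notation E := siegel.
Lemma E_def u v : E u v = toGL (fmx (Ef u v)).
Proof. exact: svalP E_seal u v. Qed.
Fact R_seal : {f : V -> GL | forall u, f u = toGL (fmx (Rf u))}.
Proof. by exists (fun u => toGL (fmx (Rf u))). Qed.
Definition reflection := sval R_seal.
Local Notation R := reflection.
Lemma R_def u : R u = toGL (fmx (Rf u)).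
Proof. exact: svalP R_seal u. Qed.

Lemma actE u v x : Q u = 0 -> bf u v = 0 -> x ## E u v = Ef u v x.
Proof.
move=> Qu uv; rewrite E_def.
by apply: (act_toGL _ (Ef_lin u v) (Ef_lin u v)) => {}x; apply: EfK.
Qed.
Lemma actR u x : Q u != 0 -> x ## R u = Rf u x.
Proof.
move=> Qu; rewrite R_def.
by apply: (act_toGL _ (Rf_lin u) (Rf_lin u)) => {}x; apply: RfK.
Qed.

Definition iso g := forall v, Q (v ## g) = Q v.
Lemma iso_bf g x y : iso g -> bf (x ## g) (y ## g) = bf x y.
Proof.
move=> ig; have := ig (x + y); rewrite vactD !QD !ig.
by move/addrI.
Qed.
Lemma isoM g h : iso g -> iso h -> iso (g * h)%g.
Proof. by move=> ig ih v; rewrite vactM ih ig. Qed.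
Lemma isoV g : iso g -> iso g^-1%g.
Proof. by move=> ig v; rewrite -ig vactVK. Qed.
Lemma iso1 : iso 1%g.
Proof. by move=> v; rewrite vact1. Qed.
Lemma isoJ g h : iso g -> iso h -> iso (g ^ h)%g.
Proof. by move=> ig ih; rewrite conjgE; exact: isoM (isoV ih) (isoM ig ih). Qed.

Lemma E_iso u v : Q u = 0 -> bf u v = 0 -> iso (E u v).
Proof.
move=> Qu uv x; rewrite actE // /Ef !QD !QZ Qu !bfDl !bfZl !bfZr (bfC v u) uv.
set a := bf x u; set b := bf x v; set c := Q v.
by apply: (@eqF _ _ (a * b + a * a * c)); ring.
Qed.
Lemma R_iso u : Q u != 0 -> iso (R u).
Proof.
move=> Qu x; rewrite actR // /Rf !QD !QZ !bfZr.
by apply: (@eqF _ _ (bf x u ^+ 2 / Q u)); field.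
Qed.

Lemma EJ u v g : Q u = 0 -> bf u v = 0 -> iso g ->
  (E u v ^ g)%g = E (u ## g) (v ## g).
Proof.
move=> Qu uv ig; apply: gl_actP => x; rewrite conjgE !vactM !actE ?iso_bf ?ig //.
rewrite /Ef !vactD !vactZ vactVK.
by rewrite -(iso_bf _ u ig) -(iso_bf _ v ig) vactVK ig.
Qed.

Lemma E_add u v v' : Q u = 0 -> bf u v = 0 -> bf u v' = 0 ->
  (E u v * E u v')%g = E u (v + v').
Proof.
move=> Qu uv uv'; apply: gl_actP => x; rewrite vactM !actE ?bfDr ?uv ?uv' ?addr0 //.
rewrite /Ef !bfDl !bfZl !bfDr !bfxx (bfC v u) uv QD uv'.
apply/rowP => j; rewrite !mxE; ring.
Qed.
Lemma E_0 u : Q u = 0 -> E u 0 = 1%g.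
Proof.
move=> Qu; apply: gl_actP => x; rewrite actE ?bf0r // vact1 /Ef bf0r Q0 mul0r.
by rewrite scaler0 !addr0 scale0r addr0.
Qed.
Lemma E_sq u v : Q u = 0 -> bf u v = 0 -> (E u v * E u v)%g = 1%g.
Proof. by move=> Qu uv; rewrite E_add // addVV E_0. Qed.
Lemma E_swap u v a : Q u = 0 -> Q v = 0 -> bf u v = 0 ->
  E u (a *: v) = E v (a *: u).
Proof.
move=> Qu Qv uv; have vu : bf v u = 0 by rewrite bfC.
apply: gl_actP => x; rewrite !actE ?bfZr ?uv ?vu ?mulr0 //.
rewrite /Ef !QZ Qu Qv !bfZr; apply/rowP => j; rewrite !mxE; ring.
Qed.
Lemma E_scale u v a : Q u = 0 -> bf u v = 0 -> E (a *: u) v = E u (a *: v).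
Proof.
move=> Qu uv; apply: gl_actP => x.
rewrite !actE ?bfZr ?bfZl ?QZ ?Qu ?uv ?mulr0 //.
rewrite /Ef !QZ !bfZr; apply/rowP => j; rewrite !mxE; ring.
Qed.
(** The two reflections are in vectors of the plane [<u, v>] of equal value. This
is what makes a Siegel transformation even. *)
Lemma E_RR u v : Q u = 0 -> bf u v = 0 -> Q v != 0 ->
  E u v = (R v * R (v + Q v *: u))%g.
Proof.
move=> Qu uv Qv; apply: gl_actP => x; rewrite vactM actE //.
have Q' : Q (v + Q v *: u) = Q v.
  by rewrite QD QZ Qu bfZr bfC uv !mulr0 !addr0.
rewrite !actR ?Q' // /Rf Q' /Ef !bfDl !bfDr !bfZl !bfZr !bfxx (bfC v u) uv.
apply/rowP => j; rewrite !mxE.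
set a := bf x u; set b := bf x v.
apply/esym; apply: (@eqF _ _ (b / Q v * v 0 j)); rewrite -[RHS]addr0.
have -> : b = b / Q v * Q v by rewrite divfK.
by set d := b / Q v; field.
Qed.

Definition perm_sv (s : {perm I}) (p : I * bool) := (s p.1, p.2).
Definition Pf (s : {perm I}) x :=
  \sum_p cs x p *: sv (perm_sv s p) + wv (cw x).
Lemma Pf_lin s : lin (Pf s).
Proof.
split=> [x y|a x]; rewrite /Pf.
  rewrite cwD wvD addrACA -big_split; congr (_ + _).
  by apply: eq_bigr => p _; rewrite csD scalerDl.
rewrite cwZ wvZ scalerDr scaler_sumr; congr (_ + _).
by apply: eq_bigr => p _; rewrite csZ scalerA.
Qed.
Lemma Pf_sv s p : Pf s (sv p) = sv (perm_sv s p).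
Proof.
rewrite /Pf cw_sv wv0 addr0 (bigD1 p) //= cs_sv eqxx scale1r big1 ?addr0 //.
by move=> q qp; rewrite cs_sv (negPf qp) scale0r.
Qed.
Lemma Pf_wv s w : Pf s (wv w) = wv w.
Proof. by rewrite /Pf cw_wv big1 ?add0r // => p _; rewrite cs_wv scale0r. Qed.
Lemma lin_ext f f' : lin f -> lin f' -> (forall p, f (sv p) = f' (sv p)) ->
  (forall w, f (wv w) = f' (wv w)) -> forall x, f x = f' x.
Proof.
move=> lf lf' es ew x; rewrite -(mul_fmx x lf) -(mul_fmx x lf').
rewrite [x]vec_sum !mulmxDl !mulmx_suml (mul_fmx (wv _) lf) (mul_fmx (wv _) lf') ew.
by congr (_ + _); apply: eq_bigr => p _; rewrite -!scalemxAl !mul_fmx ?es.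
Qed.
Lemma PfM s t x : Pf t (Pf s x) = Pf (s * t) x.
Proof.
have [[D1 Z1] [D2 Z2]] := (Pf_lin s, Pf_lin t).
apply: (lin_ext (f := fun x => Pf t (Pf s x)) (f' := Pf (s * t)%g)).
- by split=> [y1 y2|a y]; [rewrite D1 D2|rewrite Z1 Z2].
- exact: Pf_lin.
- by move=> p; rewrite !Pf_sv /perm_sv permM.
- by move=> w; rewrite !Pf_wv.
Qed.
Lemma Pf1 x : Pf 1%g x = x.
Proof.
rewrite [RHS]vec_sum; congr (_ + _); apply: eq_bigr => p _.
by rewrite /perm_sv perm1; case: p.
Qed.
Fact Pg_seal : {f : {perm I} -> GL | forall s, f s = toGL (fmx (Pf s))}.
Proof. by exists (fun s => toGL (fmx (Pf s))). Qed.
Definition Pg := sval Pg_seal.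
Lemma Pg_def s : Pg s = toGL (fmx (Pf s)).
Proof. exact: svalP Pg_seal s. Qed.
Lemma actP s x : x ## Pg s = Pf s x.
Proof.
rewrite Pg_def.
apply: (act_toGL _ (Pf_lin s) (Pf_lin s^-1%g)) => y.
by rewrite PfM mulgV Pf1.
Qed.
Lemma actP_sv s p : sv p ## Pg s = sv (perm_sv s p).
Proof. by rewrite actP Pf_sv. Qed.
Lemma actP_wv s w : wv w ## Pg s = wv w.
Proof. by rewrite actP Pf_wv. Qed.
Lemma PgM s t : Pg (s * t)%g = (Pg s * Pg t)%g.
Proof. by apply: gl_actP => x; rewrite vactM !actP PfM. Qed.
Lemma Pg1 : Pg 1%g = 1%g.
Proof. by apply: gl_actP => x; rewrite actP Pf1 vact1. Qed.
Lemma cs_Pf s x p : cs (Pf s x) p = cs x (perm_sv s^-1%g p).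
Proof.
rewrite /Pf csD cs_wv addr0 cs_sum (bigD1 (perm_sv s^-1%g p)) //=.
rewrite csZ cs_sv /perm_sv /= permKV -surjective_pairing eqxx mulr1.
rewrite big1 ?addr0 // => q qp; rewrite csZ cs_sv.
have [e|_] := eqVneq p _; last by rewrite mulr0.
by case/eqP: qp; rewrite e /= permK -surjective_pairing.
Qed.
Lemma cw_Pf s x : cw (Pf s x) = cw x.
Proof.
rewrite /Pf cwD cw_wv cw_sum ?add0r // => p _.
by rewrite cwZ cw_sv /= mulr0.
Qed.
Lemma Pg_iso s : iso (Pg s).
Proof.
move=> x; rewrite actP !QE !cw_Pf; congr (_ + _ + _ + _).
rewrite (reindex_inj (@perm_inj _ s)) /=; apply: eq_bigr => i _.
by rewrite !cs_Pf /perm_sv /= permK.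
Qed.

End Geometry.
Arguments wv {F N} w.

(** * The generators as isometries *)

Notation "v '##' g" := (vact v g) (at level 39, left associativity).

Section Generators.
Variables (F : finFieldType) (N : nat) (omega0 A B C : F).
Hypothesis F2 : 2%N \in [pchar F].
Hypothesis w0 : omega0 != 0.
Hypothesis BC : B = C * omega0.
Hypothesis AE : A = 1 + B * C.
Local Notation n := N.+4.
Local Notation dim := (n.-1.*2.+2).
Local Notation V := 'rV[F]_dim.
Local Notation I := 'I_N.+3.
Local Notation GL := {'GL_dim[F]}.
Local Notation Q := (@Qform F n omega0 B).
Local Notation E := (siegel omega0 B).
Local Notation R := (reflection omega0 B).
Local Notation bf := (bf B).
Local Notation sv := (@sv F N).
Local Notation iso := (iso omega0 B).
Implicit Types (x y u v : V) (i j : I) (g h : GL).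

Definition o0 : I := @Ordinal N.+3 0 isT.
Definition o1 : I := @Ordinal N.+3 1 isT.
Definition o2 : I := @Ordinal N.+3 2 isT.

Lemma ABC_1 : A + B * C = 1.
Proof. by rewrite AE -addrA addFF // addr0. Qed.

Lemma gen_act f p : linmx f \in unitmx ->
  sv p ## toGL (@linmx F n f) = f (if p.2 then fi n p.1 else ei n p.1).
Proof. by move=> fu; rewrite svE /vact toGLK // bv_linmx. Qed.
Lemma gen_actw f w : linmx f \in unitmx ->
  wv w ## toGL (@linmx F n f) = w.1 *: f (w1i n) + w.2 *: f (w2i n).
Proof.
by move=> fu; rewrite wvE /vact toGLK // mulmxDl -!scalemxAl !bv_linmx.
Qed.

Lemma idx_w1 (k : I * bool) : (w1i n == (if k.2 then fi n (k.1 : I) else ei n k.1)) = false.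
Proof. by rewrite eq_sym (sidx_w k). Qed.
Lemma idx_w2 (k : I * bool) : (w2i n == (if k.2 then fi n (k.1 : I) else ei n k.1)) = false.
Proof. by rewrite eq_sym (sidx_w k). Qed.

Let key p (q : I * bool) := sidx_inj p q.

Definition sigma_g : GL := toGL (sigma_mx F n).
Definition tau_g : GL := toGL (tau_mx n B).
Definition delta_g : GL := toGL (delta_mat n omega0 A B C).
Definition z_g : GL := toGL (z_mx n B).
Definition U_g : GL := toGL (U_mx F n).

Lemma sigmaE : sigma_g = E (sv (o0, true)) (sv (o1, false)).
Proof.
have su := sigma_unit (n := n) isT F2.
have Qu := Q_sv omega0 B (o0, true) : Q (sv _) = 0.
have uv : bf (sv (o0, true)) (sv (o1, false)) = 0 by rewrite bf_svsv.
apply: vact_ext => [p|w]; rewrite actE //; last first.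
  rewrite gen_actw //= (idx_w1 (o0, false)) (idx_w1 (o1, true)).
  rewrite (idx_w2 (o0, false)) (idx_w2 (o1, true)).
  by rewrite /Ef !bf_wvsv mulr0 !addr0 !scale0r !addr0 wvE.
rewrite gen_act //= (key p (o0, false)) (key p (o1, true)) /Ef !bf_svsv Q_sv.
rewrite mul0r addr0 /np /= ![(_, _) == p]eq_sym.
have [->|p1] := eqVneq p (o0, false); first by rewrite !svE /= scale1r scale0r addr0.
have [->|p2] := eqVneq p (o1, true); first by rewrite !svE /= scale1r scale0r addr0.
by rewrite !scale0r !addr0 !svE.
Qed.

Lemma tauE : tau_g = E (sv (o0, true)) (wv (1, 0)).
Proof.
have su := tau_unit (n := n) B isT F2.
have Qu := Q_sv omega0 B (o0, true) : Q (sv _) = 0.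
have uv : bf (sv (o0, true)) (wv (1, 0)) = 0 by rewrite bf_svwv.
apply: vact_ext => [p|w]; rewrite actE //; last first.
  rewrite gen_actw //= (idx_w1 (o0, false)) (idx_w2 (o0, false)).
  rewrite w1w2 eqxx /Ef !bf_wvsv bf_wv cw_wv /=.
  rewrite !(mulr0, mulr1, addr0, add0r, scale0r) wvE svE scalerDr addrA scalerA.
  by rewrite [w.2 * B]mulrC.
rewrite gen_act //= (key p (o0, false)) sidx_w /Ef !bf_svsv bf_svwv Q_wv.
rewrite /qw /= expr0n /= !mulr0 expr1n !addr0 mul1r add0r /np /= [(_, _) == p]eq_sym.
have [->|p1] := eqVneq p (o0, false).
  by rewrite !scale1r !svE wvE /= scale1r scale0r addr0 addrAC.
by rewrite !scale0r !addr0 svE.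
Qed.

(** The actions of [z] and of [delta] on the anisotropic plane are [wz] and [wd];
on the hyperbolic basis they are given by [flip] and [dsc]. *)
Definition wz (w : F * F) := (w.1 + B * w.2, w.2).
Definition wd (w : F * F) := (A * w.1 + B * w.2, C * w.1 + w.2).
Definition flip i p : I * bool := if p.1 == i then np p else p.
Definition dsc i p : F := if p.1 == i then (if p.2 then omega0 else omega0^-1) else 1.

Lemma z_g_sv p : sv p ## z_g = sv (flip o0 p).
Proof.
have zu := z_unit (n := n) B isT F2.
rewrite gen_act //= (key p (o0, false)) (key p (o0, true)) sidx_w /flip.
case: p => i b; rewrite !xpair_eqE /=.
by case: eqP => [->|_]; case: b; rewrite !svE.
Qed.
Lemma z_g_wv w : wv w ## z_g = wv (wz w).
Proof.
have zu := z_unit (n := n) B isT F2.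
rewrite gen_actw //= (idx_w1 (o0, false)) (idx_w2 (o0, false)).
rewrite (idx_w1 (o0, true)) (idx_w2 (o0, true)) w1w2 eqxx wvE.
by apply/rowP => j; rewrite /wz /= !mxE; ring.
Qed.
Lemma delta_g_sv p : sv p ## delta_g = dsc o0 p *: sv p.
Proof.
have du := delta_unit (n := n) isT F2 w0 ABC_1.
rewrite gen_act //=.
rewrite (key p (o0, false)) (key p (o0, true)) !sidx_w /dsc.
case: p => i b; rewrite !xpair_eqE /=.
by case: eqP => [->|_]; case: b; rewrite ?scale1r !svE.
Qed.
Lemma delta_g_wv w : wv w ## delta_g = wv (wd w).
Proof.
have du := delta_unit (n := n) isT F2 w0 ABC_1.
rewrite gen_actw //=.
rewrite (idx_w1 (o0, false)) (idx_w2 (o0, false)).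
rewrite (idx_w1 (o0, true)) (idx_w2 (o0, true)) w1w2 !eqxx eq_sym w1w2 wvE /=.
by apply/rowP => j; rewrite /wd /= !mxE; ring.
Qed.
Lemma UE : U_g = Pg F (tperm o0 o1).
Proof.
have su := U_unit F (n := n) isT.
apply: vact_ext => [p|w]; last first.
  rewrite actP_wv gen_actw //= (idx_w1 (o0, false)) (idx_w2 (o0, false)).
  rewrite (idx_w1 (o0, true)) (idx_w2 (o0, true)).
  rewrite (idx_w1 (o1, false)) (idx_w2 (o1, false)).
  by rewrite (idx_w1 (o1, true)) (idx_w2 (o1, true)) wvE.
rewrite gen_act // actP_sv /= (key p (o0, false)) (key p (o0, true)).
rewrite (key p (o1, false)) (key p (o1, true)) /perm_sv.
case: p => i b; rewrite !xpair_eqE /=.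
case: tpermP => [->|->|/eqP/negPf-> /eqP/negPf->]; case: b; by rewrite /= svE.
Qed.

Lemma refl_values :
  ((Q (sv (o0, false) + sv (o0, true)) = 1) * (Q (wv (1, 0)) = 1) *
   (Q (sv (o0, false) + omega0 *: sv (o0, true)) = omega0) *
   (Q (wv (B, 1)) = omega0))%type.
Proof.
do !split; rewrite ?Q_wv ?qw10 ?QD // ?QZ ?bfZr ?Q_sv ?bf_svsv ?eqxx ?mulr0 ?mulr1 ?add0r //.
by rewrite /qw /= expr1n !mulr1 addrAC -expr2 addFF // add0r.
Qed.

(** This factorisation shows at once that [z] is an isometry and that it is even;
[dRR] does the same for [delta]. *)
Lemma zRR : z_g = (R (sv (o0, false) + sv (o0, true)) * R (wv (1%R, 0%R)))%g.
Proof.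
have [[[Q1 Q2] _] _] := refl_values.
apply: vact_ext => [p|w]; rewrite vactM !actR ?Q1 ?Q2 ?oner_eq0 // ?z_g_sv ?z_g_wv.
  rewrite /Rf Q1 Q2 !divr1 !(bfDl, bfZl, bfDr, bf_svsv, bf_svwv).
  rewrite !(mulr0, addr0, scale0r) /flip /np /=.
  case: p => i b; rewrite !xpair_eqE /= eq_sym; case: eqP => [->|_] /=; last first.
    by rewrite add0r scale0r addr0.
  case: b; rewrite /= ?addr0 ?add0r scale1r.
    by rewrite addrC addVK.
  by rewrite addrA addVV // add0r.
rewrite /Rf Q1 Q2 !divr1 !bfDr !bf_wvsv addr0 scale0r addr0 bf_wv cw_wv /=.
rewrite mulr0 mulr1 add0r !wvE /wz /= scalerDr scale0r scaler0 addr0 scalerA mulr1.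
by rewrite scalerDl addrAC.
Qed.

Lemma dRR : delta_g = (R (sv (o0, false) + sv (o0, true))
  * R (sv (o0, false) + omega0 *: sv (o0, true))
  * (R (wv (1%R, 0%R)) * R (wv (B, 1%R))))%g.
Proof.
have [[[Q1 Q2] Q3] Q4] := refl_values.
apply: vact_ext => [p|w]; rewrite !vactM !actR ?Q1 ?Q2 ?Q3 ?Q4 ?oner_eq0 // ?delta_g_sv ?delta_g_wv.
  rewrite /Rf Q1 Q2 Q3 Q4 !divr1.
  rewrite !(bfDl, bfZl, bfDr, bfZr, bf_svsv, bf_svwv, bf_wvsv).
  rewrite !(mulr0, addr0, mul0r, scale0r) /dsc /np /=.
  case: p => i b; rewrite !xpair_eqE /= ?eqxx eq_sym; case: eqP => [->|_] /=; last first.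
    by rewrite !(mulr0, mul0r, addr0, add0r, scale0r, scale1r, addr0).
  case: b; rewrite /= !(mulr0, mulr1, addr0, add0r, mul1r); apply/rowP => j; rewrite !mxE.
    by apply/esym/(eqF F2 (c := sv (i, true) 0 j + sv (i, false) 0 j
    + (sv (i, false) 0 j + omega0 * sv (i, true) 0 j) / omega0)); field.
  by apply/esym/(eqF F2 (c := sv (i, false) 0 j + sv (i, true) 0 j
    + sv (i, false) 0 j + omega0 * sv (i, true) 0 j)); field.
rewrite /Rf Q1 Q2 Q3 Q4 !divr1.
rewrite !(bfDl, bfZl, bfDr, bfZr, bf_wvsv, bf_svwv, bf_wv).
rewrite !(mulr0, addr0, mul0r, scale0r) !cw_wv /wd /= !wvE /=; apply/rowP => j; rewrite !mxE.
set a := (_ && (j == w1i n))%:R; set b := (_ && (j == w2i n))%:R.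
apply/esym; apply: (eqF F2 (c := C * B * w.2 * (B * a + b))).
by rewrite AE BC; field.
Qed.

Lemma z_iso : iso z_g.
Proof. by rewrite zRR; apply: isoM; apply: R_iso; rewrite ?refl_values ?oner_eq0. Qed.
Lemma delta_iso : iso delta_g.
Proof.
by rewrite dRR; apply: isoM; apply: isoM; apply: R_iso; rewrite ?refl_values ?oner_eq0.
Qed.

Fact Zg_seal : {f : I -> GL | forall i, f i = (z_g ^ Pg F (tperm o0 i))%g}.
Proof. by exists (fun i => z_g ^ Pg F (tperm o0 i))%g. Qed.
Definition Zg := sval Zg_seal.
Lemma ZgE i : Zg i = (z_g ^ Pg F (tperm o0 i))%g.
Proof. exact: svalP Zg_seal i. Qed.
Fact Dg_seal : {f : I -> GL | forall i, f i = (delta_g ^ Pg F (tperm o0 i))%g}.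
Proof. by exists (fun i => delta_g ^ Pg F (tperm o0 i))%g. Qed.
Definition Dg := sval Dg_seal.
Lemma DgE i : Dg i = (delta_g ^ Pg F (tperm o0 i))%g.
Proof. exact: svalP Dg_seal i. Qed.

Lemma PgV s : ((Pg F s)^-1 = Pg F s^-1 :> GL)%g.
Proof. by apply: (mulgI (Pg F s)); rewrite mulgV -PgM mulgV Pg1. Qed.

Lemma Zg_sv i p : sv p ## Zg i = sv (flip i p).
Proof.
rewrite ZgE conjgE !vactM PgV tpermV actP_sv z_g_sv actP_sv; congr sv.
case: p => j b; rewrite /perm_sv /flip /= (can2_eq (tpermK _ _) (tpermK _ _)) tpermL.
by case: eqP => _ /=; rewrite /np /= tpermK.
Qed.
Lemma Zg_wv i w : wv w ## Zg i = wv (wz w).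
Proof. by rewrite ZgE conjgE !vactM PgV actP_wv z_g_wv actP_wv. Qed.
Lemma Zg_iso i : iso (Zg i).
Proof. by rewrite ZgE; apply: isoJ z_iso (Pg_iso _ _ _). Qed.
Lemma Dg_sv i p : sv p ## Dg i = dsc i p *: sv p.
Proof.
rewrite DgE conjgE !vactM PgV tpermV actP_sv delta_g_sv vactZ actP_sv.
case: p => j b; rewrite /perm_sv /dsc /= tpermK (can2_eq (tpermK _ _) (tpermK _ _)).
by rewrite tpermL.
Qed.
Lemma Dg_wv i w : wv w ## Dg i = wv (wd w).
Proof. by rewrite DgE conjgE !vactM PgV actP_wv delta_g_wv actP_wv. Qed.
Lemma Dg_iso i : iso (Dg i).
Proof. by rewrite DgE; apply: isoJ delta_iso (Pg_iso _ _ _). Qed.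

End Generators.

(** * Parity of reflections *)

Section Parity.
Variables (F : finFieldType) (N : nat) (omega0 B : F).
Hypothesis F2 : 2%N \in [pchar F].
Hypothesis B0 : B != 0.
Local Notation n := N.+4.
Local Notation dim := (n.-1.*2.+2).
Local Notation V := 'rV[F]_dim.
Local Notation I := 'I_N.+3.
Local Notation GL := {'GL_dim[F]}.
Local Notation Q := (@Qform F n omega0 B).
Local Notation E := (siegel omega0 B).
Local Notation R := (reflection omega0 B).
Local Notation bf := (bf B).
Local Notation sv := (@sv F N).
Local Notation iso := (iso omega0 B).
Implicit Types (x y u v : V) (i j : I) (g h : GL).

Lemma bf_nondeg x : (forall y, bf x y = 0) -> x = 0.
Proof.
move=> x0; apply: vecP => [p|]; first by rewrite -[p]npK -(bf_sv B) x0 /cs mxE.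
have e w := x0 (wv w); have := (e (1, 0), e (0, 1)).
rewrite !bf_wv /= !mulr0 !mulr1 add0r addr0 => -[/eqP + /eqP].
rewrite !mulf_eq0 (negPf B0) /= /cw => /eqP-> /eqP->.
by rewrite /cw1 /cw2 !mxE.
Qed.

(** Nondegeneracy: every linear functional is [bf^~ v] for some [v]. *)
Lemma functional_bf (c : 'cV[F]_dim) : exists v, forall y, (y *m c) 0 0 = bf y v.
Proof.
pose f y := (y *m c) 0 0.
have fD x y : f (x + y) = f x + f y by rewrite /f mulmxDl mxE.
have fZ a x : f (a *: x) = a * f x by rewrite /f -scalemxAl mxE.
have f0 : f 0 = 0 by rewrite /f mul0mx mxE.
exists (\sum_p f (sv (np p)) *: sv p + wv (f (wv (0, 1)) / B, f (wv (1, 0)) / B)).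
move=> y; rewrite -/(f y) [in LHS](vec_sum y) fD bfDr bf_wv (big_morph f fD f0).
congr (_ + _).
  rewrite bfC; have bD := fun x z => bfDl B x z y.
  rewrite (big_morph (bf^~ y) bD (bf0l B y)) (reindex_inj (inv_inj (@npK N))) /=.
  by apply: eq_bigr => p _; rewrite fZ bfZl bfC bf_sv mulrC.
have -> : wv (cw y) = cw1 y *: wv (1, 0) + cw2 y *: wv (0, 1) :> V.
  by rewrite -!wvZ -wvD /= !(mulr0, mulr1, addr0, add0r).
by rewrite fD !fZ /=; field.
Qed.

Definition oddr g := odd (\rank (GLval g - 1%:M)).

Lemma mulT v g : v *m (GLval g - 1%:M) = v ## g + v.
Proof. by rewrite mulmxBr mulmx1; apply/rowP => j; rewrite !mxE oppr_pchar2. Qed.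

Lemma RV u : Q u != 0 -> (R u * R u = 1)%g.
Proof. by move=> Qu; apply: gl_actP => x; rewrite vactM !actR // RfK // vact1. Qed.

(** The maps [g - 1] and [g R - 1], with [R] the reflection in [u], differ by a
map onto the line of [u], so their ranks differ by at most one. The vectors fixed
by [g] are orthogonal to [u], hence fixed by [g R]; and [g R] fixes [x], which [g]
moves. *)
Lemma rank_decr g u x : iso g -> Q u != 0 -> u = x ## g + x ->
  (\rank (GLval g - 1%:M)%R = (\rank (GLval (g * R u)%g - 1%:M)%R).+1)%N.
Proof.
move=> ig Qu ux.
have Tr v : v *m (GLval (g * R u)%g - 1%:M) = v *m (GLval g - 1%:M)
    + (bf (v ## g) u / Q u) *: u.
  by rewrite !mulT vactM actR // /Rf addrAC.
have fixP v : v *m (GLval g - 1%:M) = 0 -> bf (v ## g) u = 0.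
  rewrite mulT => vf; have vg : v ## g = v by rewrite -[LHS](addVK F2 _ v) vf add0r.
  by rewrite ux bfDr (iso_bf F2 _ _ ig) vg addFF.
have xf : x *m (GLval (g * R u)%g - 1%:M) = 0.
  rewrite Tr mulT -ux; suff -> : bf (x ## g) u = Q u by rewrite divff // scale1r addVV.
  rewrite {2}ux QD // ig addFF // add0r ux bfDr bfxx // add0r //.
pose D := GLval (g * R u)%g - GLval g.
have TD : GLval g - 1%:M = GLval (g * R u)%g - 1%:M - D.
  by rewrite /D opprB [RHS]addrC addrA subrK.
have Du : (D <= u)%MS.
  apply/row_subP => k; rewrite rowE.
  have -> : D = (GLval (g * R u)%g - 1%:M) - (GLval g - 1%:M).
    by rewrite TD opprB addrC subrK.
  by rewrite mulmxBr Tr addrAC subrr add0r scalemx_sub.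
apply/eqP; rewrite eqn_leq; apply/andP; split.
  rewrite {1}TD (leq_trans (mxrank_add _ _)) // mxrank_opp.
  have le1 := leq_trans (mxrankS Du) (rank_leq_row _).
  by apply: (leq_trans (leq_add (leqnn _) le1)); rewrite addn1.
have lt : (kermx (GLval g - 1%:M) < kermx (GLval (g * R u)%g - 1%:M))%MS.
  rewrite ltmxE; apply/andP; split.
    apply/sub_kermxP/row_matrixP => k; rewrite row_mul row0 Tr.
    have vk : row k (kermx (GLval g - 1%:M)) *m (GLval g - 1%:M) = 0.
      by rewrite -row_mul mulmx_ker row0.
    by rewrite vk fixP // mul0r scale0r addr0.
  apply/negP => le; have := submx_trans (introT sub_kermxP xf) le.
  by move/sub_kermxP; rewrite mulT -ux => u0; move: Qu; rewrite u0 Q0 eqxx.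
have := rank_ltmx lt; rewrite !mxrank_ker.
have := rank_leq_row (GLval g - 1%:M); have := rank_leq_row (GLval (g * R u)%g - 1%:M).
by move: (\rank _) (\rank _) => a b; lia.
Qed.

(** If [u] is in the image of [g - 1], then [rank_decr] applies. Otherwise some
vector fixed by [g] is not orthogonal to [u]; then [u] is in the image of
[g R - 1], and [rank_decr] applies to [g R], since [g R R = g]. *)
Lemma oddr_R g u : iso g -> Q u != 0 -> oddr (g * R u)%g = ~~ oddr g.
Proof.
move=> ig Qu; rewrite /oddr.
have [/submxP[x ux]|] := boolP (u <= GLval g - 1%:M)%MS.
  by rewrite mulT in ux; rewrite (rank_decr ig Qu ux) /= negbK.
rewrite submxE => /negP nu.
have [v [Tv uv]] : exists v, (forall y, bf (y ## g + y) v = 0) /\ bf u v != 0.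
  move: nu; set c := cokermx _ => nu.
  have [k ck] : exists k, (u *m c) 0 k != 0.
    apply: contrapT => nk; apply: nu; apply/eqP/rowP => k; rewrite [RHS]mxE.
    by apply/eqP; apply: contrapT => /negP ck; apply: nk; exists k.
  have [v vP] := functional_bf (col k c).
  have cE y : (y *m col k c) 0 0 = (y *m c) 0 k by rewrite colE mulmxA -colE mxE.
  exists v; split=> [y|]; rewrite -vP cE //.
  by rewrite -mulT -mulmxA /c mulmx_coker mulmx0 mxE.
have vg : v ## g + v = 0.
  apply: bf_nondeg => y; rewrite -[y](vactVK g); set y' := y ## _.
  by rewrite bfDl (iso_bf F2 _ _ ig) -bfDr bfC addrC Tv.
have {}vg : v ## g = v by rewrite -(addVK F2 (v ## g) v) vg add0r.
have ux : u = ((Q u / bf v u) *: v) ## (g * R u)%g + (Q u / bf v u) *: v.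
  rewrite vactZ vactM vg actR // -scalerDr /Rf addrAC addVV // add0r scalerA.
  rewrite (_ : _ * _ = 1) ?scale1r //.
  by move: uv; rewrite bfC => uv; field; rewrite uv Qu.
have iR := isoM ig (R_iso F2 Qu).
rewrite (rank_decr iR Qu ux) -mulgA RV // mulg1 /=.
by [].
Qed.

Lemma oddrJ g h : oddr (g ^ h)%g = oddr g.
Proof.
rewrite /oddr; have -> : GLval (g ^ h)%g - 1%:M
    = GLval h^-1%g *m (GLval g - 1%:M) *m GLval h.
  have e : GLval h^-1%g *m GLval h = 1%:M by rewrite -GL_MxE mulVg GL_1E.
  by rewrite conjgE !GL_MxE -mulmxA mulmxBl mul1mx mulmxBr e.
rewrite mxrankMfree; last by rewrite row_free_unit GL_unitmx.
by rewrite -mxrank_tr trmx_mul mxrankMfree ?mxrank_tr // row_free_unit unitmx_tr GL_unitmx.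
Qed.

(** Evenness is stated as invariance of the parity under multiplication, so that
closure under products needs no additivity of the parity. *)
Definition even_iso g := iso g /\ forall h, iso h -> oddr (h * g)%g = oddr h.

Lemma even_isoM g h : even_iso g -> even_iso h -> even_iso (g * h)%g.
Proof.
move=> [ig eg] [ih eh]; split; first exact: isoM.
by move=> k ik; rewrite mulgA eh ?eg //; apply: isoM.
Qed.
Lemma even_iso1 : even_iso 1%g.
Proof. by split=> [|h _]; [apply: iso1|rewrite mulg1]. Qed.
Lemma even_isoV g : even_iso g -> even_iso g^-1%g.
Proof.
move=> [ig eg]; split; first exact: isoV.
by move=> h ih; rewrite -[in RHS](mulgVK g h) eg //; apply: isoM ih (isoV ig).
Qed.
Lemma even_iso_RR u v : Q u != 0 -> Q v != 0 -> even_iso (R u * R v)%g.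
Proof.
move=> Qu Qv; split; first by apply: isoM; apply: R_iso.
by move=> h ih; rewrite mulgA !oddr_R ?negbK //; apply: isoM => //; apply: R_iso.
Qed.
Lemma even_iso_oddr g : even_iso g -> oddr g = false.
Proof.
move=> [_ eg]; have := eg _ (iso1 _ _); rewrite mul1g => ->.
by rewrite /oddr GL_1E subrr mxrank0.
Qed.
Lemma even_iso_oddr_R g u : even_iso g -> Q u != 0 -> oddr (g * R u)%g.
Proof. by move=> eg Qu; rewrite oddr_R ?even_iso_oddr //; case: eg. Qed.

Lemma even_E u v : Q u = 0 -> bf u v = 0 -> Q v != 0 -> even_iso (E u v).
Proof.
move=> Qu uv Qv; rewrite E_RR //; apply: even_iso_RR => //.
by rewrite QD // QZ Qu bfZr bfC uv !mulr0 !addr0.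
Qed.

End Parity.

(** * Root elements *)

Section RootElements.
Variables (F : finFieldType) (N : nat) (omega0 A B C : F).
Hypothesis F2 : 2%N \in [pchar F].
Hypothesis B0 : B != 0.
Hypothesis w0 : omega0 != 0.
Hypothesis BC : B = C * omega0.
Hypothesis AE : A = 1 + B * C.
Local Notation n := N.+4.
Local Notation dim := (n.-1.*2.+2).
Local Notation V := 'rV[F]_dim.
Local Notation I := 'I_N.+3.
Local Notation GL := {'GL_dim[F]}.
Local Notation Q := (@Qform F n omega0 B).
Local Notation E := (siegel omega0 B).
Local Notation R := (reflection omega0 B).
Local Notation bf := (bf B).
Local Notation sv := (@sv F N).
Local Notation iso := (iso omega0 B).
Local Notation Pg := (@Pg F N).
Local Notation Zg := (@Zg F N B).
Local Notation Dg := (@Dg F N omega0 A B C).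
Local Notation even_iso := (even_iso omega0 B).
Local Notation wz := (wz B).
Local Notation wd := (wd A B C).
Local Notation dsc := (dsc omega0).
Implicit Types (x y u v : V) (i j : I) (g h : GL) (p q r : I * bool).

(** The root elements: [Ex p q a] involves two indices and a scalar, [Ey p w] one
index and a vector of the anisotropic plane. *)
Definition xroot p q a : GL := E (sv p) (a *: sv q).
Definition yroot p w : GL := E (sv p) (wv w).
Local Notation Ex := xroot.
Local Notation Ey := yroot.
(** The polar form of the anisotropic plane. *)
Definition bw (w w' : F * F) := B * (w.1 * w'.2 + w.2 * w'.1).

Let Qs p : Q (sv p) = 0 := Q_sv omega0 B p.

Lemma bf_sv0 p q : p.1 != q.1 -> bf (sv p) (sv q) = 0.
Proof.
move=> pq; rewrite bf_svsv; case: eqP => // e; case/eqP: pq.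
by rewrite -e.
Qed.
Lemma bf_svZ0 p q a : p.1 != q.1 -> bf (sv p) (a *: sv q) = 0.
Proof. by move=> pq; rewrite bfZr bf_sv0 // mulr0. Qed.

Lemma Ex_sv p q a r : p.1 != q.1 -> sv r ## Ex p q a =
  sv r + ((np p == r)%:R * a) *: sv q + ((np q == r)%:R * a) *: sv p.
Proof.
move=> pq; rewrite actE ?bf_svZ0 // /Ef QZ Qs mulr0 mul0r addr0 scalerA.
by rewrite bfZr !bf_svsv [a * _]mulrC.
Qed.
Lemma Ex_wv p q a w : p.1 != q.1 -> wv w ## Ex p q a = wv w.
Proof.
move=> pq; rewrite actE ?bf_svZ0 // /Ef bfZr !bf_wvsv !mulr0 addr0.
by rewrite !scale0r !addr0.
Qed.
Lemma Ey_sv p w r : sv r ## Ey p w =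
  sv r + (np p == r)%:R *: (wv w + qw omega0 B w *: sv p).
Proof.
rewrite actE ?bf_svwv // /Ef Q_wv bf_svwv bf_svsv add0r -addrA scalerDr scalerA.
by rewrite [_ * qw _ _ _]mulrC.
Qed.
Lemma Ey_wv p w w' : wv w' ## Ey p w = wv w' + bw w' w *: sv p.
Proof.
rewrite actE ?bf_svwv // /Ef bf_wvsv mulr0 scale0r !addr0 bf_wv.
by rewrite cw_wv.
Qed.
Lemma Ex_iso p q a : p.1 != q.1 -> iso (Ex p q a).
Proof. by move=> pq; apply: E_iso; rewrite ?bf_svZ0. Qed.
Lemma Ey_iso p w : iso (Ey p w).
Proof. by apply: E_iso; rewrite ?bf_svwv. Qed.

Lemma Ex_swap p q a : p.1 != q.1 -> Ex p q a = Ex q p a.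
Proof. by move=> pq; apply: E_swap; rewrite ?bf_sv0. Qed.
Lemma Ex_add p q a b : p.1 != q.1 -> (Ex p q a * Ex p q b = Ex p q (a + b))%g.
Proof. by move=> pq; rewrite /Ex E_add ?bf_svZ0 // -scalerDl. Qed.
Lemma Ex0 p q : Ex p q 0 = 1%g.
Proof. by rewrite /Ex scale0r E_0. Qed.
Lemma Ey_add p w w' : (Ey p w * Ey p w')%g = Ey p (w.1 + w'.1, w.2 + w'.2).
Proof. by rewrite /Ey E_add ?bf_svwv // -wvD. Qed.
Lemma Ey0 p : Ey p (0, 0) = 1%g.
Proof. by rewrite /Ey wv0 E_0. Qed.

Lemma ExJ p q a g : p.1 != q.1 -> iso g ->
  (Ex p q a ^ g)%g = E (sv p ## g) (a *: (sv q ## g)).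
Proof. by move=> pq ig; rewrite /Ex EJ ?bf_svZ0 // vactZ. Qed.
Lemma EyJ p w g : iso g -> (Ey p w ^ g)%g = E (sv p ## g) (wv w ## g).
Proof. by move=> ig; rewrite /Ey EJ ?bf_svwv. Qed.

Lemma ExJP p q a s : p.1 != q.1 ->
  (Ex p q a ^ Pg s)%g = Ex (perm_sv s p) (perm_sv s q) a.
Proof. by move=> pq; rewrite ExJ ?actP_sv //; apply: Pg_iso. Qed.
Lemma EyJP p w s : (Ey p w ^ Pg s)%g = Ey (perm_sv s p) w.
Proof. by rewrite EyJ ?actP_sv ?actP_wv //; apply: Pg_iso. Qed.
Lemma ExJZ p q a i : p.1 != q.1 -> (Ex p q a ^ Zg i)%g = Ex (flip i p) (flip i q) a.
Proof. by move=> pq; rewrite ExJ ?Zg_sv //; apply: Zg_iso. Qed.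
Lemma EyJZ p w i : (Ey p w ^ Zg i)%g = Ey (flip i p) (wz w).
Proof. by rewrite EyJ ?Zg_sv ?Zg_wv //; apply: Zg_iso. Qed.
Lemma ExJD p q a i : p.1 != q.1 ->
  (Ex p q a ^ Dg i)%g = Ex p q (dsc i p * (dsc i q * a)).
Proof.
move=> pq; rewrite ExJ ?Dg_sv //; last exact: Dg_iso.
rewrite scalerA E_scale // ?bf_svZ0 //.
by rewrite /Ex scalerA [a * _]mulrC.
Qed.
Lemma EyJD p w i : (Ey p w ^ Dg i)%g =
  Ey p (dsc i p * (wd w).1, dsc i p * (wd w).2).
Proof.
rewrite EyJ ?Dg_sv ?Dg_wv //; last exact: Dg_iso.
by rewrite E_scale ?bf_svwv // -wvZ.
Qed.

Lemma E_commute u v v' : Q u = 0 -> bf u v = 0 -> bf u v' = 0 ->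
  commute (E u v) (E u v').
Proof.
by move=> Qu uv uv'; rewrite /commute (E_add F2 Qu uv uv') (E_add F2 Qu uv' uv) addrC.
Qed.
Lemma Ex_commute p q q' a b : p.1 != q.1 -> p.1 != q'.1 ->
  commute (Ex p q a) (Ex p q' b).
Proof.
by move=> pq pq'; apply: (E_commute (Qs p)); apply: bf_svZ0.
Qed.
Lemma ExEy_commute p q a w : p.1 != q.1 -> commute (Ex p q a) (Ey p w).
Proof.
by move=> pq; apply: (E_commute (Qs p)); [apply: bf_svZ0|apply: bf_svwv].
Qed.

Lemma ExJEy p q a w : p.1 != q.1 -> (Ex p q a ^ Ey q w = Ex p q a)%g.
Proof.
move=> pq; rewrite ExJ //; last exact: Ey_iso.
rewrite !Ey_sv [_ == p]eq_sym.
case: eqP => [e|_]; first by rewrite e eqxx in pq.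
case: eqP => [/(congr1 snd)/=|_]; first by case: q.2.
by rewrite !scale0r !addr0.
Qed.
Lemma ExJEyN p q a w : p.1 != q.1 -> (Ex p q a ^ Ey (np q) w =
  Ex p q a * Ey p (a * w.1, a * w.2)%R * Ex p (np q) (a * qw omega0 B w)%R)%g.
Proof.
move=> pq; rewrite ExJ //; last exact: Ey_iso.
rewrite !Ey_sv npK eqxx [_ == p]eq_sym.
case: eqP => [e|_]; first by rewrite e eqxx in pq.
rewrite scale0r addr0 scale1r !scalerDr -wvZ scalerA.
have h1 := bf_svZ0 a pq; have h2 := bf_svwv B p (a * w.1, a * w.2).
have h3 : bf (sv p) ((a * qw omega0 B w) *: sv (np q)) = 0 by apply: bf_svZ0.
rewrite /Ex /Ey (E_add F2 (Qs p) h1 h2) E_add // ?bfDr ?h1 ?h2 ?addr0 //.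
by rewrite addrA.
Qed.
Lemma EyJEy p q w w' : p.1 != q.1 ->
  (Ey p w ^ Ey q w' = Ey p w * Ex p q (bw w w'))%g.
Proof.
move=> pq; rewrite EyJ; last exact: Ey_iso.
rewrite Ey_sv Ey_wv [_ == p]eq_sym.
case: eqP => [e|_]; first by rewrite e eqxx in pq.
by rewrite scale0r addr0 /Ey /Ex E_add ?bf_svZ0 ?bf_svwv.
Qed.

(** A reflection of the Weyl group as a product of three root elements, as in
[SL_2]; [Zg_Ey] is the same identity for the other kind of root. *)
Lemma swapE p q : p.1 != q.1 -> p.2 != q.2 ->
  Pg (tperm p.1 q.1) = (Ex p q 1%R * Ex (np p) (np q) 1%R * Ex p q 1%R)%g.
Proof.
move=> pq b; have npq : (np p).1 != (np q).1 by [].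
have qE : q.2 = ~~ p.2 by case: (p.2) (q.2) b => [] [].
case: p q pq b npq qE => [i b] [j c] /= ij _ _ ->.
have ji : (j == i) = false by rewrite eq_sym (negPf ij).
apply: vact_ext => [[k d]|w]; rewrite !vactM; last first.
  by rewrite actP_wv !Ex_wv.
rewrite actP_sv /perm_sv /=.
pose simp := (vactD, vactZ, eqxx, ji, negPf ij, mul1r, mul0r, mulr0n, scale0r,
  addr0, scale1r).
have [->|ki] := eqVneq k i.
  rewrite tpermL; move: d b => [] [];
  do ![rewrite ?simp Ex_sv //= /np /= !xpair_eqE ?simp /=];
  rewrite ?simp; apply/rowP => l; rewrite !mxE;
  set s := sv (i, _) 0 l; set t := sv (j, _) 0 l; apply/esym;
  first [apply: (eqF F2 (c := s)); ring|apply: (eqF F2 (c := s + t)); ring].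
have [->|kj] := eqVneq k j.
  rewrite tpermR; move: d b => [] [];
  do ![rewrite ?simp Ex_sv //= /np /= !xpair_eqE ?simp /=];
  rewrite ?simp; apply/rowP => l; rewrite !mxE;
  set s := sv (i, _) 0 l; set t := sv (j, _) 0 l; apply/esym;
  first [apply: (eqF F2 (c := t)); ring|apply: (eqF F2 (c := s + t)); ring].
rewrite tpermD 1?eq_sym //.
by do ![rewrite Ex_sv //= /np /= !xpair_eqE ![_ == k]eq_sym (negPf ki) (negPf kj) /= !simp].
Qed.
Lemma Zg_Ey i b : Zg i =
  (Ey (i, b) (1%R, 0%R) * Ey (i, ~~ b) (1%R, 0%R) * Ey (i, b) (1%R, 0%R))%g.
Proof.
have Qw := qw10 omega0 B.
have ww : bw (1, 0) (1, 0) = 0 by rewrite /bw /= mulr0 mul0r addr0 mulr0.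
pose simp := (vactD, vactZ, eqxx, mul1r, mul0r, mulr0n, scale0r,
  addr0, scale1r, Qw, ww).
apply: vact_ext => [[k d]|w]; rewrite !vactM; last first.
  rewrite Zg_wv //; do ![rewrite ?simp ?Ey_wv ?Ey_sv //= /np /= ?xpair_eqE ?simp].
  have -> : wv (wz w) = wv w + (B * w.2) *: wv (1, 0) :> V.
    by rewrite -wvZ -wvD /wz /= mulr1 mulr0 addr0.
  rewrite /bw /= mulr0 add0r mulr1; case: b; rewrite /= ?simp;
  apply/rowP => l; rewrite !mxE; apply/esym; set t := B * _;
  [ apply: (eqF F2 (c := t * (wv (1, 0) 0 l + sv (i, true) 0 l
      + sv (i, true) 0 l + sv (i, false) 0 l)))
  | apply: (eqF F2 (c := t * (wv (1, 0) 0 l + sv (i, false) 0 l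
      + sv (i, false) 0 l + sv (i, true) 0 l))) ]; ring.
rewrite Zg_sv // /flip /np /=.
have [->|ki] := eqVneq k i.
  rewrite /np /=; move: d b => [] [];
  do ![rewrite ?simp ?Ey_wv ?Ey_sv //= /np /= !xpair_eqE ?simp /=]; rewrite ?simp;
  apply/rowP => l; rewrite !mxE; apply/esym;
  set s := sv (i, true) 0 l; set s' := sv (i, false) 0 l; set t := wv _ _ _;
  first [apply: (eqF F2 (c := t + s)); ring|apply: (eqF F2 (c := t + s')); ring
        |apply: (eqF F2 (c := t + t + s + s')); ring].
by do ![rewrite Ey_sv //= /np /= !xpair_eqE ![_ == k]eq_sym (negPf ki) /= !simp].
Qed.

(** Here [a *: sv q] is singular, so [E_RR] does not apply; adding and removing
[w_1] gives a product of two Siegel transformations to which it does. *)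
Lemma even_Ex p q a : p.1 != q.1 -> even_iso (Ex p q a).
Proof.
move=> pq.
have Qw := qw10 omega0 B.
have -> : Ex p q a = (E (sv p) (a *: sv q + wv (1%R, 0%R)) * Ey p (1%R, 0%R))%g.
  by rewrite /Ex /Ey E_add ?bfDr ?bf_svZ0 ?bf_svwv ?addr0 // addVK.
apply: even_isoM; apply: even_E; rewrite ?bfDr ?bf_svZ0 ?bf_svwv ?addr0 //.
  by rewrite QD // QZ Qs mulr0 add0r bfZl bf_svwv mulr0 addr0 Q_wv Qw oner_eq0.
by rewrite Q_wv Qw oner_eq0.
Qed.
Lemma even_Pg s : even_iso (Pg s).
Proof.
have [ts -> _] := prod_tpermP s.
elim/big_ind: _ => [|x y ex ey|t _]; rewrite ?Pg1 ?PgM.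
- exact: even_iso1.
- exact: even_isoM.
have [<-|t12] := eqVneq t.1 t.2; first by rewrite tperm1 Pg1; apply: even_iso1.
rewrite (@swapE (t.1, false) (t.2, true)) //.
by apply: even_isoM; [apply: even_isoM|]; apply: even_Ex.
Qed.
Lemma even_sigma : even_iso (sigma_g F N).
Proof. by rewrite (sigmaE N omega0 B F2) -[sv (o1 _, _)]scale1r; apply: even_Ex. Qed.
Lemma even_tau : even_iso (tau_g N B).
Proof.
by rewrite (tauE N omega0 B F2); apply: even_E; rewrite ?bf_svwv // Q_wv qw10 oner_eq0.
Qed.
Lemma even_z : even_iso (z_g N B).
Proof.
by rewrite (zRR N omega0 B F2); apply: even_iso_RR; rewrite ?refl_values ?oner_eq0.
Qed.
Lemma even_delta : even_iso (delta_g N omega0 A B C).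
Proof.
rewrite (dRR N F2 w0 BC AE).
by apply: even_isoM; apply: even_iso_RR; rewrite ?refl_values ?oner_eq0.
Qed.
End RootElements.

(** * Arithmetic of the two fields *)

Section FieldFacts.
Variables (e q : nat) (F L : finFieldType) (iota : {rmorphism F -> L}).
Variables (omega : L) (omega0 A B C : F).
Hypotheses (e0 : (0 < e)%N) (q2 : q = (2 ^ e)%N) (cardF : #|F| = q).
Hypothesis cardL : #|L| = (q ^ 2)%N.
Hypothesis omegaP : ((q ^ 2).-1).-primitive_root omega.
Hypothesis omega0E : iota omega0 = omega ^+ q.+1.
Hypothesis AE : iota A = omega ^+ q.-1 + omega ^- q.-1 + 1.
Hypothesis BE : iota B = omega + omega ^+ q.
Hypothesis CE : iota C = omega^-1 + omega ^- q.
Implicit Types (w : F * F) (a : F).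

Let F2 : 2%N \in [pchar F] := pchar_GFq q2 cardF.
Let L2 : 2%N \in [pchar L].
Proof. by rewrite (fmorph_pchar iota) F2. Qed.
Let omegan0 : omega != 0 := omega_neq0 omegaP.
Let omega0n0 : omega0 != 0 := omega0_neq0 omegaP omega0E.

Lemma q_gt1 : (1 < q)%N.
Proof. by rewrite q2 -{1}(expn0 2) ltn_exp2l. Qed.
Let q0 : (0 < q)%N := ltnW q_gt1.
Lemma q_pred : (q.-1 * q.+1 = (q ^ 2).-1)%N.
Proof. by have := q_gt1; case: (q) => // k _; rewrite -mulnn /=; lia. Qed.

Lemma order_pos : (0 < (q ^ 2).-1)%N.
Proof. exact: prim_order_gt0 omegaP. Qed.
Lemma omega_pow (x : L) : x != 0 -> exists k, x = omega ^+ k.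
Proof.
move=> x0; have x1 : x ^+ (q ^ 2).-1 = 1.
  by apply: (mulfI x0); rewrite -exprS prednK ?expn_gt0 ?q0 // -cardL expf_card mulr1.
by have [k ->] := prim_rootP omegaP x1; exists k.
Qed.

Lemma exprq a : a ^+ q = a.
Proof. by rewrite -cardF expf_card. Qed.
Lemma omega0_q1 : omega0 ^+ q.-1 = 1.
Proof. by apply: (mulfI omega0n0); rewrite -exprS prednK // exprq mulr1. Qed.
Lemma omega0_order k : omega0 ^+ k = 1 -> (q.-1 %| k)%N.
Proof.
move=> /(congr1 iota); rewrite rmorphXn omega0E rmorph1 -exprM => /eqP.
by rewrite -(prim_order_dvd omegaP) -q_pred mulnC dvdn_pmul2l.
Qed.
Lemma omega0_pow a : a != 0 -> exists k, a = omega0 ^+ k.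
Proof.
move=> a0; have [k ak] : exists k, iota a = omega ^+ k.
  by apply: omega_pow; rewrite fmorph_eq0.
have a1 : a ^+ q.-1 = 1 by apply: (mulfI a0); rewrite -exprS prednK // exprq mulr1.
have : omega ^+ (k * q.-1) = 1 by rewrite exprM -ak -rmorphXn a1 rmorph1.
move/eqP; rewrite -(prim_order_dvd omegaP) -q_pred [(k * _)%N]mulnC dvdn_pmul2l; last first.
  by rewrite -ltnS prednK // q_gt1.
case/dvdnP => j kj; exists j; apply: (fmorph_inj iota).
by rewrite ak rmorphXn omega0E -exprM kj mulnC.
Qed.
(** On the base field [x ^+ q.+1] is [x ^+ 2], and every element is a square. *)
Lemma omega0_powS a : a != 0 -> exists k, a = omega0 ^+ (q.+1 * k).
Proof.
move=> /omega0_pow[j ->]; exists (j * 2 ^ e.-1)%N.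
have -> : omega0 ^+ (q.+1 * (j * 2 ^ e.-1)) = (omega0 ^+ q.+1) ^+ (j * 2 ^ e.-1).
  by rewrite exprM.
have -> : omega0 ^+ q.+1 = omega0 ^+ 2 by rewrite exprS exprq.
rewrite -exprM mulnCA -expnS prednK // -q2 mulnC exprM exprq //.
Qed.

Lemma BC_rel : B = C * omega0.
Proof.
apply: (fmorph_inj iota); rewrite rmorphM BE CE omega0E exprS mulrDl.
have wq := expf_neq0 q omegan0.
by field; rewrite omegan0 wq.
Qed.
Lemma A_rel : A = 1 + B * C.
Proof.
have := ABC1 q2 cardF omegaP AE BE CE => /(congr1 (fun x => x + B * C)).
by rewrite -addrA addFF // addr0.
Qed.

(** The anisotropic plane is the quadratic extension [L], with [w_1] and [w_2]
at 1 and [omega]: then [wd] is multiplication by [omega ^+ q.-1] and the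
quadratic form is the norm. *)
Definition lam (w : F * F) : L := iota w.1 + iota w.2 * omega.

Lemma omega_q : omega ^+ q != omega.
Proof.
apply/eqP => wq.
have : omega ^+ q.-1 = 1 by apply: (mulfI omegan0); rewrite -exprS prednK // wq mulr1.
move/eqP; rewrite -(prim_order_dvd omegaP) => /dvdn_leq.
have := q_gt1; rewrite -q_pred; case: (q) => [|[|k]] // _ /(_ isT) /=.
by move=> H; lia.
Qed.
Lemma omega_notin a : iota a != omega.
Proof.
apply/eqP => ia; case/eqP: omega_q.
by rewrite -ia -rmorphXn exprq.
Qed.

Lemma lam0 w : lam w = 0 -> w = (0, 0).
Proof.
case: w => a b; rewrite /lam /= => ab.
have b0 : b = 0.
  apply/eqP; apply: contraT => b0; case/eqP: (omega_notin (- a / b)).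
  rewrite rmorphM fmorphV rmorphN /=; apply: (mulIf (x := iota b)).
    by rewrite fmorph_eq0.
  rewrite mulfVK ?fmorph_eq0 // -[LHS]add0r -ab mulrC; ring.
by move: ab; rewrite b0 rmorph0 mul0r addr0 => /eqP; rewrite fmorph_eq0 => /eqP->.
Qed.
Lemma lam_inj w w' : lam w = lam w' -> w = w'.
Proof.
move=> ww; have := @lam0 (w.1 - w'.1, w.2 - w'.2).
rewrite /lam /= !rmorphB mulrBl; case: w w' ww => [a b] [c d]; rewrite /lam /=.
move=> E H; have /H[] : iota a - iota c + (iota b * omega - iota d * omega) = 0.
  by rewrite addrACA -opprD E subrr.
by move=> /subr0_eq-> /subr0_eq->.
Qed.
Lemma lam_scale a w : lam (a * w.1, a * w.2) = iota a * lam w.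
Proof. by rewrite /lam /= !rmorphM; ring. Qed.
Lemma lam_wd w : lam (wd A B C w) = omega ^+ q.-1 * lam w.
Proof.
rewrite /lam /wd /= !rmorphD !rmorphM AE BE CE.
have wq1 := expf_neq0 q.-1 omegan0.
have -> : omega ^+ q = omega * omega ^+ q.-1 by rewrite -exprS prednK.
move: wq1; set t := omega ^+ _ => t0.
have ch (x y c : L) : x = y + (c + c) -> x = y by rewrite addrr_pchar2 // addr0.
apply: (ch _ _ (iota w.1 + iota w.2 * omega + iota w.1 / t)).
by field; rewrite omegan0 t0.
Qed.
Lemma lam_iter_wd k w : lam (iter k (wd A B C) w) = omega ^+ (q.-1 * k) * lam w.
Proof.
elim: k => [|k IH]; first by rewrite muln0 mul1r.
by rewrite iterS lam_wd IH mulrA -exprD mulnS.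
Qed.
Lemma wd_order w : iter q.+1 (wd A B C) w = w.
Proof. by apply: lam_inj; rewrite lam_iter_wd q_pred prim_expr_order // mul1r. Qed.

Lemma lam_q w : lam w ^+ q = iota w.1 + iota w.2 * omega ^+ q.
Proof.
rewrite /lam exprDn_pchar; last first.
  rewrite q2 pnatX; apply/orP; left.
  by rewrite pnatE // (pcharf_eq L2) inE.
have iq a : iota a ^+ q = iota a by rewrite -[RHS](congr1 iota (exprq a)) rmorphXn.
by rewrite exprMn !iq.
Qed.
Lemma lam_norm w : iota (qw omega0 B w) = lam w ^+ q.+1.
Proof.
rewrite exprS lam_q /qw !rmorphD !rmorphM ?rmorphXn /= BE omega0E exprS /lam; ring.
Qed.
Lemma qw0 w : qw omega0 B w = 0 -> w = (0, 0).
Proof.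
move=> /(congr1 iota); rewrite lam_norm rmorph0 => /eqP.
by rewrite expf_eq0 /= => /eqP/lam0.
Qed.
Lemma B_neq0 : B != 0.
Proof.
apply/eqP => B0; case/eqP: omega_q; move: BE; rewrite B0 rmorph0 => /esym E.
by rewrite -[LHS]add0r -E -addrA addrr_pchar2 // addr0.
Qed.

(** The action of a torus generator on the root group of a short root. *)
Definition wact c w := (c * (wd A B C w).1, c * (wd A B C w).2).

Lemma coprime_gen m k : coprime m (q ^ 2).-1 ->
  exists l, omega ^+ k = omega ^+ (m * l).
Proof.
move=> cop; have m0 : (0 < (q ^ 2).-1)%N := order_pos.
have Ek : (k = k * (egcdn m (q ^ 2).-1).1 * m %[mod (q ^ 2).-1])%N.
  case: m cop => [|m] cop.
    move: cop; rewrite /coprime gcd0n => /eqP ->; by rewrite !modn1.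
  case: egcdnP => //= a b E _; move: E; rewrite (eqP cop) => E.
  by rewrite -mulnA E mulnDr muln1 mulnA modnMDl.
exists (k * (egcdn m (q ^ 2).-1).1)%N.
by rewrite mulnC -(prim_expr_mod omegaP) Ek (prim_expr_mod omegaP).
Qed.

Lemma lam_wact_iter c m k w : iota c * omega ^+ q.-1 = omega ^+ m ->
  lam (iter k (wact c) w) = omega ^+ (m * k) * lam w.
Proof.
move=> cm; elim: k => [|k IH]; first by rewrite muln0 mul1r.
by rewrite iterS /wact lam_scale lam_wd IH mulrA cm mulrA -exprD mulnS.
Qed.
Lemma lam10 : lam (1, 0) = 1.
Proof. by rewrite /lam /= rmorph1 rmorph0 mul0r addr0. Qed.

(** In terms of [lam], the torus acts by [omega ^+ (2 * q)] or by [omega ^- 2].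
Both are primitive, because the order of [omega] is odd. *)
Lemma wact_trans (b : bool) w : w != (0, 0) ->
  exists k, w = iter k (wact (if b then omega0 else omega0^-1)) (1, 0).
Proof.
move=> w_0; have /omega_pow[k wk] : lam w != 0.
  by apply: contra w_0 => /eqP/lam0->.
have odd_ord : odd (q ^ 2).-1.
  rewrite -subn1 oddB ?expn_gt0 ?q0 // q2 -expnM oddX /= orbF muln_eq0 orbF.
  by rewrite addbT -lt0n e0.
(* The exponents of [omega] for the two actions; the second is [-2]. *)
pose m := if b then (q.+1 + q.-1)%N else ((q ^ 2).-1 - 2)%N.
have ord3 : (2 < (q ^ 2).-1)%N.
  by have := q_gt1; case: (q) => [|[|j]] // _; rewrite -mulnn /=; lia.
have cm : iota (if b then omega0 else omega0^-1) * omega ^+ q.-1 = omega ^+ m.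
  rewrite /m; case: (b); first by rewrite omega0E exprD.
  rewrite fmorphV omega0E; apply: (mulfI (expf_neq0 q.+1 omegan0)).
  rewrite mulVKf ?expf_neq0 // -exprD.
  have -> : (q.+1 + ((q ^ 2).-1 - 2) = (q ^ 2).-1 + q.-1)%N.
    by have := q_gt1; have := ord3; lia.
  by rewrite exprD (prim_expr_order omegaP) mul1r.
have cop : coprime m (q ^ 2).-1.
  rewrite /m; case: (b).
    have -> : (q.+1 + q.-1 = 2 * q)%N by have := q_gt1; lia.
    rewrite coprimeMl coprime2n odd_ord /= -(@coprime_pexpl 2 q) // coprime_sym.
    by rewrite coprimePn // expn_gt0 q0.
  rewrite /coprime -[X in gcdn _ X](subnKC (ltnW ord3)) gcdnDr -/(coprime _ _).
  by rewrite coprimen2 oddB ?odd_ord // ltnW.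
have [l kl] := coprime_gen k cop.
by exists l; apply: lam_inj; rewrite (lam_wact_iter _ _ cm) lam10 mulr1 wk kl.
Qed.

(** Elements of norm 1 are powers of [omega ^+ q.-1]. *)
Lemma wd_trans w : qw omega0 B w = 1 ->
  exists k, w = iter k (wd A B C) (1, 0).
Proof.
move=> w1; have wN0 : lam w != 0.
  apply/eqP => /lam0 E; move: w1; rewrite E /qw /= expr0n /= !mulr0 !addr0.
  by move/eqP; rewrite eq_sym oner_eq0.
have [k wk] := omega_pow wN0.
have : omega ^+ (k * q.+1) = 1 by rewrite exprM -wk -lam_norm w1 rmorph1.
move/eqP; rewrite -(prim_order_dvd omegaP) -q_pred dvdn_pmul2r // => /dvdnP[j kj].
exists j; apply: lam_inj; rewrite lam_iter_wd lam10 mulr1 wk kj mulnC.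
by [].
Qed.
End FieldFacts.

(** * Faithfulness: Steinberg relations and parabolic double cosets *)

Section Steinberg.
Variables (F : finFieldType) (N q : nat) (omega0 A B C : F).
Hypothesis F2 : 2%N \in [pchar F].
Hypothesis w0 : omega0 != 0.
Hypothesis BC : B = C * omega0.
Hypothesis AE : A = 1 + B * C.
Hypothesis omega0_pow : forall a : F, a != 0 -> exists k, a = omega0 ^+ k.
Hypothesis wact_trans : forall (b : bool) w, w != (0, 0) ->
  exists k, w = iter k (wact A B C (if b then omega0 else omega0^-1)) (1, 0).
Hypothesis omega0_q : omega0 ^+ q = omega0.
Hypothesis wd_order : forall w : F * F, iter q.+1 (wd A B C) w = w.
Hypothesis omega0_powS : forall a : F, a != 0 -> exists k, a = omega0 ^+ (q.+1 * k).
Hypothesis q0 : (0 < q)%N.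
Hypothesis q_gt1 : (1 < q)%N.
Hypothesis omega0_q1 : omega0 ^+ q.-1 = 1.
Hypothesis omega0_order : forall m, omega0 ^+ m = 1 -> (q.-1 %| m)%N.
Local Notation n := N.+4.
Local Notation dim := (n.-1.*2.+2).
Local Notation I := 'I_N.+3.
Local Notation GL := {'GL_dim[F]}.
Local Notation sv := (@sv F N).
Local Notation iso := (iso omega0 B).
Local Notation Pg := (@Pg F N).
Local Notation Zg := (@Zg F N B).
Local Notation Dg := (@Dg F N omega0 A B C).
Local Notation wz := (wz B).
Local Notation wd := (wd A B C).
Local Notation dsc := (dsc omega0).
Local Notation Ex := (xroot omega0 B).
Local Notation Ey := (@yroot F N omega0 B).
Local Notation o0 := (o0 N).
Local Notation o1 := (o1 N).
Local Notation o2 := (o2 N).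
Implicit Types (i j : I) (p r u : I * bool) (s t : {perm I}) (w : F * F).
Local Open Scope group_scope.

(** An abstract group with a map [M] to matrices, with elements over [sigma],
[tau], [delta], [z] and with a copy of the symmetric group. The hypothesis
[M_inj2] stands for the presentation of [Omega^-(6,q)]; those that follow it are
the relations involving further indices. *)
Variables (G : groupType) (M : G -> GL).
Variables (sg tg dg zg : G) (psi : {perm I} -> G).
Implicit Types (x y k : G).
Hypothesis MM : forall x y, M (x * y) = M x * M y.
Hypothesis psiM : forall s t, psi (s * t) = psi s * psi t.
Hypothesis Msg : M sg = sigma_g F N.
Hypothesis Mtg : M tg = tau_g N B.
Hypothesis Mdg : M dg = delta_g N omega0 A B C.
Hypothesis Mzg : M zg = z_g N B.
Hypothesis Mpsi : forall s, M (psi s) = Pg s.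

Definition gens1 x := [\/ x = tg, x = dg | x = zg].
Definition gens2 x := [\/ gens1 x, x = sg | x = psi (tperm o0 o1)].

Hypothesis M_inj2 : forall x, gen gens2 x -> M x = 1 -> x = 1.
Hypothesis psi_fix1 : forall s, s o0 = o0 -> forall x, gens1 x -> x ^ psi s = x.
Hypothesis sg_fix : forall s, s o0 = o0 -> s o1 = o1 -> sg ^ psi s = sg.

Hypothesis sg_z : commute sg (zg ^ psi (tperm o0 o2)).
Hypothesis sg_d : commute sg (dg ^ psi (tperm o0 o2)).
Hypothesis sg_sg : forall s, s o0 = o1 -> s o1 = o2 ->
  [~ sg, sg ^ psi s] = sg ^ psi (tperm o1 o2).
Hypothesis sg_sg0 : commute sg (sg ^ psi (tperm o1 o2)).
Hypothesis sg_sg2 : forall s, s o0 != o0 -> s o0 != o1 -> s o1 != o0 -> s o1 != o1 ->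
  commute sg (sg ^ psi s).
Hypothesis sg_tg : forall s, s o0 = o1 -> s o1 = o2 -> commute (sg ^ psi s) tg.

Let hom1 : M 1 = 1 := hom_one MM.
Let homV x : M x^-1 = (M x)^-1 := hom_inv x MM.
Let homJ x y : M (x ^ y) = M x ^ M y := hom_conj x y MM.
Let homX x (m : nat) : M (x ^+ m) = M x ^+ m.
Proof. by elim: m => [|m IH]; rewrite ?hom1 // !expgS MM IH. Qed.

Let Dsv i p : sv p ## Dg i = (dsc i p *: sv p)%R.
Proof. exact: Dg_sv. Qed.
Let Dwv i w : wv w ## Dg i = wv (wd w).
Proof. exact: Dg_wv. Qed.
Let Zsv i p : sv p ## Zg i = sv (flip i p).
Proof. exact: Zg_sv. Qed.
Let Zwv i w : wv w ## Zg i = wv (wz w).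
Proof. exact: Zg_wv. Qed.

Let psi1 : psi 1 = 1 := hom_one psiM.
Let psiV s : psi s^-1 = (psi s)^-1 := hom_inv s psiM.

Lemma gen1_fix s x : s o0 = o0 -> gen gens1 x -> x ^ psi s = x.
Proof. by move=> s0; apply: gen_fix => y; apply: psi_fix1. Qed.
Lemma gen2_fix s x : s o0 = o0 -> s o1 = o1 -> gen gens2 x -> x ^ psi s = x.
Proof.
move=> s0 s1; apply: gen_fix => y [y1|->|->]; first exact: psi_fix1.
  exact: sg_fix.
by rewrite conjgE -psiV -!psiM -conjgE tpermJ s0 s1.
Qed.

(** The conjugate at the indices [i], [j] of the subgroup generated at the first
two indices. It does not depend on the permutation that moves the indices, since
permutations fixing 0 and 1 centralise that subgroup ([gen2_fix]). *)
Definition on_pair i j x := exists s k, [/\ s o0 = i, s o1 = j, gen gens2 k & x = k ^ psi s].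
Definition on_index i x := exists s k, [/\ s o0 = i, gen gens1 k & x = k ^ psi s].

Lemma conj_at1 s t k : gen gens1 k -> s o0 = t o0 -> k ^ psi s = k ^ psi t.
Proof.
move=> gk st; rewrite -{2}(@gen1_fix (s * t^-1) k) //; last by rewrite permM st permK.
by rewrite -conjgM -psiM mulgVK.
Qed.

Lemma perm2 i j : i != j -> exists s : {perm I}, s o0 = i /\ s o1 = j.
Proof.
move=> ij; exists (tperm o0 i * tperm (tperm o0 i o1) j).
rewrite !permM !tpermL; split=> //.
have ti : tperm o0 i o1 != i by rewrite -[X in _ != X](tpermL o0 i) (inj_eq perm_inj).
by rewrite (tpermD ti) // eq_sym.
Qed.

Lemma on_pair_at i j x s : s o0 = i -> s o1 = j -> on_pair i j x ->
  exists2 k, gen gens2 k & x = k ^ psi s.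
Proof.
move=> s0 s1 [t [k [t0 t1 gk ->]]]; exists k => //.
rewrite -{2}(@gen2_fix (t * s^-1) k) //; last 2 first.
- by rewrite permM t0 -s0 permK.
- by rewrite permM t1 -s1 permK.
by rewrite -conjgM -psiM mulgVK.
Qed.
Lemma on_index_at i x s : s o0 = i -> on_index i x -> exists2 k, gen gens1 k & x = k ^ psi s.
Proof.
move=> s0 [t [k [t0 gk ->]]]; exists k => //.
rewrite -{2}(@gen1_fix (t * s^-1) k) //; last by rewrite permM t0 -s0 permK.
by rewrite -conjgM -psiM mulgVK.
Qed.
Lemma gens12 x : gen gens1 x -> gen gens2 x.
Proof. by apply: gen_sub => y y1; apply: gen_in; apply: Or31. Qed.
Lemma on_index_Loc i j x : i != j -> on_index i x -> on_pair i j x.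
Proof.
move=> /perm2[s [s0 s1]] /(on_index_at s0)[k gk ->].
by exists s, k; split=> //; apply: gens12.
Qed.
Lemma on_pairM i j x y : on_pair i j x -> on_pair i j y -> on_pair i j (x * y).
Proof.
move=> [s [k [s0 s1 gk ->]]] /(on_pair_at s0 s1)[l gl ->].
by exists s, (k * l); split; rewrite ?conjMg //; apply: gen_M.
Qed.
Lemma on_pairV i j x : on_pair i j x -> on_pair i j x^-1.
Proof.
move=> [s [k [s0 s1 gk ->]]].
by exists s, k^-1; split; rewrite ?conjVg //; apply: gen_V.
Qed.
Lemma on_pairJ i j x y : on_pair i j x -> on_pair i j y -> on_pair i j (x ^ y).
Proof. by move=> lx ly; rewrite conjgE; apply: on_pairM; [apply: on_pairV|apply: on_pairM]. Qed.
Lemma on_pairX i j x (m : nat) : i != j -> on_pair i j x -> on_pair i j (x ^+ m).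
Proof.
move=> /perm2[s [s0 s1]] lx; elim: m => [|m IH]; last by rewrite expgS; apply: on_pairM.
by exists s, 1; split=> //; [apply: gen_1|rewrite conj1g].
Qed.
Lemma on_pair_psi i j x s : on_pair i j x -> on_pair (s i) (s j) (x ^ psi s).
Proof.
move=> [t [k [t0 t1 gk ->]]]; exists (t * s), k.
by split; rewrite ?permM ?t0 ?t1 // psiM conjgM.
Qed.
Lemma on_index_psi i x s : on_index i x -> on_index (s i) (x ^ psi s).
Proof.
move=> [t [k [t0 gk ->]]]; exists (t * s), k.
by split; rewrite ?permM ?t0 // psiM conjgM.
Qed.
Lemma on_pair_sym i j x : on_pair i j x -> on_pair j i x.
Proof.
move=> [t [k [t0 t1 gk ->]]]; exists (tperm o0 o1 * t), (k ^ psi (tperm o0 o1)).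
split; rewrite ?permM ?tpermL ?tpermR //.
  by apply: gen_J => //; apply: gen_in; apply: Or33.
by rewrite -conjgM -psiM mulgA tperm2 mul1g.
Qed.
(** The presentation of [Omega^-(6,q)], moved to an arbitrary pair of indices. *)
Lemma on_pair_inj i j x y : on_pair i j x -> on_pair i j y -> M x = M y -> x = y.
Proof.
move=> lx ly Mxy; have [s [k [s0 s1 gk e]]] := on_pairM lx (on_pairV ly).
apply: (mulIg y^-1); rewrite mulgV e.
suff -> : k = 1 by rewrite conj1g.
apply: M_inj2 => //; apply: (conjg_inj (M (psi s))).
by rewrite /= -homJ -e MM homV Mxy mulgV conj1g.
Qed.
Lemma on_pair_one i j : i != j -> on_pair i j 1.
Proof. by move=> ij; rewrite -(expg0 1); apply: on_pairX => //; apply: on_index_Loc => //;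
  exists (tperm o0 i), 1; split; rewrite ?tpermL ?conj1g //; apply: gen_1. Qed.

Fact d_seal : {f : I -> G | forall i, f i = dg ^ psi (tperm o0 i)}.
Proof. by exists (fun i => dg ^ psi (tperm o0 i)). Qed.
Definition delta_at := sval d_seal.
Local Notation d := delta_at.
Lemma dE i : d i = dg ^ psi (tperm o0 i).
Proof. exact: svalP d_seal i. Qed.
Fact z_seal : {f : I -> G | forall i, f i = zg ^ psi (tperm o0 i)}.
Proof. by exists (fun i => zg ^ psi (tperm o0 i)). Qed.
Definition z_at := sval z_seal.
Local Notation z := z_at.
Lemma zE i : z i = zg ^ psi (tperm o0 i).
Proof. exact: svalP z_seal i. Qed.
Lemma on_index_d i : on_index i (d i).
Proof.
by rewrite dE; exists (tperm o0 i), dg; rewrite tpermL; split=> //; apply/gen_in/Or32.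
Qed.
Lemma on_index_z i : on_index i (z i).
Proof.
by rewrite zE; exists (tperm o0 i), zg; rewrite tpermL; split=> //; apply/gen_in/Or33.
Qed.
Lemma Md i : M (d i) = Dg i.
Proof. by rewrite dE homJ Mdg Mpsi DgE. Qed.
Lemma Mz i : M (z i) = Zg i.
Proof. by rewrite zE homJ Mzg Mpsi ZgE. Qed.
Lemma dJpsi i s : d i ^ psi s = d (s i).
Proof.
rewrite !dE -conjgM -psiM; apply: conj_at1; first by apply: gen_in; apply: Or32.
by rewrite permM !tpermL.
Qed.
Lemma zJpsi i s : z i ^ psi s = z (s i).
Proof.
rewrite !zE -conjgM -psiM; apply: conj_at1; first by apply: gen_in; apply: Or33.
by rewrite permM !tpermL.
Qed.

Lemma flipK i p : flip i (flip i p) = p.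
Proof. by rewrite /flip; case e: (p.1 == i); rewrite /= e ?npK. Qed.
Lemma flip1 i p : (flip i p).1 = p.1.
Proof. by rewrite /flip; case: ifP. Qed.
Lemma wzK w : wz (wz w) = w.
Proof. by case: w => a b; rewrite /wz /= -addrA addFF // addr0. Qed.

(** The torus reaches every nonzero scalar from 1, [z_at] the four choices of
signs, and the permutations all pairs of indices. *)
Lemma ex_x p r a : p.1 != r.1 -> exists g, on_pair p.1 r.1 g /\ M g = Ex p r a.
Proof.
move=> pr; have [s [s0 s1]] := perm2 pr.
have o01 : o0 != o1 by [].
have Lsg : on_pair o0 o1 sg.
  by exists 1, sg; split; rewrite ?perm1 ?psi1 ?conjg1 //; apply: gen_in; apply: Or32.
have [g [Lg Mg]] : exists g, on_pair o0 o1 g /\ M g = Ex (o0, true) (o1, false) a.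
  have [->|/omega0_pow[k ->]] := eqVneq a 0%R.
    by exists 1; split; rewrite ?hom1 ?Ex0 //; apply: on_pair_one.
  exists (sg ^ (d o0 ^+ k)); split.
    by apply: on_pairJ Lsg (on_pairX _ o01 (on_index_Loc o01 (on_index_d _))).
  elim: k => [|k IH].
    by rewrite expg0 conjg1 Msg (sigmaE N omega0 B F2) /Ex scale1r.
  rewrite expgSr conjgM homJ IH Md ExJD //.
  by congr Ex; rewrite /dsc /= mul1r exprS.
have [g1 [Lg1 Mg1]] : exists g, on_pair o0 o1 g /\ M g = Ex (o0, p.2) (o1, false) a.
  case: p.2; first by exists g.
  exists (g ^ z o0); split; first by apply: on_pairJ Lg (on_index_Loc o01 (on_index_z _)).
  by rewrite homJ Mg Mz ExJZ.
have [g2 [Lg2 Mg2]] : exists g, on_pair o0 o1 g /\ M g = Ex (o0, p.2) (o1, r.2) a.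
  case: r.2; last by exists g1.
  exists (g1 ^ z o1); split.
    by apply: on_pairJ Lg1 (on_pair_sym (on_index_Loc _ (on_index_z _))).
  by rewrite homJ Mg1 Mz ExJZ.
exists (g2 ^ psi s); split; first by rewrite -s0 -s1; apply: on_pair_psi.
by rewrite homJ Mg2 Mpsi ExJP // /perm_sv /= s0 s1 -!surjective_pairing.
Qed.
(** Choosing any element over [Ex p r a] in the subgroup of its two indices is
harmless: there is only one ([x_unique]). *)
Fact xe_seal : {f : I * bool -> I * bool -> F -> G | forall p r a,
  p.1 != r.1 -> on_pair p.1 r.1 (f p r a) /\ M (f p r a) = Ex p r a}.
Proof.
exists (fun p r a => xget 1 [set g | on_pair p.1 r.1 g /\ M g = Ex p r a]%classic).
move=> p r a /ex_x-/(_ a) ex.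
exact: (@xgetPex _ 1 [set g | on_pair p.1 r.1 g /\ M g = Ex p r a]%classic ex).
Qed.
Definition xe := sval xe_seal.
Lemma xP p r a : p.1 != r.1 -> on_pair p.1 r.1 (xe p r a) /\ M (xe p r a) = Ex p r a.
Proof. exact: svalP xe_seal p r a. Qed.

Lemma ex_y p w : exists g, on_index p.1 g /\ M g = Ey p w.
Proof.
have [g [Lg Mg]] : exists g, on_index o0 g /\ M g = Ey (o0, p.2) w.
  have L1 g : gen gens1 g -> on_index o0 g.
    by exists 1, g; split; rewrite ?perm1 ?psi1 ?conjg1.
  have H v : exists g, gen gens1 g /\ M g = Ey (o0, true) v.
    have [->|/(wact_trans true)[k ->]] := eqVneq v (0, 0)%R.
      by exists 1; split; rewrite ?hom1 ?Ey0 //; apply: gen_1.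
    exists (tg ^ (d o0 ^+ k)); split.
      apply: gen_J; first by apply: gen_in; apply: Or31.
      by apply: gen_X; rewrite dE tperm1 psi1 conjg1; apply: gen_in; apply: Or32.
    elim: k => [|k IH]; first by rewrite expg0 conjg1 Mtg (tauE N omega0 B F2).
    by rewrite expgSr conjgM homJ IH Md EyJD // iterS.
  case: p.2; first by have [g [/L1 Lg Mg]] := H w; exists g.
  have [g [gg Mg]] := H (wz w); exists (g ^ zg); split.
    by apply/L1/gen_J => //; apply: gen_in; apply: Or33.
  have -> : zg = z o0 by rewrite !zE tperm1 psi1 conjg1.
  by rewrite homJ Mg Mz EyJZ // wzK.
exists (g ^ psi (tperm o0 p.1)); split.
  by rewrite -[X in on_index X _](tpermL o0 p.1); apply: on_index_psi.
by rewrite homJ Mg Mpsi EyJP // /perm_sv /= tpermL -surjective_pairing.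
Qed.
Fact ye_seal : {f : I * bool -> F * F -> G | forall p w,
  on_index p.1 (f p w) /\ M (f p w) = Ey p w}.
Proof.
exists (fun p w => xget 1 [set g | on_index p.1 g /\ M g = Ey p w]%classic).
move=> p w.
exact: (@xgetPex _ 1 [set g | on_index p.1 g /\ M g = Ey p w]%classic (ex_y p w)).
Qed.
Definition ye := sval ye_seal.
Lemma yP p w : on_index p.1 (ye p w) /\ M (ye p w) = Ey p w.
Proof. exact: svalP ye_seal p w. Qed.

Lemma Lx p r a : p.1 != r.1 -> on_pair p.1 r.1 (xe p r a).
Proof. by case/(xP a). Qed.
Lemma Mx p r a : p.1 != r.1 -> M (xe p r a) = Ex p r a.
Proof. by case/(xP a). Qed.
Lemma Ly p w i : p.1 != i -> on_pair p.1 i (ye p w).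
Proof. by move=> pi; apply: on_index_Loc => //; case: (yP p w). Qed.
Lemma Ly' p w i : i != p.1 -> on_pair i p.1 (ye p w).
Proof. by move=> pi; apply/on_pair_sym/Ly; rewrite eq_sym. Qed.
Lemma My p w : M (ye p w) = Ey p w.
Proof. by case: (yP p w). Qed.
Lemma Ld i j : i != j -> on_pair i j (d i).
Proof. by move=> ij; apply: on_index_Loc => //; exact: on_index_d. Qed.
Lemma Ld' i j : i != j -> on_pair i j (d j).
Proof. by move=> ij; apply/on_pair_sym/Ld; rewrite eq_sym. Qed.
Lemma Lz i j : i != j -> on_pair i j (z i).
Proof. by move=> ij; apply: on_index_Loc => //; exact: on_index_z. Qed.
Lemma Lz' i j : i != j -> on_pair i j (z j).
Proof. by move=> ij; apply/on_pair_sym/Lz; rewrite eq_sym. Qed.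
Lemma Ls i j : i != j -> on_pair i j (psi (tperm i j)).
Proof.
move=> ij; have [s [s0 s1]] := perm2 ij.
exists s, (psi (tperm o0 o1)); split=> //; first by apply: gen_in; apply: Or33.
by rewrite conjgE -psiV -!psiM -conjgE tpermJ s0 s1.
Qed.

(** From here on, an identity between root elements on at most two indices holds
in [G] as soon as it holds for the matrices. *)
Lemma x_unique p r a g : p.1 != r.1 -> on_pair p.1 r.1 g -> M g = Ex p r a -> g = xe p r a.
Proof. by move=> pr lg Mg; apply: (on_pair_inj lg (Lx a pr)); rewrite Mx. Qed.
Lemma y_unique p w g i : p.1 != i -> on_pair p.1 i g -> M g = Ey p w -> g = ye p w.
Proof. by move=> pi lg Mg; apply: (on_pair_inj lg (Ly w pi)); rewrite My. Qed.

Lemma other_index i : exists j, i != j.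
Proof.
by have [->|i0] := eqVneq i o0; [exists o1|exists o0].
Qed.

Lemma xJpsi p r a s : p.1 != r.1 -> xe p r a ^ psi s = xe (perm_sv s p) (perm_sv s r) a.
Proof.
move=> pr; apply: x_unique; rewrite /= ?(inj_eq perm_inj) //.
  by apply: on_pair_psi; apply: Lx.
by rewrite homJ Mx // Mpsi ExJP.
Qed.
Lemma yJpsi p w s : ye p w ^ psi s = ye (perm_sv s p) w.
Proof.
have [j pj] := other_index p.1; apply: (@y_unique _ _ _ (s j)).
- by rewrite (inj_eq perm_inj).
- by apply: on_pair_psi; apply: Ly.
by rewrite homJ My Mpsi EyJP.
Qed.
Lemma x_sym p r a : p.1 != r.1 -> xe p r a = xe r p a.
Proof.
move=> pr; apply: x_unique; rewrite 1?eq_sym //; first exact/on_pair_sym/Lx.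
by rewrite Mx // Ex_swap.
Qed.
Lemma xD p r a b : p.1 != r.1 -> xe p r a * xe p r b = xe p r (a + b)%R.
Proof.
move=> pr; apply: x_unique => //; first by apply: on_pairM; apply: Lx.
by rewrite MM !Mx // Ex_add.
Qed.
Lemma x0 p r : p.1 != r.1 -> xe p r 0%R = 1.
Proof. by move=> pr; apply/esym/x_unique; rewrite ?hom1 ?Ex0 //; apply: on_pair_one. Qed.
Lemma yD p w w' : ye p w * ye p w' = ye p (w.1 + w'.1, w.2 + w'.2)%R.
Proof.
have [j pj] := other_index p.1; apply: (@y_unique _ _ _ j) => //.
  by apply: on_pairM; apply: Ly.
by rewrite MM !My Ey_add.
Qed.
Lemma y0 p : ye p (0, 0)%R = 1.
Proof.
have [j pj] := other_index p.1.
by apply/esym/(@y_unique _ _ _ j); rewrite ?hom1 ?Ey0 //; apply: on_pair_one.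
Qed.

Lemma Dg_pow_sv i (m : nat) p : sv p ## (Dg i ^+ m) = (dsc i p ^+ m *: sv p)%R.
Proof.
elim: m => [|m IH]; first by rewrite expg0 vact1 scale1r.
by rewrite expgSr vactM IH vactZ Dsv scalerA -exprSr.
Qed.
Lemma Dg_pow_wv i (m : nat) w : wv w ## (Dg i ^+ m) = wv (iter m wd w).
Proof. by elim: m => [|m IH]; rewrite ?vact1 // expgSr vactM IH Dwv. Qed.
Lemma dsc_q i p : (dsc i p ^+ q = dsc i p)%R.
Proof.
by rewrite /dsc; case: (p.1 == i); case: p.2; rewrite ?expr1n ?exprVn ?omega0_q.
Qed.
(** On the plane, seen as the quadratic extension, [wz] is the Frobenius map and
[wd] multiplication by an element of norm 1, which the Frobenius map inverts. *)
Lemma wd_wz w : wd (wz (wd w)) = wz w.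
Proof.
case: w => a b; rewrite /wd /wz /=; congr (_, _)%R.
  apply: (eqF F2 (c := B * C * a + B * C * a + B * b + B * C * (B * C) * a
    + B * C * B * b)%R); by rewrite AE; ring.
by apply: (eqF F2 (c := C * a + B * C * C * a + C * B * b)%R); rewrite AE; ring.
Qed.
Lemma iter_wd_q2 w : iter (q * q) wd w = wd w.
Proof.
have -> : (q * q = q.-1 * q.+1 + 1)%N by case: (q) q0 => // m _; lia.
rewrite iterD /=; elim: (q.-1) => // m IH.
by rewrite mulSn iterD IH wd_order.
Qed.

Lemma d_commute i j : commute (d i) (d j).
Proof.
have [->//|ij] := eqVneq i j; apply: (on_pair_inj (i := i) (j := j)).
- by apply: on_pairM; [apply: Ld|apply: Ld'].
- by apply: on_pairM; [apply: Ld'|apply: Ld].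
rewrite [LHS]MM [RHS]MM (Md i) (Md j).
apply: vact_ext => [p|w]; rewrite [LHS]vactM [RHS]vactM.
  rewrite (Dsv i p) (Dsv j p) [LHS]vactZ [RHS]vactZ (Dsv i p) (Dsv j p).
  by rewrite [LHS]scalerA [RHS]scalerA mulrC.
by rewrite (Dwv i w) (Dwv j w) (Dwv i) (Dwv j).
Qed.
Lemma z_commute i j : commute (z i) (z j).
Proof.
have [->//|ij] := eqVneq i j; apply: (on_pair_inj (i := i) (j := j)).
- by apply: on_pairM; [apply: Lz|apply: Lz'].
- by apply: on_pairM; [apply: Lz'|apply: Lz].
rewrite [LHS]MM [RHS]MM (Mz i) (Mz j).
apply: vact_ext => [p|w]; rewrite [LHS]vactM [RHS]vactM.
  rewrite (Zsv i p) (Zsv j p) (Zsv i) (Zsv j); congr sv; rewrite /flip.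
  by case ei: (p.1 == i); case ej: (p.1 == j); rewrite /= ?ei ?ej.
by rewrite (Zwv i w) (Zwv j w) (Zwv i) (Zwv j).
Qed.
Lemma dJz i j : i != j -> d j ^ z i = d j ^+ q.
Proof.
move=> ij; apply: (on_pair_inj (i := i) (j := j)).
- by apply: on_pairJ; [apply: Ld'|apply: Lz].
- by apply: on_pairX => //; apply: Ld'.
rewrite homJ homX Md Mz; apply: (mulgI (Zg i)); rewrite conjgE mulKVg.
apply: vact_ext => [p|w]; rewrite [LHS]vactM [RHS]vactM.
  rewrite (Dsv j p) vactZ (Zsv i p) Dg_pow_sv dsc_q; congr (_ *: _)%R.
  rewrite /dsc flip1 /flip; case: (p.1 =P i) => [->|//]; by rewrite (negPf ij).
rewrite (Dwv j w) !Zwv Dg_pow_wv; congr wv.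
set v := wz w; have e : wd (wz (wd w)) = v by rewrite wd_wz.
by rewrite -(wd_order (wz (wd w))) iterSr e.
Qed.
Lemma d_q2 i : d i ^+ (q * q) = d i.
Proof.
have [j ij] := other_index i; apply: (on_pair_inj (i := i) (j := j)); try exact: Ld.
  by apply: on_pairX => //; apply: Ld.
rewrite homX Md; apply: vact_ext => [p|w].
  by rewrite Dg_pow_sv exprM !dsc_q (Dsv i p).
by rewrite Dg_pow_wv iter_wd_q2 (Dwv i w).
Qed.

Lemma xJz_in p r a i : p.1 != r.1 -> (i == p.1) || (i == r.1) ->
  xe p r a ^ z i = xe (flip i p) (flip i r) a.
Proof.
move=> pr ii; apply: x_unique; rewrite ?flip1 //.
  by apply: on_pairJ; [apply: Lx|case/orP: ii => /eqP->; [apply: Lz|apply: Lz']].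
by rewrite homJ Mx // Mz ExJZ.
Qed.
Lemma xJd_in p r a i : p.1 != r.1 -> (i == p.1) || (i == r.1) ->
  xe p r a ^ d i = xe p r (dsc i p * (dsc i r * a))%R.
Proof.
move=> pr ii; apply: x_unique => //.
  by apply: on_pairJ; [apply: Lx|case/orP: ii => /eqP->; [apply: Ld|apply: Ld']].
by rewrite homJ Mx // Md ExJD.
Qed.
Lemma yJz p w i : ye p w ^ z i = ye (flip i p) (wz w).
Proof.
have [j [pj ij]] : exists j, p.1 != j /\ (i = p.1 \/ i = j).
  have [->|ip] := eqVneq i p.1; last by exists i; rewrite eq_sym; split; [|right].
  by have [j pj] := other_index p.1; exists j; split; [|left].
apply: (@y_unique _ _ _ j); rewrite ?flip1 //.
  by apply: on_pairJ; [apply: Ly|case: ij => ->; [apply: Lz|apply: Lz']].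
by rewrite homJ My Mz EyJZ.
Qed.
Lemma yJd p w i : ye p w ^ d i = ye p (wact A B C (dsc i p) w).
Proof.
have [j [pj ij]] : exists j, p.1 != j /\ (i = p.1 \/ i = j).
  have [->|ip] := eqVneq i p.1; last by exists i; rewrite eq_sym; split; [|right].
  by have [j pj] := other_index p.1; exists j; split; [|left].
apply: (@y_unique _ _ _ j) => //.
  by apply: on_pairJ; [apply: Ly|case: ij => ->; [apply: Ld|apply: Ld']].
by rewrite homJ My Md EyJD.
Qed.

Lemma perm3 i j l : i != j -> i != l -> j != l ->
  exists s : {perm I}, [/\ s o0 = i, s o1 = j & s o2 = l].
Proof.
move=> ij il jl; have [s [s0 s1]] := perm2 ij.
exists (s * tperm (s o2) l); rewrite !permM s0 s1 tpermL.
by split=> //; rewrite tpermD // 1?eq_sym // -?s0 -?s1 (inj_eq perm_inj).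
Qed.
Definition dist3 p r u := [&& p.1 != r.1, p.1 != u.1 & r.1 != u.1] : bool.

(** Triples of signed indices with distinct indices form one orbit under sign
changes and permutations, so a property with this invariance is checked on one
triple. *)
Lemma transport3 (P : I * bool -> I * bool -> I * bool -> Prop) b0 b1 b2 :
  (forall i p r u, dist3 p r u -> P p r u -> P (flip i p) (flip i r) (flip i u)) ->
  (forall s p r u, dist3 p r u -> P p r u ->
    P (perm_sv s p) (perm_sv s r) (perm_sv s u)) ->
  P (o0, b0) (o1, b1) (o2, b2) -> forall p r u, dist3 p r u -> P p r u.
Proof.
move=> Hz Hs P0 p r u /and3P[pr pu ru].
have [s [s0 s1 s2]] := perm3 pr pu ru.
have {}P0 : P (o0, p.2) (o1, b1) (o2, b2).
  by have := Hz o0 (o0, b0) (o1, b1) (o2, b2) isT P0; case: p.2; case: b0 P0.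
have {}P0 : P (o0, p.2) (o1, r.2) (o2, b2).
  by have := Hz o1 (o0, p.2) (o1, b1) (o2, b2) isT P0; case: r.2; case: b1 P0.
have {}P0 : P (o0, p.2) (o1, r.2) (o2, u.2).
  by have := Hz o2 (o0, p.2) (o1, r.2) (o2, b2) isT P0; case: u.2; case: b2 P0.
have := Hs s (o0, p.2) (o1, r.2) (o2, u.2) isT P0.
by rewrite /perm_sv /= s0 s1 s2 -!surjective_pairing.
Qed.

Lemma flip_same p : flip p.1 p = np p.
Proof. by rewrite /flip eqxx. Qed.
Lemma flip_other i p : i != p.1 -> flip i p = p.
Proof. by rewrite /flip eq_sym => /negPf->. Qed.
Lemma dsc_other i p : i != p.1 -> dsc i p = 1%R.
Proof. by rewrite /dsc eq_sym => /negPf->. Qed.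

Lemma same_index r u : r.1 = u.1 -> u = r \/ u = np r.
Proof. by case: r u => [i []] [j []] /= ->; [left|right|right|left]. Qed.

Lemma sg_xe : sg = xe (o0, true) (o1, false) 1%R.
Proof.
apply: x_unique => //; last by rewrite Msg (sigmaE N omega0 B F2) /Ex scale1r.
by exists 1, sg; split; rewrite ?perm1 ?psi1 ?conjg1 //; apply: gen_in; apply: Or32.
Qed.
Lemma tg_ye : tg = ye (o0, true) (1, 0)%R.
Proof.
apply: (@y_unique _ _ _ o1) => //; last by rewrite Mtg (tauE N omega0 B F2).
apply: on_index_Loc => //; exists 1, tg.
by split; rewrite ?perm1 ?psi1 ?conjg1 //; apply: gen_in; apply: Or31.
Qed.

Lemma xJdX p r a (m : nat) : p.1 != r.1 ->
  xe p r a ^ (d p.1 ^+ m) = xe p r (dsc p.1 p ^+ m * a)%R.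
Proof.
move=> pr; elim: m => [|m IH]; first by rewrite conjg1 expr0 mul1r.
rewrite expgSr conjgM IH xJd_in ?eqxx //.
by rewrite (dsc_other pr) mul1r exprS mulrA.
Qed.
Lemma xJdX' p r a (m : nat) : p.1 != r.1 ->
  xe p r a ^ (d r.1 ^+ m) = xe p r (dsc r.1 r ^+ m * a)%R.
Proof. by move=> pr; rewrite !(x_sym _ pr) xJdX // eq_sym. Qed.
Lemma omega0V_pow (a : F) : a != 0%R -> exists m, a = (omega0^-1 ^+ m)%R.
Proof.
move=> a0; have [m e] : exists m, (a^-1 = omega0 ^+ m)%R by apply: omega0_pow; rewrite invr_eq0.
by exists m; rewrite exprVn -e invrK.
Qed.
Lemma dq1_z i j : i != j -> commute (d j ^+ q.+1) (z i).
Proof.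
move=> ij; apply/commute_fix; rewrite conjXg (dJz ij) -expgM mulnS expgD d_q2.
by rewrite -expgSr expgS.
Qed.

Lemma commute1l x : commute 1 x.
Proof. exact/commute_sym/commute1. Qed.

(** The given relation is the case [a = 1] on one triple of indices. The torus at
the first index reaches the other [a], through powers that commute with the
element at the third index. *)
Lemma x_third_index (y : I -> G) : (forall i s, y i ^ psi s = y (s i)) ->
  (forall x i j, i != j -> commute x (y j) -> commute (x ^ z i) (y j)) ->
  (forall a, a != 0%R -> exists m : nat, a = (omega0 ^+ m)%R /\ commute (d o0 ^+ m) (y o2)) ->
  commute sg (y o2) -> forall p r u a, dist3 p r u -> commute (xe p r a) (y u.1).
Proof.
move=> yJ yz yd sgy p r u a pru; move: p r u pru a.
apply: (@transport3 (fun p r u => forall a, commute (xe p r a) (y u.1)) true false true).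
- move=> i p r u /and3P[pr pu ru] Pp a; rewrite flip1.
  have [ii|] := boolP ((i == p.1) || (i == r.1)); last first.
    by rewrite negb_or => /andP[ip ir]; rewrite !flip_other.
  by rewrite -xJz_in //; apply: yz (Pp a); case/orP: ii => /eqP->.
- move=> s p r u /and3P[pr _ _] Pp a; have := commuteJ (psi s) (Pp a).
  by rewrite xJpsi // yJ.
move=> a; have [->|/yd[m [-> dy]]] := eqVneq a 0%R; first by rewrite x0 //; apply: commute1l.
move: sgy; rewrite sg_xe => /(commuteJ (d o0 ^+ m)).
rewrite (@xJdX (o0, true)) // /dsc /= mulr1; congr commute.
exact/commute_fix/commute_sym.
Qed.

Lemma x_d p r u a : dist3 p r u -> commute (xe p r a) (d u.1).
Proof.
apply: x_third_index => [||{}a|]; first exact: dJpsi; last by rewrite dE; exact: sg_d.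
- move=> x i j ij c; have := commuteJ (z i) c; rewrite (dJz ij) => /(commuteX q).
  by rewrite -expgM d_q2.
move=> /omega0_pow[m ->]; exists m; split=> //.
exact/commute_sym/commuteX/d_commute.
Qed.

(** Here [d j] itself does not commute with [z i], but its power [q.+1] does
([dq1_z]), and the powers of [omega0 ^+ q.+1] are all nonzero scalars. *)
Lemma x_z p r u a : dist3 p r u -> commute (xe p r a) (z u.1).
Proof.
apply: x_third_index => [||{}a|]; first exact: zJpsi; last by rewrite zE; exact: sg_z.
- move=> x i j ij c; have := commuteJ (z i) c.
  by have /commute_fix-> := z_commute j i.
move=> /omega0_powS[m ->]; exists (q.+1 * m)%N; split=> //.
by rewrite expgM; apply/commute_sym/commuteX/commute_sym/dq1_z.
Qed.

Lemma xJz p r a i : p.1 != r.1 -> xe p r a ^ z i = xe (flip i p) (flip i r) a.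
Proof.
move=> pr; have [ii|] := boolP ((i == p.1) || (i == r.1)); first exact: xJz_in.
rewrite negb_or => /andP[ip ir]; rewrite !flip_other //.
apply/commute_fix; apply: (@x_z p r (i, true)).
by rewrite /dist3 pr /= eq_sym ip eq_sym ir.
Qed.
Lemma xJd p r a i : p.1 != r.1 ->
  xe p r a ^ d i = xe p r (dsc i p * (dsc i r * a))%R.
Proof.
move=> pr; have [ii|] := boolP ((i == p.1) || (i == r.1)); first exact: xJd_in.
rewrite negb_or => /andP[ip ir]; rewrite !dsc_other // !mul1r.
apply/commute_fix; apply: (@x_d p r (i, true)).
by rewrite /dist3 pr /= eq_sym ip eq_sym ir.
Qed.

(** The torus at index [u.1] reaches all [w] from the given relation with
[w = w_1], and the torus at [p.1] then reaches all scalars [a], up to a change of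
[w], which is now arbitrary. *)
Lemma x_y p r u a w : dist3 p r u -> commute (xe p r a) (ye u w).
Proof.
move=> pru; move: p r u pru a w.
pose P p r u := forall a w, commute (xe p r a) (ye u w).
have Pz i p r u : dist3 p r u -> P p r u -> P (flip i p) (flip i r) (flip i u).
  move=> /and3P[pr _ _] Pp a w; have := commuteJ (z i) (Pp a (wz w)).
  by rewrite xJz // yJz wzK.
have Pf : P (o1, true) (o2, false) (o0, true); last first.
  move=> p r u D; have := D; rewrite /dist3 => /and3P[pr pu ru].
  have D' : dist3 u p r by rewrite /dist3 eq_sym pu eq_sym ru pr.
  move: u p r D' {D pr pu ru}; apply: (@transport3 (fun u p r => P p r u) _ _ _ _ _ Pf).
    move=> i u p r /and3P[up ur pr]; apply: Pz.
    by rewrite /dist3 pr eq_sym up eq_sym ur.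
  move=> s u p r /and3P[up ur pr] Pp a w; have := commuteJ (psi s) (Pp a w).
  by rewrite xJpsi // yJpsi.
have [s [s0 s1 _]] := @perm3 o1 o2 o0 isT isT isT.
have base : commute (xe (o1, true) (o2, false) 1%R) tg.
  by have := sg_tg s0 s1; rewrite {1}sg_xe xJpsi // /perm_sv /= s0 s1.
have {}base w : commute (xe (o1, true) (o2, false) 1%R) (ye (o0, true) w).
  have [->|/(wact_trans true)[m ->]] := eqVneq w (0, 0)%R.
    by rewrite y0; apply: commute1.
  elim: m => [|m IH]; first by rewrite -tg_ye.
  have := commuteJ (d o0) IH; rewrite yJd xJd //= /dsc /= !mul1r.
  by rewrite -iterS.
have {}base a w : a != 0%R -> commute (xe (o1, true) (o2, false) a) (ye (o0, true) w).
  move=> /omega0_pow[m ->]; elim: m w => [|m IH] w; first exact: base.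
  have [v ->] : exists v, w = wact A B C 1 v.
    exists (iter q wd w); rewrite /wact !mul1r -surjective_pairing.
    by rewrite -iterS wd_order.
  have := commuteJ (d o1) (IH v); rewrite yJd xJd //= /dsc /= mul1r.
  by rewrite -exprS.
move=> a w; have [->|a0] := eqVneq a 0%R; last exact: base.
by rewrite x0 //; apply: commute1l.
Qed.

(** Both coefficients are reached from 1 by the torus at [r.1] and at [u.1]; each
of the two fixes the other root element by [x_d]. *)
Lemma x_x p r u a b : dist3 p r u -> commute (xe p r a) (xe p u b).
Proof.
move=> pru; move: p r u pru a b.
pose P p r u := forall a b, commute (xe p r a) (xe p u b).
have Pz i p r u : dist3 p r u -> P p r u -> P (flip i p) (flip i r) (flip i u).
  move=> /and3P[pr pu _] Pp a b; have := commuteJ (z i) (Pp a b).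
  by rewrite !xJz.
apply: (@transport3 P true false false) => //.
- move=> s p r u /and3P[pr pu _] Pp a b; have := commuteJ (psi s) (Pp a b).
  by rewrite !xJpsi.
move=> a b.
have [->|/omega0V_pow[m ->]] := eqVneq a 0%R; first by rewrite x0 //; apply: commute1l.
have [->|/omega0V_pow[l ->]] := eqVneq b 0%R; first by rewrite x0 //; apply: commute1.
have [s [s0 s1 s2]] := @perm3 o0 o2 o1 isT isT isT.
have := sg_sg0; rewrite sg_xe xJpsi // /perm_sv /= tpermL tpermD //.
move=> /(commuteJ (d o1 ^+ m)).
rewrite (@xJdX' (o0, true) (o1, false)) // /dsc /= mulr1.
have/commute_fix-> := @commuteX _ _ _ m (@x_d (o0, true) (o2, false) (o1, true) 1%R isT).
move=> /(commuteJ (d o2 ^+ l)).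
rewrite (@xJdX' (o0, true) (o2, false)) // /dsc /= mulr1.
have/commute_fix-> := @commuteX _ _ _ l (@x_d (o0, true) (o1, false) (o2, true)
  (omega0^-1 ^+ m)%R isT).
by [].
Qed.

(** The Chevalley commutator relation, spread from coefficients 1 by the torus
at [p.1] and at [u.1]. *)
Lemma x_xJ p r u a b : dist3 p r u ->
  xe p r a ^ xe (np r) u b = xe p r a * xe p u (a * b)%R.
Proof.
move=> pru; move: p r u pru a b.
pose P p r u := forall a b, xe p r a ^ xe (np r) u b = xe p r a * xe p u (a * b)%R.
have Pz i p r u : dist3 p r u -> P p r u -> P (flip i p) (flip i r) (flip i u).
  move=> /and3P[pr pu ru] Pp a b; have := congr1 (fun x => x ^ z i) (Pp a b).
  rewrite /= conjJg conjMg !xJz //; congr (_ ^ xe _ _ _ = _).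
  by rewrite /flip /=; case: (r.1 == i).
apply: (@transport3 P true false false) => //.
- move=> s p r u /and3P[pr pu ru] Pp a b; have := congr1 (fun x => x ^ psi s) (Pp a b).
  by rewrite /= conjJg conjMg !xJpsi.
move=> a b.
have [->|/omega0_pow[m ->]] := eqVneq a 0%R; first by rewrite mul0r !x0 // conj1g mul1g.
have [->|/omega0V_pow[l ->]] := eqVneq b 0%R.
  by rewrite mulr0 !x0 // conjg1 mulg1.
have [s [s0 s1 _]] := @perm3 o1 o2 o0 isT isT isT.
have E1 : xe (o0, true) (o1, false) 1%R ^ xe (np (o1, false)) (o2, false) 1%R
    = xe (o0, true) (o1, false) 1%R * xe (o0, true) (o2, false) 1%R.
  have := sg_sg s0 s1; rewrite sg_xe !xJpsi // /perm_sv /= s0 s1 tpermL tpermD //.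
  by move=> <-; rewrite /commg mulKVg.
have := congr1 (fun x => x ^ (d o0 ^+ m)) E1; rewrite /= conjJg conjMg.
rewrite !(@xJdX (o0, true)) // /dsc /= !mulr1.
have/commute_fix-> := @commuteX _ _ _ m (@x_d (o1, true) (o2, false) (o0, true) 1%R isT).
move=> {}E1; have := congr1 (fun x => x ^ (d o2 ^+ l)) E1; rewrite /= conjJg [X in _ = X]conjMg.
rewrite (@xJdX' (o0, true) (o2, false)) // (@xJdX' (o1, true) (o2, false)) //.
rewrite /dsc /= !mulr1.
have/commute_fix-> := @commuteX _ _ _ l (@x_d (o0, true) (o1, false) (o2, true)
  (omega0 ^+ m)%R isT).
by rewrite [(_ * omega0 ^+ m)%R]mulrC.
Qed.

(** Two roots on four distinct indices: one relation, moved by the permutations,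
the torus, and the four sign changes in turn. *)
Lemma x_x4 p r u v a b : dist3 p r u -> dist3 p r v -> u.1 != v.1 ->
  commute (xe p r a) (xe u v b).
Proof.
move=> /and3P[pr pu ru] /and3P[_ pv rv] uv.
have base : commute (xe (p.1, true) (r.1, false) 1%R) (xe (u.1, true) (v.1, false) 1%R).
  have [s [s0 s1]] := perm2 pr; have [t [t0 t1]] := perm2 uv.
  have := @sg_sg2 (t * s^-1); rewrite !permM t0 t1.
  rewrite -(inj_eq (@perm_inj _ s) _ o0) -(inj_eq (@perm_inj _ s) _ o1).
  rewrite -(inj_eq (@perm_inj _ s) _ o0) -(inj_eq (@perm_inj _ s) _ o1).
  rewrite !permKV s0 s1 => /(_ _ _ _ _)H.
  have {}H : commute sg (sg ^ psi (t * s^-1)) by apply: H; rewrite eq_sym.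
  have := commuteJ (psi s) H; rewrite -conjgM -psiM mulgVK sg_xe !xJpsi //.
  by rewrite /perm_sv /= s0 s1 t0 t1.
have [->|/omega0_pow[m ->]] := eqVneq a 0%R; first by rewrite x0 //; apply: commute1l.
have [->|/omega0_pow[l ->]] := eqVneq b 0%R; first by rewrite x0 //; apply: commute1.
have {}base : commute (xe (p.1, true) (r.1, false) (omega0 ^+ m)%R)
    (xe (u.1, true) (v.1, false) (omega0 ^+ l)%R).
  have := commuteJ (d p.1 ^+ m) base.
  rewrite (@xJdX (p.1, true)) // /dsc /= eqxx mulr1.
  have D : dist3 (u.1, true) (v.1, false) (p.1, true).
    by rewrite /dist3 /= uv eq_sym pu eq_sym pv.
  have/commute_fix-> := @commuteX _ _ _ m (@x_d _ _ _ 1%R D).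
  move=> /(commuteJ (d u.1 ^+ l)).
  rewrite (@xJdX (u.1, true)) // /dsc /= eqxx mulr1.
  have D' : dist3 (p.1, true) (r.1, false) (u.1, true) by rewrite /dist3 /= pr pu ru.
  by have/commute_fix-> := @commuteX _ _ _ l (@x_d _ _ _ (omega0 ^+ m)%R D').
pose fl i (c : bool) (p' : I * bool) := if c then flip i p' else p'.
have fl1 i c p' : (fl i c p').1 = p'.1 by rewrite /fl; case: c; rewrite ?flip1.
have flJ i c p' r' u' v' :
    commute (xe p' r' (omega0 ^+ m)%R) (xe u' v' (omega0 ^+ l)%R) ->
    p'.1 != r'.1 -> u'.1 != v'.1 ->
    commute (xe (fl i c p') (fl i c r') (omega0 ^+ m)%R)
            (xe (fl i c u') (fl i c v') (omega0 ^+ l)%R).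
  by case: c => // /(commuteJ (z i)) + H1 H2; rewrite !xJz.
move: base => /(flJ p.1 (~~ p.2))/(_ pr uv)/(flJ r.1 r.2); rewrite !fl1.
move=> /(_ pr uv)/(flJ u.1 (~~ u.2)); rewrite !fl1 => /(_ pr uv)/(flJ v.1 v.2); rewrite !fl1.
move=> /(_ pr uv); rewrite /fl /flip.
have E (i j : I) : i != j -> ((i == j = false) * (j == i = false))%type.
  by move=> ij; rewrite [j == i]eq_sym (negPf ij).
move: {flJ fl1 fl} (E _ _ pr) (E _ _ pu) (E _ _ pv) (E _ _ ru) (E _ _ rv) (E _ _ uv).
case: p r u v {pr pu pv ru rv uv} => [i b0] [j b1] [k b2] [h b3] /= pr pu pv ru rv uv.
by case: b0; case: b1; case: b2; case: b3;
  do ![rewrite /np /= ?(eqxx, pr, pu, pv, ru, rv, uv)].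
Qed.

Lemma x_x2 p r a b : p.1 != r.1 -> commute (xe p r a) (xe p (np r) b).
Proof.
move=> pr; apply: (on_pair_inj (i := p.1) (j := r.1)).
- by apply: on_pairM; [apply: Lx|apply: (Lx (r := np r))].
- by apply: on_pairM; [apply: (Lx (r := np r))|apply: Lx].
by rewrite [LHS]MM [RHS]MM (Mx a pr) (@Mx p (np r) b pr); apply: Ex_commute.
Qed.
Lemma x_y2 p r a w : p.1 != r.1 -> commute (xe p r a) (ye p w).
Proof.
move=> pr; apply: (on_pair_inj (i := p.1) (j := r.1)).
- by apply: on_pairM; [apply: Lx|apply: Ly].
- by apply: on_pairM; [apply: Ly|apply: Lx].
by rewrite [LHS]MM [RHS]MM (Mx a pr) My; apply: ExEy_commute.
Qed.
Lemma y_y p w w' : commute (ye p w) (ye p w').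
Proof. by rewrite /commute !yD; congr (ye _ (_, _)); rewrite addrC. Qed.
Lemma xJy p r a w : p.1 != r.1 -> xe p r a ^ ye r w = xe p r a.
Proof.
move=> pr; apply: (on_pair_inj (i := p.1) (j := r.1)); first 1 last.
- exact: Lx.
- by rewrite homJ Mx // My ExJEy.
by apply: on_pairJ; [apply: Lx|apply: Ly'].
Qed.
Lemma xJyN p r a w : p.1 != r.1 -> xe p r a ^ ye (np r) w =
  xe p r a * ye p (a * w.1, a * w.2)%R * xe p (np r) (a * qw omega0 B w)%R.
Proof.
move=> pr; apply: (on_pair_inj (i := p.1) (j := r.1)).
- by apply: on_pairJ; [apply: Lx|apply: (@Ly' (np r) _ _ pr)].
- apply: on_pairM; last exact: (Lx (r := np r)).
  by apply: on_pairM; [apply: Lx|apply: Ly].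
by rewrite homJ !MM (Mx a pr) !My (@Mx p (np r) _ pr) ExJEyN.
Qed.
Lemma yJy p r w w' : p.1 != r.1 -> ye p w ^ ye r w' = ye p w * xe p r (bw B w w').
Proof.
move=> pr; apply: (on_pair_inj (i := p.1) (j := r.1)).
- by apply: on_pairJ; [apply: Ly|apply: Ly'].
- by apply: on_pairM; [apply: Ly|apply: Lx].
by rewrite homJ !MM !My Mx // EyJEy.
Qed.
Lemma swap_x i j : i != j -> psi (tperm i j) =
  xe (i, true) (j, false) 1%R * xe (i, false) (j, true) 1%R * xe (i, true) (j, false) 1%R.
Proof.
move=> ij; apply: (on_pair_inj (i := i) (j := j)); first exact: Ls.
  by apply: on_pairM; [apply: on_pairM|]; apply: (@Lx (_, _) (_, _)).
by rewrite Mpsi !MM !Mx // (@swapE _ _ omega0 B F2 (i, true) (j, false)).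
Qed.
Lemma z_y i b : z i =
  ye (i, b) (1, 0)%R * ye (i, ~~ b) (1, 0)%R * ye (i, b) (1, 0)%R.
Proof.
have [j ij] := other_index i; apply: (on_pair_inj (i := i) (j := j)); first exact: Lz.
  by apply: on_pairM; [apply: on_pairM|]; apply: (@Ly (_, _)).
by rewrite Mz !MM !My -Zg_Ey.
Qed.
Lemma dJz_same i : d i ^ z i = (d i)^-1.
Proof.
have [j ij] := other_index i; apply: (on_pair_inj (i := i) (j := j)).
- by apply: on_pairJ; [apply: Ld|apply: Lz].
- by apply: on_pairV; apply: Ld.
rewrite homJ homV Md Mz; apply: (mulgI (Zg i)); rewrite conjgE mulKVg.
apply: (mulIg (Dg i)); rewrite mulgVK.
apply: vact_ext => [p|w]; rewrite !vactM.
  rewrite (Dsv i p) vactZ (Zsv i p) vactZ Dsv scalerA -[RHS]scale1r; congr (_ *: _)%R.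
  rewrite /dsc flip1 /flip; case: (p.1 =P i) => [e|]; last by rewrite mulr1.
  by rewrite /=; case: p.2; rewrite /= ?divff ?mulVf.
by rewrite (Dwv i w) !Zwv Dwv wd_wz.
Qed.
(** The power [q.-1] of [delta_i] is trivial on the hyperbolic basis, and on the
anisotropic plane it does not depend on [i]. *)
Lemma d_q1 i j : d i ^+ q.-1 = d j ^+ q.-1.
Proof.
have [->//|ij] := eqVneq i j; apply: (on_pair_inj (i := i) (j := j)).
- by apply: on_pairX => //; apply: Ld.
- by apply: on_pairX => //; apply: Ld'.
have t i' p : (dsc i' p ^+ q.-1)%R = 1%R.
  by rewrite /dsc; case: (p.1 == i'); case: p.2; rewrite ?expr1n // ?exprVn omega0_q1 ?invr1.
rewrite !homX !Md; apply: vact_ext => [p|w]; first by rewrite !Dg_pow_sv !t.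
by rewrite !Dg_pow_wv.
Qed.
Lemma dV i : (d i)^-1 = d i ^+ (q * q - 2).
Proof.
apply: (mulgI (d i)); rewrite mulgV -expgS; apply: (mulgI (d i)).
rewrite mulg1 -expgS -[LHS](d_q2 i); congr (_ ^+ _).
by case: (q) q_gt1 => [|[|m]] // _; lia.
Qed.
Lemma zz i : z i * z i = 1.
Proof.
have [j ij] := other_index i; apply: (on_pair_inj (i := i) (j := j)).
- by apply: on_pairM; apply: Lz.
- exact: on_pair_one.
rewrite MM hom1 Mz; apply: vact_ext => [p|w]; rewrite vactM vact1.
  by rewrite !Zsv flipK.
by rewrite !Zwv wzK.
Qed.
Lemma zV i : (z i)^-1 = z i.
Proof. by apply: (mulgI (z i)); rewrite mulgV zz. Qed.
Lemma xx p r a : p.1 != r.1 -> xe p r a * xe p r a = 1.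
Proof. by move=> pr; rewrite xD // addFF // x0. Qed.
Lemma yy p w : ye p w * ye p w = 1.
Proof. by rewrite yD !addFF // y0. Qed.

(** The chain of subgroups: [levi m] acts on the space obtained by
dropping the first [m] hyperbolic pairs, and [parab i] is the stabiliser in
[levi i] of the line of [f_i], with unipotent radical [unip i]. *)
Definition Lgen (m : nat) x := [\/
  exists p r a, [/\ (m <= p.1)%N, (m <= r.1)%N, p.1 != r.1 & x = xe p r a],
  exists p w, (m <= p.1)%N /\ x = ye p w | exists i, (m <= i)%N /\ x = d i].
Definition levi m := gen (Lgen m).
Definition Qgen i x := (exists r a, (i < r.1)%N /\ x = xe (i, true) r a) \/
  exists w, x = ye (i, true) w.
Definition unip i := gen (Qgen i).
Definition Pgen i x := [\/ Lgen i.+1 x, Qgen i x | x = d i].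
Definition parab i := gen (Pgen i).

Lemma ltn_neq i j : (i < j)%N -> i != j.
Proof. by move=> ij; apply: contraTneq ij => ->; rewrite ltnn. Qed.

Lemma QxJx i r u (v : I * bool) a b : (i < r.1)%N -> (i < u.1)%N -> (i < v.1)%N -> u.1 != v.1 ->
  r.1 != v.1 -> unip i (xe (i, true) r a ^ xe u v b).
Proof.
move=> ir iu iv uv rv; have [ir' iu' iv'] := And3 (ltn_neq ir) (ltn_neq iu) (ltn_neq iv).
have Qx c (t : I * bool) : (i < t.1)%N -> unip i (xe (i, true) t c).
  by move=> it; apply: gen_in; left; exists t, c.
have [ru|ru] := eqVneq r.1 u.1.
  have [->|->] := same_index ru.
    suff /commute_fix-> : commute (xe (i, true) r a) (xe r v b) by apply: Qx.
    rewrite (x_sym a (p := (i, true))) //; apply: x_x.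
    by rewrite /dist3 /= rv eq_sym ir' iv'.
  rewrite x_xJ; last by rewrite /dist3 /= ir' iv' rv.
  by apply: gen_M; apply: Qx.
suff /commute_fix-> : commute (xe (i, true) r a) (xe u v b) by apply: Qx.
by apply: x_x4; rewrite /dist3 /= ?ir' ?iu' ?iv' ?ru ?rv.
Qed.
(** The radical is normalised by the Levi part; this is where the commutator
relations between root elements are used. *)
Lemma QJL i x y : Qgen i x -> Lgen i.+1 y -> unip i (x ^ y).
Proof.
have Qx c (t : I * bool) : (i < t.1)%N -> unip i (xe (i, true) t c).
  by move=> it; apply: gen_in; left; exists t, c.
have Qy w : unip i (ye (i, true) w) by apply: gen_in; right; exists w.
move=> [[r [a [ir ->]]]|[w ->]] [[u [v [b [iu iv uv ->]]]]|[u [w' [iu ->]]]|[j [ij ->]]].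
- have [rv|rv] := eqVneq r.1 v.1; last exact: QxJx.
  rewrite (x_sym b uv); apply: QxJx => //; first by rewrite eq_sym.
  by rewrite rv eq_sym.
- have [ru|ru] := eqVneq r.1 u.1; last first.
    suff /commute_fix-> : commute (xe (i, true) r a) (ye u w') by apply: Qx.
    by apply: x_y; rewrite /dist3 /= ru (ltn_neq ir) (ltn_neq iu).
  have [->|->] := same_index ru.
    by rewrite xJy ?(ltn_neq ir) //; apply: Qx.
  rewrite xJyN ?(ltn_neq ir) //; apply: gen_M; last exact: Qx.
  by apply: gen_M; [apply: Qx|apply: Qy].
- by rewrite xJd ?(ltn_neq ir) //; apply: Qx.
- suff /commute_sym/commute_fix-> : commute (xe u v b) (ye (i, true) w) by apply: Qy.
  by apply: x_y; rewrite /dist3 /= uv eq_sym (ltn_neq iu) eq_sym (ltn_neq iv).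
- rewrite yJy ?(ltn_neq iu) //; apply: gen_M; first exact: Qy.
  exact: Qx.
by rewrite yJd; apply: Qy.
Qed.
Lemma QJd i x : Qgen i x -> unip i (x ^ d i).
Proof.
move=> [[r [a [ir ->]]]|[w ->]]; last by rewrite yJd; apply: gen_in; right; eexists.
rewrite xJd ?(ltn_neq ir) //; apply: gen_in; left.
by exists r; eexists; split; [exact: ir|].
Qed.

Lemma Lgen_fin m x : Lgen m x -> exists l : nat, x^-1 = x ^+ l.
Proof.
move=> [[p [r [a [_ _ pr ->]]]]|[p [w [_ ->]]]|[i [_ ->]]].
- by exists 1%N; apply: (mulgI (xe p r a)); rewrite expg1 mulgV xx.
- by exists 1%N; apply: (mulgI (ye p w)); rewrite expg1 mulgV yy.
by eexists; apply: dV.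
Qed.
Lemma Qgen_fin i x : Qgen i x -> exists l : nat, x^-1 = x ^+ l.
Proof.
move=> [[r [a [ir ->]]]|[w ->]]; exists 1%N; rewrite expg1.
  by apply: (mulgI (xe (i, true) r a)); rewrite mulgV xx // ltn_neq.
by apply: (mulgI (ye (i, true) w)); rewrite mulgV yy.
Qed.
Lemma Pgen_fin i x : Pgen i x -> exists l : nat, x^-1 = x ^+ l.
Proof. by move=> [/Lgen_fin|/Qgen_fin|->] //; eexists; apply: dV. Qed.
Lemma dXV i (m : nat) : (d i ^+ m)^-1 = d i ^+ ((q * q - 2) * m).
Proof. by rewrite -expVgn dV expgM. Qed.

Lemma levi_parab i x : levi i.+1 x -> parab i x.
Proof. by apply: gen_sub => y Ly; apply: gen_in; apply: Or31. Qed.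
Lemma unip_parab i x : unip i x -> parab i x.
Proof. by apply: gen_sub => y Qy; apply: gen_in; apply: Or32. Qed.
Lemma d_parab i (m : nat) : parab i (d i ^+ m).
Proof. by apply: gen_X; apply: gen_in; apply: Or33. Qed.

Lemma unipJL i x y : levi i.+1 y -> unip i x -> unip i (x ^ y).
Proof.
move=> Ly; move: x; apply: (gen_ind_fin (R := fun y => forall x, unip i x -> unip i (x ^ y))) Ly.
- exact: Lgen_fin.
- by move=> x; rewrite conjg1.
- by move=> u v Hu Hv x Qx; rewrite conjgM; apply/Hv/Hu.
by move=> u Lu x; apply: gen_conj => v Qv; apply: QJL.
Qed.
Lemma unipJd i x (m : nat) : unip i x -> unip i (x ^ (d i ^+ m)).
Proof.
elim: m x => [|m IH] x Qx; first by rewrite conjg1.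
by rewrite expgS conjgM; apply/IH; move: Qx; apply: gen_conj; apply: QJd.
Qed.
Lemma leviJd i x (m : nat) : levi i.+1 x -> levi i.+1 (x ^ (d i ^+ m)).
Proof.
elim: m x => [|m IH] x Lx; first by rewrite conjg1.
rewrite expgS conjgM; apply/IH; move: Lx; apply: gen_conj => {m IH}.
move=> y [[p [r [a [ip ir pr ->]]]]|[p [w [ip ->]]]|[j [ij ->]]]; apply: gen_in.
- by rewrite xJd //; apply: Or31; exists p, r; eexists.
- by rewrite yJd; apply: Or32; exists p; eexists.
apply: Or33; exists j; split=> //.
exact/commute_fix/d_commute.
Qed.
Lemma leviJz i x : levi i.+1 x -> levi i.+1 (x ^ z i).
Proof.
apply: gen_conj.
move=> y [[p [r [a [ip ir pr ->]]]]|[p [w [ip ->]]]|[j [ij ->]]].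
- rewrite xJz // !flip_other ?ltn_neq //; apply: gen_in.
  by apply: Or31; exists p, r, a.
- rewrite yJz flip_other ?ltn_neq //; apply: gen_in.
  by apply: Or32; exists p; eexists.
rewrite dJz ?ltn_neq //; apply: gen_X; apply: gen_in.
by apply: Or33; exists j.
Qed.

(** The Levi decomposition of the parabolic subgroup. *)
Lemma parabP i x : parab i x -> exists v l (m : nat),
  [/\ unip i v, levi i.+1 l & x = v * l * d i ^+ m].
Proof.
apply: (gen_ind_fin (R := fun x => exists v l (m : nat),
  [/\ unip i v, levi i.+1 l & x = v * l * d i ^+ m])) => {x}.
- exact: Pgen_fin.
- by exists 1, 1, 0%N; split; rewrite ?mulg1 //; apply: gen_1.
- move=> _ _ [v [l [m [Qv Ll ->]]]] [v' [l' [m' [Qv' Ll' ->]]]].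
  exists (v * (v' ^ ((d i ^+ m)^-1 * l^-1))), (l * l' ^ (d i ^+ m)^-1), (m + m')%N.
  split.
  + apply: gen_M => //; rewrite conjgM; apply: unipJL; first exact: gen_V.
    by rewrite dXV; apply: unipJd.
  + by apply: gen_M => //; rewrite dXV; apply: leviJd.
  by rewrite expgD !conjgE !invgM !invgK !mulgA !mulgVK.
move=> x [Lx|Qx|->].
- by exists 1, x, 0%N; split; rewrite ?mulg1 ?mul1g //; [apply: gen_1|apply: gen_in].
- by exists x, 1, 0%N; split; rewrite ?mulg1 //; [apply: gen_in|apply: gen_1].
by exists 1, 1, 1%N; split; rewrite ?mul1g ?expg1 //; apply: gen_1.
Qed.

Lemma levi_sv i b x : levi i.+1 x -> sv (i, b) ## M x = sv (i, b).
Proof.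
apply: (gen_ind_fin (R := fun x => sv (i, b) ## M x = sv (i, b))) => {x}.
- exact: Lgen_fin.
- by rewrite hom1 vact1.
- by move=> x y ex ey; rewrite MM vactM ex ey.
move=> y [[p [r [a [ip ir pr ->]]]]|[p [w [ip ->]]]|[j [ij ->]]].
- rewrite Mx // Ex_sv // /np !xpair_eqE ![_ == i]eq_sym !(negPf (ltn_neq _)) //.
  by rewrite !mul0r !scale0r !addr0.
- rewrite My Ey_sv // /np !xpair_eqE ![_ == i]eq_sym !(negPf (ltn_neq _)) //.
  by rewrite !scale0r !addr0.
by rewrite Md Dsv dsc_other ?scale1r // eq_sym ltn_neq.
Qed.
Lemma unip_sv i x : unip i x -> sv (i, true) ## M x = sv (i, true).
Proof.
apply: (gen_ind_fin (R := fun x => sv (i, true) ## M x = sv (i, true))) => {x}.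
- exact: Qgen_fin.
- by rewrite hom1 vact1.
- by move=> x y ex ey; rewrite MM vactM ex ey.
move=> y [[r [a [ir ->]]]|[w ->]].
  rewrite Mx ?ltn_neq // Ex_sv ?ltn_neq // /np !xpair_eqE /= andbF.
  rewrite [r.1 == i]eq_sym (negPf (ltn_neq ir)).
  by rewrite !mul0r !scale0r !addr0.
by rewrite My Ey_sv // /np !xpair_eqE /= andbF !scale0r !addr0.
Qed.
Lemma d_pow_sv i (m : nat) : sv (i, true) ## M (d i ^+ m) = (omega0 ^+ m *: sv (i, true))%R.
Proof. by rewrite homX Md Dg_pow_sv /dsc eqxx. Qed.
Lemma parab_sv i x : parab i x -> exists m, sv (i, true) ## M x = (omega0 ^+ m *: sv (i, true))%R.
Proof.
move=> /parabP[v [l [m [Qv Ll ->]]]]; exists m.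
by rewrite !MM !vactM unip_sv // levi_sv // d_pow_sv.
Qed.

(** Normal form in the radical, with coordinates indexed by the signed indices
above [i] and by the anisotropic plane. *)
Definition unip_elt i (c : I * bool -> F) w :=
  (\prod_(r : I * bool | (i < r.1)%N) xe (i, true) r (c r)) * ye (i, true) w.
Lemma Qx_comm i r u a b : (i < r.1)%N -> (i < u.1)%N ->
  commute (xe (i, true) r a) (xe (i, true) u b).
Proof.
move=> /ltn_neq ir /ltn_neq iu.
have [ru|ru] := eqVneq r.1 u.1; last by apply: x_x; rewrite /dist3 /= ir iu ru.
have [->|->] := same_index ru; first by rewrite /commute !xD // addrC.
exact: x_x2.
Qed.
Lemma unip_eltM i c w c' w' : unip_elt i c w * unip_elt i c' w' =
  unip_elt i (fun r => c r + c' r)%R (w.1 + w'.1, w.2 + w'.2)%R.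
Proof.
rewrite /unip_elt -yD; set A1 := \prod_(r | _) _; set A2 := \prod_(r | _) _.
have -> : \prod_(r : I * bool | (i < r.1)%N) xe (i, true) r (c r + c' r)%R = A1 * A2.
  rewrite -prodgM_commute; last by move=> r u; apply: Qx_comm.
  by apply: eq_bigr => r ir; rewrite xD // ltn_neq.
rewrite !mulgA; congr (_ * _); rewrite -!mulgA; congr (_ * _).
apply/commute_prod => r ir; apply/commute_sym/x_y2; exact: ltn_neq.
Qed.
Lemma unip_elt0 i : unip_elt i (fun=> 0)%R (0, 0)%R = 1.
Proof. by rewrite /unip_elt y0 mulg1 big1 // => r ir; rewrite x0 // ltn_neq. Qed.
Lemma unipP i x : unip i x -> exists c w, x = unip_elt i c w.
Proof.
apply: (gen_ind_fin (R := fun x => exists c w, x = unip_elt i c w)) => {x}.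
- exact: Qgen_fin.
- by exists (fun=> 0)%R, (0, 0)%R; rewrite unip_elt0.
- by move=> _ _ [c [w ->]] [c' [w' ->]]; rewrite unip_eltM; do 2 eexists.
move=> x [[r [a [ir ->]]]|[w ->]]; last first.
  by exists (fun=> 0)%R, w; rewrite /unip_elt big1 ?mul1g // => r ir; rewrite x0 // ltn_neq.
exists (fun u => if u == r then a else 0)%R, (0, 0)%R.
rewrite /unip_elt y0 mulg1 (@prod_single _ _ _ _ _ r) ?eqxx ?index_enum_uniq ?mem_index_enum //.
by move=> u iu /negPf->; rewrite x0 // ltn_neq.
Qed.
Lemma unip_eltE i c w : M (unip_elt i c w) = siegel omega0 B (sv (i, true))
  (\sum_(r : I * bool | (i < r.1)%N) c r *: sv r + wv w)%R.
Proof.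
have Qf := Q_sv omega0 B (i, true) : Qform omega0 B (sv _) = 0%R.
have [e1 e2] : M (\prod_(r : I * bool | (i < r.1)%N) xe (i, true) r (c r))
    = siegel omega0 B (sv (i, true)) (\sum_(r : I * bool | (i < r.1)%N) c r *: sv r)%R
  /\ bf B (sv (i, true)) (\sum_(r : I * bool | (i < r.1)%N) c r *: sv r)%R = 0%R.
  elim/big_rec2: _ => [|r g v ir [IH1 IH2]]; first by rewrite hom1 E_0 ?bf0r.
  have h : bf B (sv (i, true)) (c r *: sv r)%R = 0%R by apply: bf_svZ0; apply: ltn_neq.
  rewrite MM Mx ?ltn_neq // IH1 /xroot E_add //.
  by rewrite bfDr h IH2 addr0.
by rewrite /unip_elt MM e1 My /yroot E_add // bf_svwv.
Qed.
(** The image of [e_i] displays all coordinates of the normal form. *)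
Lemma unip_inj i x : unip i x -> sv (i, false) ## M x = sv (i, false) -> x = 1.
Proof.
move=> /unipP[c [w ->]]; rewrite unip_eltE; set v := (\sum_(r | _) _)%R.
have bv : bf B (sv (i, true)) v = 0%R.
  rewrite /v; elim/big_rec: _ => [|r y ir IH]; first by rewrite bf0r.
  by rewrite bfDr IH addr0; apply: bf_svZ0; apply: ltn_neq.
have bvw : bf B (sv (i, true)) (v + wv w)%R = 0%R by rewrite bfDr bv bf_svwv addr0.
rewrite actE ?Q_sv // /Ef bf_svsv /np /= eqxx scale1r.
set k := (bf B _ _ + _)%R => e.
have {}e : (v + wv w + k *: sv (i, true))%R = 0%R.
  by apply: (addrI (sv (i, false))); rewrite addr0 -[RHS]e addrA.
have c0 r : (i < r.1)%N -> c r = 0%R.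
  move=> ir; have := congr1 (@cs F N ^~ r) e.
  rewrite !csD cs_wv csZ cs_sv addr0 /v cs_sum (bigD1 r) //= big1 => [|u /andP[_ ur]].
    rewrite csZ cs_sv eqxx mulr1 addr0 /cs mxE; case: eqP => [e'|_]; last by rewrite mulr0 addr0.
    by move: ir; rewrite e' ltnn.
  by rewrite csZ cs_sv eq_sym (negPf ur) mulr0.
have w_0 : w = (0, 0)%R.
  have := congr1 (@cw F N) e; rewrite !cwD cwZ cw_sv cw_wv /v cw_sum => [|r _].
    by rewrite /= !mulr0 !addr0 !add0r /cw /cw1 /cw2 !mxE -surjective_pairing.
  by rewrite cwZ cw_sv /= mulr0.
rewrite /unip_elt w_0 y0 mulg1 big1 // => r ir.
by rewrite c0 // x0 // ltn_neq.
Qed.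
(** The eigenvalue at [f_i] forces the torus part to be a power of
[delta_i ^+ q.-1]. By [d_q1] this is a power of [delta_j ^+ q.-1] for the next
index [j], hence lies in the Levi part. *)
Lemma parab_ker i j x : (i < j)%N -> (forall y, levi i.+1 y -> M y = 1 -> y = 1) ->
  parab i x -> M x = 1 -> x = 1.
Proof.
move=> ij ker /parabP[v [l [m [Qv Ll ->]]]] M1.
have m1 : (omega0 ^+ m = 1)%R.
  have := congr1 (fun g => sv (i, true) ## g) M1.
  rewrite !MM !vactM unip_sv // levi_sv // d_pow_sv vact1 => /(congr1 (@cs F N ^~ (i, true))).
  by rewrite csZ cs_sv eqxx mulr1.
have Ld : levi i.+1 (d i ^+ m).
  have /dvdnP[k ->] := omega0_order m1.
  rewrite mulnC expgM (d_q1 i j) -expgM; apply: gen_X; apply: gen_in.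
  by apply: Or33; exists j.
have Ll' : levi i.+1 (l * d i ^+ m) by apply: gen_M.
move: M1; rewrite -mulgA MM => M1.
have v1 : v = 1.
  apply: (@unip_inj i) => //; rewrite -[M v](mulgK (M (l * d i ^+ m))) M1 mul1g -homV.
  by apply: levi_sv; apply: gen_V.
rewrite v1 mul1g; apply: ker => //.
by move: M1; rewrite v1 hom1 mul1g.
Qed.

(** Representatives of the double cosets of the parabolic subgroup: they send the
line of [f_i] to itself, to a line not orthogonal to it, and to a different line
orthogonal to it. For the last [i] there is no [j], and indeed no line of the
third kind. *)
Definition coset_rep i x := [\/ x = 1, x = z i
  | exists j, (j = i.+1 :> nat) /\ x = psi (tperm i j)].
Definition cells i x := exists y g y' : G,
  [/\ parab i y, coset_rep i g, parab i y' & x = y * g * y'].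

Lemma parab1 i : parab i 1. Proof. exact: gen_1. Qed.
Lemma cellsMr i x y : cells i x -> parab i y -> cells i (x * y).
Proof.
move=> [p [w [p' [Pp Ww Pp' ->]]]] Py; exists p, w, (p' * y).
by rewrite !mulgA; split=> //; apply: gen_M.
Qed.
Lemma cellsMl i x y : cells i x -> parab i y -> cells i (y * x).
Proof.
move=> [p [w [p' [Pp Ww Pp' ->]]]] Py; exists (y * p), w, p'.
by rewrite !mulgA; split=> //; apply: gen_M.
Qed.
Lemma cellsW i x : coset_rep i x -> cells i x.
Proof. by move=> Ww; exists 1, x, 1; rewrite mul1g mulg1; split=> //; apply: parab1. Qed.
Lemma cellsP i x : parab i x -> cells i x.
Proof.
move=> Px; exists x, 1, 1; rewrite !mulg1; split=> //; [exact: Or31|exact: parab1].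
Qed.

Lemma unip_comm i x y : unip i x -> unip i y -> commute x y.
Proof.
have gg (u v : G) : Qgen i u -> Qgen i v -> commute u v.
  move=> [[r [a [ir ->]]]|[w ->]] [[t [b [it ->]]]|[w' ->]].
  - exact: Qx_comm.
  - by apply: x_y2; apply: ltn_neq.
  - by apply/commute_sym/x_y2; apply: ltn_neq.
  exact: y_y.
move=> Qx Qy; apply/commute_fix; move: Qx; apply: gen_fix => u Qu'.
apply/commute_fix/commute_sym/commute_fix; move: Qy; apply: gen_fix => v Qv.
exact/commute_fix/gg.
Qed.

Section Step.
Variables i j : I.
Hypothesis ji : j = i.+1 :> nat.
Let s := psi (tperm i j).
Let ij : i != j.
Proof. by rewrite -val_eqE /= ji ltn_eqF. Qed.
Let lt_ij : (i < j)%N.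
Proof. by rewrite ji. Qed.

Let ss : s * s = 1.
Proof. by rewrite /s -psiM tperm2 psi1. Qed.
Let sV : s^-1 = s.
Proof. by apply: (mulgI s); rewrite mulgV ss. Qed.
Let mulss x : x * s * s = x.
Proof. by rewrite -mulgA ss mulg1. Qed.
Let zJs : z i ^ s = z j.
Proof. by rewrite zJpsi tpermL. Qed.

Lemma mulzz x (k : I) : x * z k * z k = x.
Proof. by rewrite -mulgA zz mulg1. Qed.
Lemma zi_eq : z i = s * z j * s.
Proof. by rewrite -zJs conjgE sV !mulgA ss mul1g mulss. Qed.

Lemma tperm_fix (p : I * bool) : (j < p.1)%N -> perm_sv (tperm i j) p = p.
Proof.
move=> jp; rewrite /perm_sv tpermD -?surjective_pairing ?ltn_neq //.
exact: ltn_trans jp.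
Qed.

Lemma parabJs x : parab j x -> parab i (x ^ s).
Proof.
apply: gen_conj => y [Ly|Qy|->]; last first.
- by rewrite dJpsi tpermR -[d i]expg1; apply: d_parab.
- apply: unip_parab; case: Qy => [[r [a [jr ->]]]|[w ->]].
    rewrite xJpsi ?ltn_neq // (tperm_fix jr) /perm_sv /= tpermR; apply: gen_in.
    by left; exists r, a; split; rewrite ?(ltn_trans lt_ij).
  by rewrite yJpsi /perm_sv /= tpermR; apply: gen_in; right; exists w.
apply: levi_parab; case: Ly => [[p [r [a [ip ir pr ->]]]]|[p [w [ip ->]]]|[k [jk ->]]].
- rewrite xJpsi // !tperm_fix //; apply/gen_in/Or31; exists p, r, a.
  by rewrite !(leq_trans _ ip, leq_trans _ ir) // ltnW // ltnS.
- rewrite yJpsi tperm_fix //; apply/gen_in/Or32; exists p, w.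
  by rewrite (leq_trans _ ip) // ltnW // ltnS.
rewrite dJpsi tpermD ?ltn_neq //; last exact: ltn_trans jk.
by apply/gen_in/Or33; exists k; rewrite (leq_trans _ jk) // ltnW // ltnS.
Qed.
Lemma parab_levi x : parab j x -> levi i.+1 x.
Proof.
apply: gen_sub => y [Ly|[[r [a [jr ->]]]|[w ->]]|->].
- case: Ly => [[p [r [a [ip ir pr ->]]]]|[p [w [ip ->]]]|[k [jk ->]]].
  + apply/gen_in/Or31; exists p, r, a.
    by rewrite !(leq_trans _ ip, leq_trans _ ir) // ltnW // ltnS.
  + by apply/gen_in/Or32; exists p, w; rewrite (leq_trans _ ip) // ltnW // ltnS.
  by apply/gen_in/Or33; exists k; rewrite (leq_trans _ jk) // ltnW // ltnS.
- apply/gen_in/Or31; exists (j, true), r, a => /=.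
  by rewrite ltn_neq // -ji leqnn (ltnW jr).
- by apply/gen_in/Or32; exists (j, true), w; rewrite -ji.
by apply/gen_in/Or33; exists j; rewrite -ji.
Qed.
Let X a := xe (i, true) (j, false) a.
Lemma unip_X a : unip i (X a).
Proof. by apply: gen_in; left; exists (j, false), a. Qed.
(** Only the root element at [(f_i, e_j)] fails to stay in the parabolic subgroup
under conjugation by the transposition of [i] and [j]. *)
Lemma unip_split (v : G) : unip i v -> exists v1 a, [/\ unip i v1, parab i (v1 ^ s) & v = v1 * X a].
Proof.
apply: (gen_ind_fin (R := fun v => exists v1 a,
  [/\ unip i v1, parab i (v1 ^ s) & v = v1 * X a])) => {v}.
- exact: Qgen_fin.
- by exists 1, 0%R; rewrite conj1g /X x0 // mulg1; split=> //; apply: gen_1.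
- move=> _ _ [v [a [Qv Pv ->]]] [v' [a' [Qv' Pv' ->]]]; exists (v * v'), (a + a')%R.
  split; [exact: gen_M|by rewrite conjMg; apply: gen_M|].
  by rewrite /X -xD // -!mulgA; congr (_ * _); rewrite !mulgA;
    congr (_ * _); apply: (unip_comm (unip_X _) Qv').
move=> x [[r [a [ir ->]]]|[w ->]]; last first.
  exists (ye (i, true) w), 0%R; rewrite /X x0 // mulg1; split=> //.
    by apply: gen_in; right; exists w.
  rewrite yJpsi /perm_sv /= tpermL; apply/levi_parab/gen_in/Or32; exists (j, true), w.
  by rewrite -ji.
have [e|e] := eqVneq r (j, false).
  by exists 1, a; rewrite e mul1g conj1g; split=> //; apply: gen_1.
exists (xe (i, true) r a), 0%R; rewrite /X x0 // mulg1; split=> //.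
  by apply: gen_in; left; exists r, a.
rewrite xJpsi ?ltn_neq // /perm_sv /= tpermL.
have [rj|rj] := eqVneq r.1 j.
  have -> : r.2 = true by move: e rj; case: r {ir} => k [] //= + kj; rewrite kj eqxx.
  rewrite rj tpermR x_sym 1?eq_sym //; apply/unip_parab/gen_in; left.
  by exists (j, true), a.
have jr : (j < r.1)%N by rewrite ltn_neqAle ji ir andbT -ji eq_sym.
rewrite -/(perm_sv (tperm i j) r) tperm_fix //; apply/levi_parab/gen_in/Or31.
by exists (j, true), r, a; split; rewrite ?ltn_neq // -ji.
Qed.

Lemma sX1 : s = X 1%R * xe (i, false) (j, true) 1%R * X 1%R.
Proof. exact: swap_x. Qed.
Lemma X1s : X 1%R * s = xe (i, false) (j, true) 1%R * X 1%R.
Proof. by rewrite {1}sX1 !mulgA /X xx // mul1g. Qed.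
Lemma coset_rep_s : coset_rep i s.
Proof. by apply: Or33; exists j. Qed.

(** The core of the argument: a computation in rank one when [x = 1], in rank two
when [x] is [z j], and the braid relation when [x] is the next transposition. *)
Lemma sXws a x : coset_rep j x -> cells i (s * X a * x * s).
Proof.
case=> [->|->|[k [kj ->]]].
- rewrite mulg1 -{1}sV -mulgA -conjgE xJpsi // /perm_sv /= tpermL tpermR.
  rewrite x_sym 1?eq_sym //.
  have [->|/omega0V_pow[m ->]] := eqVneq a 0%R; first by rewrite x0 //; apply/cellsP/parab1.
  have := @xJdX (i, false) (j, true) 1%R m ij; rewrite /dsc /= eqxx mulr1 => <-.
  have -> : xe (i, false) (j, true) 1%R = X 1%R * s * X 1%R.
    by rewrite X1s -mulgA /X xx // mulg1.
  rewrite conjgE; apply: cellsMl; last by rewrite dXV; apply: d_parab.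
  apply: cellsMr; last exact: d_parab.
  apply: cellsMr; last exact/unip_parab/unip_X.
  by apply: cellsMl; [apply/cellsW/coset_rep_s|apply/unip_parab/unip_X].
- have -> : s * X a * z j * s = z i * (X a ^ z j) ^ s.
    by rewrite zi_eq !conjgE sV zV !mulgA !(mulss, mulzz).
  have e : (X a ^ z j) ^ s = xe (i, true) (j, true) a.
    rewrite xJz // flip_other 1?eq_sym // (@flip_same (j, false)) xJpsi //.
    by rewrite /perm_sv /= tpermL tpermR x_sym // eq_sym.
  rewrite e; apply: cellsMr; first by apply/cellsW/Or32.
  by apply/unip_parab/gen_in; left; exists (j, true), a.
have jk : j != k by rewrite -val_eqE /= kj ltn_eqF.
have ik : i != k by rewrite -val_eqE /= kj ji ltn_eqF // ltnW.
set s' := psi (tperm j k).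
have ss' : s' * s' = 1 by rewrite /s' -psiM tperm2 psi1.
have mulss' y : y * s' * s' = y by rewrite -mulgA ss' mulg1.
have br : s * s' * s = s' * s * s'.
  rewrite /s /s' -!psiM; congr psi.
  have -> : tperm i j * tperm j k * tperm i j = tperm j k ^ tperm i j.
    by rewrite conjgE tpermV mulgA.
  have -> : tperm j k * tperm i j * tperm j k = tperm i j ^ tperm j k.
    by rewrite conjgE tpermV mulgA.
  by rewrite !tpermJ tpermL tpermR (tpermD ik jk) (tpermD (z := i)) // eq_sym.
have -> : s * X a * s' * s = s * s' * s * (X a ^ s') ^ s.
  have sV' : s'^-1 = s' by apply: (mulgI s'); rewrite mulgV ss'.
  by rewrite !conjgE sV sV' !mulgA !(mulss, mulss').
rewrite br.
have Ps' : parab i s'.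
  have Lx' b c : levi i.+1 (xe (j, b) (k, c) 1%R).
    by apply/gen_in/Or31; exists (j, b), (k, c), 1%R; rewrite /= kj ji ltnS leqnn leqnSn jk.
  rewrite /s' swap_x //; apply: levi_parab.
  by apply: gen_M; [apply: gen_M|]; apply: Lx'.
have Pe : parab i ((X a ^ s') ^ s).
  rewrite xJpsi // /perm_sv /= tpermL [tperm j k i]tpermD 1?eq_sym //.
  rewrite xJpsi // /perm_sv /= tpermL [tperm i j k]tpermD //.
  apply/levi_parab/gen_in/Or31; exists (j, true), (k, false), a.
  by rewrite /= kj ji.
apply: cellsMr => //; rewrite -mulgA; apply: cellsMl => //; apply: cellsMr => //.
exact/cellsW/coset_rep_s.
Qed.

Lemma parab_zj : parab i (z j).
Proof.
have Ly' b : levi i.+1 (ye (j, b) (1, 0)%R).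
  by apply/gen_in/Or32; exists (j, b), (1, 0)%R; rewrite /= ji.
rewrite (z_y j true); apply/levi_parab.
by apply: gen_M; [apply: gen_M|]; apply: Ly'.
Qed.
Lemma parab_dJs (m : nat) : parab i ((d i ^+ m) ^ s).
Proof.
rewrite conjXg dJpsi tpermL; apply/levi_parab/gen_X/gen_in/Or33.
by exists j; rewrite ji.
Qed.

Lemma zXs a : cells i (z i * X a * s).
Proof.
have [->|/omega0_pow[m ->]] := eqVneq a 0%R.
  rewrite /X x0 // mulg1 zi_eq mulss; apply: cellsMr; last exact: parab_zj.
  exact/cellsW/coset_rep_s.
have := @xJdX (i, true) (j, false) 1%R m ij.
rewrite /dsc /= eqxx mulr1 -/(X _) -/(X _) => <-; set D := d i ^+ m.
set y1 := xe (i, false) (j, true) 1%R.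
have -> : z i * X 1%R ^ D * s = D^-1 ^ z i * (y1 ^ z i * (z i * (X 1%R * D ^ s))).
  rewrite !conjgE zV sV !mulgA !mulzz -[_ * y1 * _]mulgA -X1s.
  by rewrite !mulgA mulss.
apply: cellsMl; last first.
  rewrite conjVg /D conjXg dJz_same; apply/gen_V/gen_X/gen_V/gen_in; exact: Or33.
apply: cellsMl; last first.
  rewrite /y1 xJz // (@flip_same (i, false)) flip_other //.
  by apply/unip_parab/gen_in; left; exists (j, true), 1%R.
apply: cellsMr; first exact/cellsW/Or32.
by apply: gen_M; [apply/unip_parab/unip_X|apply: parab_dJs].
Qed.

(** By [unip_split], multiplying a double coset by [s] leaves one root element [X a]
between the representative and [s]. For the representative [z i] this is [zXs].
For [s], the Levi part in between lies by induction in the union of the double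
cosets of [parab j]. Since [s] conjugates [parab j] into [parab i], only [X a] and
a representative remain between two copies of [s], and this is [sXws]. *)
Lemma cells_s x : (forall l, levi i.+1 l -> cells j l) -> cells i x -> cells i (x * s).
Proof.
move=> IH [y [g [y' [Py Wg Py' ->]]]]; case: Wg => [->|->|[j' [j'i ->]]].
- rewrite mulg1; apply: cellsMl; last exact: gen_M.
  exact/cellsW/coset_rep_s.
- have [v [l [m [Qv Ll ->]]]] := parabP Py'; set D := d i ^+ m.
  have [v1 [a [Qv1 Pv1 e]]] := unip_split (unipJL Ll Qv).
  have {}e : v1 = (X a)^-1 * v ^ l.
    by rewrite e (unip_comm Qv1 (unip_X a)) mulKg.
  have -> : y * z i * (v * l * D) * s =
      y * (l ^ z i) * (z i * X a * s) * (v1 ^ s) * (D ^ s).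
    rewrite e !conjgE zV sV !mulgA !(mulzz, mulss, mulgK).
    by rewrite -!mulgA.
  do 2 (apply: cellsMr; last by [|apply: parab_dJs]).
  apply: cellsMl; first exact: zXs.
  by apply: gen_M => //; apply/levi_parab/leviJz.
have {j' j'i} -> : j' = j by apply: val_inj; rewrite /= j'i ji.
rewrite -/s; have [v [l [m [Qv Ll ->]]]] := parabP Py'; set D := d i ^+ m.
have [v1 [a [Qv1 Pv1 ->]]] := unip_split Qv.
have [p1 [w [p2 [Pp1 Ww Pp2 ->]]]] := IH l Ll.
have [v2 [a' [Qv2 Pv2 e]]] := unip_split (unipJL (parab_levi Pp1) (unip_X a)).
(* Moving [X a] past [p1] produces an element of the radical; [s] conjugates all of
it but [X a'] into [parab i]. *)
have {}e : v2 = (X a) ^ p1 * (X a')^-1 by rewrite e mulgK.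
have -> : y * s * (v1 * X a * (p1 * w * p2) * D) * s =
    y * (v1 ^ s) * (p1 ^ s) * (v2 ^ s) * (s * X a' * w * s) * (p2 ^ s * D ^ s).
  by rewrite e !conjgE sV !mulgA !(mulss, mulgK, mulgVK).
apply: cellsMr; last by apply: gen_M; [apply: parabJs|apply: parab_dJs].
apply: cellsMl; first exact: sXws.
exact: gen_M (gen_M (gen_M Py Pv1) (parabJs Pp1)) Pv2.
Qed.
End Step.

(** For the last index the radical contains only elements [ye], and conjugating
one of them by [z i] gives a product of the form [p z i p'], as in [SL_2]. *)
Lemma cells_z i x : i.+1 = N.+3 -> cells i x -> cells i (x * z i).
Proof.
move=> iN [y [g [y' [Py Wg Py' ->]]]].
have Qy v : unip i v -> exists w, v = ye (i, true) w.
  apply: (gen_ind_fin (R := fun v => exists w, v = ye (i, true) w)) => {v}.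
  - exact: Qgen_fin.
  - by exists (0, 0)%R; rewrite y0.
  - by move=> _ _ [w ->] [w' ->]; rewrite yD; eexists.
  move=> v [[r [a [ir _]]]|[w ->]]; last by eexists.
  by have := leq_ltn_trans ir (ltn_ord r.1); rewrite iN ltnn.
case: Wg => [->|->|[j [ji _]]]; last first.
- by have := ltn_ord j; rewrite ji iN ltnn.
- have [v [l [m [Qv Ll ->]]]] := parabP Py'; set D := d i ^+ m.
  have -> : y * z i * (v * l * D) * z i = y * (v ^ z i) * (l ^ z i) * (D ^ z i).
    by rewrite !conjgE zV !mulgA !mulzz.
  apply: cellsMr; last first.
    by rewrite /D conjXg dJz_same; apply/gen_X/gen_V/gen_in; exact: Or33.
  apply: cellsMr; last exact/levi_parab/leviJz.
  apply: cellsMl => //; have [w ->] := Qy v Qv; rewrite yJz (@flip_same (i, true)).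
  have [->|/(wact_trans false)[k ->]] := eqVneq (wz w) (0, 0)%R.
    by rewrite y0; apply/cellsP/parab1.
  have -> : ye (np (i, true)) (iter k (wact A B C omega0^-1) (1, 0))%R =
      ye (i, false) (1, 0)%R ^ (d i ^+ k).
    elim: k => [|k IHk]; first by rewrite conjg1.
    by rewrite expgSr conjgM -IHk yJd /dsc /= eqxx.
  have -> : ye (i, false) (1, 0)%R = ye (i, true) (1, 0)%R * z i * ye (i, true) (1, 0)%R.
    by rewrite (z_y i true) /= !mulgA yy mul1g -!mulgA yy mulg1.
  rewrite conjgE; apply: cellsMl; last by rewrite dXV; apply: d_parab.
  apply: cellsMr; last exact: d_parab.
  have Py1 : parab i (ye (i, true) (1, 0)%R) by apply/unip_parab/gen_in; right; eexists.
  by apply: cellsMr => //; apply: cellsMl => //; exact/cellsW/Or32.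
by rewrite mulg1; apply: cellsMl; [exact/cellsW/Or32|exact: gen_M].
Qed.

Lemma levi_gens i x : levi i x -> gen (fun y => parab i y \/ y = z i) x.
Proof.
apply: gen_sub => {x}.
have gP y : parab i y -> gen (fun y => parab i y \/ y = z i) y by move=> Py; apply: gen_in; left.
have gz : gen (fun y => parab i y \/ y = z i) (z i) by apply: gen_in; right.
have Hx p r a : p.1 = i -> (i < r.1)%N -> gen (fun y => parab i y \/ y = z i) (xe p r a).
  case: p => i' [] /= -> ir.
    by apply/gP/unip_parab/gen_in; left; exists r, a.
  have -> : xe (i, false) r a = xe (i, true) r a ^ z i.
    by rewrite xJz ?ltn_neq // (@flip_same (i, true)) flip_other // ltn_neq.
  by apply: gen_J => //; apply/gP/unip_parab/gen_in; left; exists r, a.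
move=> y [[p [r [a [ip ir pr ->]]]]|[p [w [ip ->]]]|[k [ik ->]]].
- have [pi|pi] := eqVneq i p.1.
    by apply: Hx => //; rewrite ltn_neqAle ir pi pr.
  have [ri|ri] := eqVneq i r.1.
    rewrite x_sym //; apply: Hx => //; rewrite ltn_neqAle ip andbT.
    by rewrite -val_eqE in pi.
  apply/gP/levi_parab/gen_in/Or31; exists p, r, a; split=> //.
    by rewrite ltn_neqAle ip andbT.
  by rewrite ltn_neqAle ir andbT.
- have [pi|pi] := eqVneq i p.1; last first.
    apply/gP/levi_parab/gen_in/Or32; exists p, w; split=> //.
    by rewrite ltn_neqAle ip andbT.
  case: p ip pi => i' [] /= _ <-.
    by apply/gP/unip_parab/gen_in; right; exists w.
  have -> : ye (i, false) w = ye (i, true) (wz w) ^ z i.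
    by rewrite yJz (@flip_same (i, true)) wzK.
  by apply: gen_J => //; apply/gP/unip_parab/gen_in; right; eexists.
have [<-|ki] := eqVneq i k; first by apply/gP/gen_in/Or33.
apply/gP/levi_parab/gen_in/Or33; exists k; split=> //.
by rewrite ltn_neqAle ik andbT.
Qed.

(** Descending induction on [i]. For [i] not the last index, [z i] is a conjugate
of [z j], with [j] the next index, by the transposition of [i] and [j]; since
[z j] is in the parabolic subgroup, multiplication by the transposition is all
that matters. *)
Lemma levi_cells i x : levi i x -> cells i x.
Proof.
have [m] := ubnP (N.+3 - i); elim: m i x => // m IH i x lem Lx.
have zR y : cells i y -> cells i (y * z i).
  have [iN|iN] := eqVneq i.+1 N.+3; first exact: cells_z.
  have lt : (i.+1 < N.+3)%N by rewrite ltn_neqAle iN ltn_ord.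
  pose j : I := Ordinal lt; have ji : j = i.+1 :> nat by [].
  have IHj l : levi i.+1 l -> cells j l.
    apply: (IH j l); rewrite /= -ltnS (leq_trans _ lem) // ltnS.
    by rewrite ltn_sub2l // ltn_ord.
  move=> Dy; rewrite (zi_eq i j) !mulgA; apply: cells_s => //.
  by apply: cellsMr; [apply: cells_s|apply: parab_zj].
suff [R _] : (forall u : G, cells i u -> cells i (u * x)) /\
    (forall u : G, cells i u -> cells i (u * x^-1)).
  by rewrite -[x]mul1g; apply/R/cellsP/parab1.
elim: (levi_gens Lx) => {x Lx} [x [Px|->]||x y _ [Rx Rx'] _ [Ry Ry']|x _ [Rx Rx']].
- by split=> u Du; apply: cellsMr => //; apply: gen_V.
- by rewrite zV; split=> u; apply: zR.
- by rewrite invg1; split=> u; rewrite mulg1.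
- by split=> u Du; rewrite ?invgM mulgA; [apply/Ry/Rx|apply/Rx'/Ry'].
by rewrite invgK.
Qed.

Lemma sv_neq i c : sv (i, true) <> (c *: sv (i, false))%R.
Proof.
move=> /(congr1 (@cs F N ^~ (i, true))); rewrite csZ !cs_sv eqxx xpair_eqE andbF mulr0.
by move/eqP; rewrite oner_eq0.
Qed.

(** An element with trivial matrix fixes the line of [f_i], so it is not in the
double coset of [z i] or of the transposition. *)
Lemma cells_ker i x : cells i x -> M x = 1 -> parab i x.
Proof.
move=> [y [g [y' [Py Wg Py' ->]]]] M1.
suff -> : g = 1 by rewrite mulg1; apply: gen_M.
have /parab_sv[m e] := Py; have /parab_sv[m' e'] := gen_V Py'.
have {}M1 : sv (i, true) ## (M y * M g) = sv (i, true) ## M y'^-1.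
  by congr vact; rewrite -[M y * M g](mulgK (M y')) -!MM M1 mul1g homV.
move: M1; rewrite e' vactM e vactZ; case: Wg => [->//|->|[j [ji ->]]].
  rewrite Mz Zsv (@flip_same (i, true)) => M1; case: (@sv_neq i (omega0 ^+ m / omega0 ^+ m')%R).
  rewrite mulrC -scalerA M1 scalerA mulVf ?scale1r //.
  by rewrite expf_neq0.
rewrite Mpsi actP_sv /perm_sv /= tpermL.
have ij : i != j by rewrite -val_eqE /= ji ltn_eqF.
move=> /(congr1 (@cs F N ^~ (i, true))); rewrite !csZ !cs_sv eqxx xpair_eqE.
rewrite (negPf ij) /= mulr0 mulr1 => /eqP; rewrite eq_sym expf_eq0.
by rewrite (negPf w0) andbF.
Qed.

Lemma levi_inj i x : levi i x -> M x = 1 -> x = 1.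
Proof.
have [m] := ubnP (N.+3 - i); elim: m i x => // m IH i x lem Lx M1.
have [iN|iN] := eqVneq i.+1 N.+3.
  have [j ij] := other_index i; apply: (@on_pair_inj i j); rewrite ?hom1 //;
    last exact: on_pair_one.
  have top (k : I) : (i <= k)%N -> k = i.
    move=> ik; apply: val_inj; apply/eqP; rewrite eqn_leq ik andbT /=.
    by rewrite -ltnS iN ltn_ord.
  move: Lx; apply: (gen_ind_fin (R := on_pair i j)).
  - exact: Lgen_fin.
  - exact: on_pair_one.
  - by move=> u v; apply: on_pairM.
  move=> y [[p [r [a [ip ir pr ->]]]]|[p [w [ip ->]]]|[k [ik ->]]].
  - by case/eqP: pr; rewrite (top _ ip) (top _ ir).
  - by rewrite -(top _ ip); apply: Ly; rewrite (top _ ip).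
  by rewrite (top _ ik); apply: Ld.
have lt : (i.+1 < N.+3)%N by rewrite ltn_neqAle iN ltn_ord.
pose j : I := Ordinal lt; have ij : (i < j)%N by [].
apply: (parab_ker ij) => //; last exact: cells_ker (levi_cells Lx) M1.
move=> y; apply: (IH j); rewrite /= -ltnS (leq_trans _ lem) // ltnS.
by rewrite ltn_sub2l // ltn_ord.
Qed.

Definition gens3 x := [\/ gens1 x, x = sg | exists s, x = psi s].

Lemma psi_levi s : levi o0 (psi s).
Proof.
have [ts -> _] := prod_tpermP s; elim/big_ind: _ => [|x y Lx Ly'|t _].
- by rewrite psi1; apply: gen_1.
- by rewrite psiM; apply: gen_M.
have [<-|t12] := eqVneq t.1 t.2; first by rewrite tperm1 psi1; apply: gen_1.
have Lx' b c : levi o0 (xe (t.1, b) (t.2, c) 1%R).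
  by apply/gen_in/Or31; exists (t.1, b), (t.2, c), 1%R.
by rewrite swap_x //; apply: gen_M; [apply: gen_M|]; apply: Lx'.
Qed.
Theorem gens_inj x : gen gens3 x -> M x = 1 -> x = 1.
Proof.
move=> gx; apply: (@levi_inj o0); move: gx; apply: gen_sub => {x} x.
have ps1 : psi (tperm o0 o0) = 1 by rewrite tperm1 psi1.
have Ly1 b : levi o0 (ye (o0, b) (1, 0)%R).
  by apply/gen_in/Or32; exists (o0, b), (1, 0)%R.
case=> [[->|->|->]|->|[s ->]]; last exact: psi_levi.
- by rewrite tg_ye; apply: Ly1.
- have -> : dg = d o0 by rewrite dE ps1 conjg1.
  by apply/gen_in/Or33; exists o0.
- have -> : zg = z o0 by rewrite zE ps1 conjg1.
  by rewrite (z_y o0 true); apply: gen_M; [apply: gen_M|]; apply: Ly1.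
rewrite sg_xe; apply/gen_in/Or31.
by exists (o0, true), (o1, false), 1%R.
Qed.
End Steinberg.

(** * Generation of the even isometries *)

Section Surjectivity.
Variables (F : finFieldType) (N q : nat) (omega0 A B C : F).
Hypothesis F2 : 2%N \in [pchar F].
Hypothesis w0 : omega0 != 0.
Hypothesis B0 : B != 0.
Hypothesis BC : B = C * omega0.
Hypothesis AE : A = 1 + B * C.
Hypothesis omega0_pow : forall a : F, a != 0 -> exists m, a = omega0 ^+ m.
Hypothesis omega0_powS : forall a : F, a != 0 -> exists m, a = omega0 ^+ (q.+1 * m).
Hypothesis wd_order : forall w : F * F, iter q.+1 (wd A B C) w = w.
Hypothesis wd_trans : forall w, qw omega0 B w = 1 ->
  exists m, w = iter m (wd A B C) (1, 0).
Hypothesis qw0 : forall w, qw omega0 B w = 0 -> w = (0, 0).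
Local Notation n := N.+4.
Local Notation dim := (n.-1.*2.+2).
Local Notation V := 'rV[F]_dim.
Local Notation I := 'I_N.+3.
Local Notation GL := {'GL_dim[F]}.
Local Notation Q := (@Qform F n omega0 B).
Local Notation E := (siegel omega0 B).
Local Notation R := (reflection omega0 B).
Local Notation bf := (bf B).
Local Notation sv := (@sv F N).
Local Notation iso := (iso omega0 B).
Local Notation Zg := (@Zg F N B).
Local Notation Dg := (@Dg F N omega0 A B C).
Local Notation Ex := (xroot omega0 B).
Local Notation Ey := (@yroot F N omega0 B).
Implicit Types (x y u v : V) (i j : I) (g h : GL) (p r : I * bool).

(** A group of isometries that contains the root elements, the torus and the
[Zg i]. *)
Variable H : GL -> Prop.
Hypothesis H1 : H 1%g.
Hypothesis HM : forall g h, H g -> H h -> H (g * h)%g.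
Hypothesis HV : forall g, H g -> H g^-1%g.
Hypothesis Hiso : forall g, H g -> iso g.
Hypothesis HEx : forall p r a, p.1 != r.1 -> H (Ex p r a).
Hypothesis HEy : forall p w, H (Ey p w).
Hypothesis HD : forall i, H (Dg i).
Hypothesis HZ : forall i, H (Zg i).

Lemma HX g m : H g -> H (g ^+ m)%g.
Proof. by move=> Hg; elim: m => [|m IH]; rewrite ?expgS //; apply: HM. Qed.

Let Dsv i (m : nat) p : sv p ## (Dg i ^+ m)%g = dsc omega0 i p ^+ m *: sv p.
Proof.
elim: m => [|m IH]; first by rewrite vact1 scale1r.
by rewrite expgSr vactM IH vactZ Dg_sv // scalerA -exprSr.
Qed.
Let Dwv i (m : nat) w : wv w ## (Dg i ^+ m)%g = wv (iter m (wd A B C) w).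
Proof. by elim: m => [|m IH]; rewrite ?vact1 // expgSr vactM IH Dg_wv. Qed.

Definition fixes_below (m : nat) g := forall i b, (i < m)%N -> sv (i, b) ## g = sv (i, b).
Lemma fixbM m g h : fixes_below m g -> fixes_below m h -> fixes_below m (g * h)%g.
Proof. by move=> fg fh i b im; rewrite vactM fg // fh. Qed.

Definition orth_below (m : nat) v := forall i b, (i < m)%N -> cs v (i, b) = 0.
Lemma low_act m v g : iso g -> fixes_below m g -> orth_below m v -> orth_below m (v ## g).
Proof.
move=> ig fg lv i b im; have := iso_bf F2 v (sv (i, ~~ b)) ig.
by rewrite fg // !bf_sv /np /= !negbK (lv i b im).
Qed.

(** Siegel transformations at a fixed singular vector multiply by adding their
second arguments, so they are products of root elements. *)
Lemma E_mem i b y : orth_below i.+1 y -> H (E (sv (i, b)) y).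
Proof.
move=> ly; rewrite [y]vec_sum.
have Qf := Q_sv omega0 B (i, b) : Q (sv _) = 0.
have e0 p : p.1 = i -> cs y p = 0.
  by case: p => k c /= ->; apply: ly.
have bfp p a : p.1 != i -> bf (sv (i, b)) (a *: sv p) = 0.
  by move=> pi; apply: bf_svZ0; rewrite eq_sym.
have [h1 h2] : H (E (sv (i, b)) (\sum_p cs y p *: sv p))
    /\ bf (sv (i, b)) (\sum_p cs y p *: sv p) = 0.
  elim/big_rec: _ => [|p x _ [IH1 IH2]]; first by rewrite E_0 // bf0r.
  have [pi|pi] := eqVneq p.1 i; first by rewrite e0 // scale0r add0r.
  have h := bfp p (cs y p) pi.
  rewrite -E_add // bfDr h IH2 addr0; split=> //.
  by apply: HM => //; apply: HEx; rewrite eq_sym.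
rewrite -E_add // ?bf_svwv //.
by apply: HM => //; apply: HEy.
Qed.

Lemma E_fix i b y : orth_below i.+1 y -> bf (sv (i, b)) y = 0 /\ fixes_below i (E (sv (i, b)) y).
Proof.
move=> ly; have e : bf (sv (i, b)) y = 0 by rewrite bfC bf_sv; apply: ly.
split=> // j c ji; rewrite actE ?Q_sv // /Ef bf_svsv [bf _ y]bfC bf_sv.
rewrite (ly _ _ (ltnW _)) // /np xpair_eqE eq_sym -val_eqE ltn_eqF //=.
by rewrite mulr0 addr0 !scale0r !addr0.
Qed.

(** Since [v] is singular, its coordinate at the opposite vector is the value of
its middle part [u]; so [v] is the image of [sv (i, b)] under a Siegel
transformation at [sv (i, ~~ b)]. *)
Lemma to_sv i b v : orth_below i v -> Q v = 0 -> cs v (i, b) = 1 ->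
  exists h, [/\ H h, fixes_below i h, sv (i, ~~ b) ## h = sv (i, ~~ b) & v ## h = sv (i, b)].
Proof.
move=> lv Qv c1; set c := cs v (i, ~~ b).
have bb : (b == ~~ b) = false by case: (b).
have bb' : (~~ b == b) = false by case: (b).
have [u [lu ve]] : exists u, orth_below i.+1 u /\ v = sv (i, b) + u + c *: sv (i, ~~ b).
  exists (v + sv (i, b) + c *: sv (i, ~~ b)); split; last first.
    apply/rowP => k; rewrite !mxE.
    by apply/esym/(eqF F2 (c := sv (i, b) 0 k + c * sv (i, ~~ b) 0 k)); ring.
  move=> j d; rewrite ltnS leq_eqVlt !csD csZ !cs_sv !xpair_eqE.
  case/orP=> [/eqP/val_inj->|ji].
    rewrite eqxx /=; have [->|db] := eqVneq d b.
      by rewrite bb mulr0 addr0 c1 addFF.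
    have -> : d = ~~ b by case: d b db {c1 c bb bb'} => [] [].
    by rewrite eqxx mulr1 addr0 /c addFF.
  by rewrite (lv _ _ ji) -val_eqE ltn_eqF //= mulr0 !addr0.
have [uv fu] := E_fix (~~ b) lu.
have uvb : bf (sv (i, b)) u = 0 by rewrite bfC bf_sv; apply: lu.
have cQ : c = Q u.
  apply: (addF_eq0 F2); move: Qv; rewrite {1}ve !QD // QZ !Q_sv bfDl !bfZr uvb.
  by rewrite bf_svsv /np /= negbK eqxx [bf u _]bfC uv mulr0 !addr0 add0r mulr1 addrC mulr0 addr0.
have Qf := Q_sv omega0 B (i, ~~ b) : Q (sv _) = 0.
exists (E (sv (i, ~~ b)) u); split=> //; first exact: E_mem.
  by rewrite actE // /Ef bfxx // uv mulr0 addr0 !scale0r !addr0.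
have sve : sv (i, b) ## E (sv (i, ~~ b)) u = v.
  rewrite actE // /Ef uvb bf_svsv /np /= negbK eqxx scale1r mulr1 add0r -cQ.
  by rewrite [RHS]ve.
by rewrite -sve -vactM E_sq // vact1.
Qed.

(** A nonzero coordinate is scaled to 1 by the torus. If both coordinates at [i]
vanish, another one is brought there by a root element; and not all hyperbolic
coordinates vanish, because the plane is anisotropic. *)
Lemma to_one i v : orth_below i v -> Q v = 0 -> v != 0 ->
  exists h, [/\ H h, fixes_below i h & cs (v ## h) (i, false) = 1].
Proof.
move=> lv Qv v0.
have fixZ : fixes_below i (Zg i).
  by move=> j c ji; rewrite Zg_sv // /flip /= -val_eqE ltn_eqF.
have fixD m : fixes_below i (Dg i ^+ m)%g.
  by move=> j c ji; rewrite Dsv /dsc /= -val_eqE ltn_eqF // expr1n scale1r.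
have scale v' : cs v' (i, false) != 0 ->
    exists h, [/\ H h, fixes_below i h & cs (v' ## h) (i, false) = 1].
  move=> c0; have [m e] := omega0_pow c0.
  exists (Dg i ^+ m)%g; split; [exact: HX|exact: fixD|].
  have := iso_bf F2 v' (sv (i, true)) (Hiso (HX m (HD i))).
  rewrite Dsv bfZr !bf_sv /np /= /dsc /= eqxx e => h.
  by apply: (mulfI (expf_neq0 m w0)); rewrite h mulr1.
have either v' : (cs v' (i, false) != 0) || (cs v' (i, true) != 0) ->
    exists h, [/\ H h, fixes_below i h & cs (v' ## h) (i, false) = 1].
  case/orP=> [/scale//|c0].
  have [|h [Hh fh e]] := scale (v' ## Zg i).
    have := iso_bf F2 v' (sv (i, false)) (Hiso (HZ i)).
    by rewrite Zg_sv // /flip eqxx !bf_sv /np /= => ->.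
  by exists (Zg i * h)%g; rewrite vactM; split=> //; [apply: HM|apply: fixbM].
have [|] := boolP ((cs v (i, false) != 0) || (cs v (i, true) != 0)); first exact: either.
rewrite negb_or !negbK => /andP[/eqP c1 /eqP c2].
have lv' : orth_below i.+1 v.
  move=> j b; rewrite ltnS leq_eqVlt => /orP[/eqP/val_inj->|]; last exact: lv.
  by case: b.
have [[r cr]|nr] := pselect (exists r, cs v r != 0).
  have ir : i != r.1.
    apply: contraNneq cr => ir; have := lv' r.1 r.2; rewrite -surjective_pairing => -> //.
    by rewrite -ir.
  have ir' : (i < r.1)%N.
    by rewrite ltnNge; apply: contraNN cr => ri; rewrite [r]surjective_pairing lv' // ltnS.
  have [|h [Hh fh e]] := either (v ## Ex (i, true) (np r) 1).
    rewrite actE ?Q_sv ?bf_svZ0 // /Ef !csD !csZ !cs_sv bfZr !bf_sv npK QZ Q_sv mul1r.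
    rewrite !xpair_eqE /np /= (negPf ir) eqxx /= ?c1 ?c2.
    by rewrite !(mul0r, mulr0, addr0, add0r, mulr1, mul1r) cr orbT.
  exists (Ex (i, true) (np r) 1 * h)%g; rewrite vactM; split=> //.
    by apply: HM => //; apply: HEx.
  apply: fixbM => //; apply: (E_fix (i := i) true (y := 1 *: sv (np r)) _).2 => //.
  move=> j b ji; rewrite scale1r cs_sv xpair_eqE /= -val_eqE ltn_eqF //.
  by rewrite (leq_trans _ ir').
have cs0 r : cs v r = 0 by apply/eqP; apply: contrapT => /negP cr; apply: nr; exists r.
case/eqP: v0; have ve : v = wv (cw v).
  by apply: vecP => [r|]; rewrite ?cs_wv ?cs0 // cw_wv.
by rewrite ve (qw0 (w := cw v)) ?wv0 // -(Q_wv N) -ve.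
Qed.

(** First the image of [e_i] is moved back, then that of [f_i] by a Siegel
transformation at [e_i]. *)
Lemma fix_next_pair i g : iso g -> fixes_below i g -> exists h, H h /\ fixes_below i.+1 (g * h)%g.
Proof.
move=> ig fg.
have nz p : sv p != 0.
  by apply/eqP => /(congr1 (@cs F N ^~ p)) /eqP; rewrite cs_sv eqxx /cs mxE oner_eq0.
have lsv b : orth_below i (sv (i, b)).
  by move=> j c ji; rewrite cs_sv xpair_eqE -val_eqE ltn_eqF.
have le := low_act ig fg (lsv false).
have Qe : Q (sv (i, false) ## g) = 0 by rewrite ig Q_sv.
have ne : sv (i, false) ## g != 0.
  by apply: contraNneq (nz (i, false)) => e; rewrite -[sv _](vactK g) e vact0.
have [h1 [Hh1 f1 e1]] := to_one le Qe ne.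
have ih1 := Hiso Hh1.
have [|h2 [Hh2 f2 _ e2]] := to_sv (low_act ih1 f1 le) _ e1; first by rewrite ih1.
have ig2 : iso (g * h1 * h2)%g by apply: isoM (Hiso Hh2); apply: isoM.
have fg2 : fixes_below i (g * h1 * h2)%g by apply: fixbM => //; apply: fixbM.
have ee : sv (i, false) ## (g * h1 * h2)%g = sv (i, false) by rewrite !vactM.
have [|||h3 [Hh3 f3 e3 e4]] := @to_sv i true (sv (i, true) ## (g * h1 * h2)%g).
- exact: low_act.
- by rewrite ig2 Q_sv.
- have := iso_bf F2 (sv (i, true)) (sv (i, false)) ig2.
  by rewrite ee bf_svsv /np /= eqxx bf_sv.
exists (h1 * h2 * h3)%g; split; first by apply: HM => //; apply: HM.
move=> j b; rewrite ltnS leq_eqVlt !mulgA => /orP[/eqP/val_inj->|ji].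
  rewrite vactM; case: b; first by rewrite e4.
  by rewrite ee; exact: e3.
by rewrite vactM fg2 // f3.
Qed.

(** An isometry that fixes all hyperbolic pairs acts on the plane only. A power of
[delta] moves the image of [w_1] back to [w_1]; multiplying that power by an
element of the torus which acts trivially on the plane makes it trivial on the
hyperbolic pairs. Then [w_2] is sent to [w_2] or to [w_2 + B w_1]. *)
Theorem iso_decomp g : iso g -> exists h, H h /\ (g = h \/ g = (R (wv (1%R, 0%R)) * h)%g).
Proof.
move=> ig.
have [h [Hh fh]] : exists h, H h /\ fixes_below N.+3 (g * h)%g.
  suff /(_ _ (leqnn _)) : forall m, (m <= N.+3)%N -> exists h, H h /\ fixes_below m (g * h)%g by [].
  elim=> [|m IH] mN; first by exists 1%g; split.
  have [h [Hh fh]] := IH (ltnW mN).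
  have [h' [Hh' fh']] := @fix_next_pair (Ordinal mN) (g * h)%g (isoM ig (Hiso Hh)) fh.
  by exists (h * h')%g; rewrite mulgA; split=> //; apply: HM.
have fix_wv g' w : iso g' -> fixes_below N.+3 g' -> exists w',
    wv w ## g' = wv w' /\ qw omega0 B w' = qw omega0 B w.
  move=> ig' fg'; exists (cw (wv w ## g')).
  have e : wv w ## g' = wv (cw (wv w ## g')).
    apply: vecP => [p|]; last by rewrite cw_wv.
    rewrite cs_wv -[p]npK -(bf_sv B) [np p]surjective_pairing -(fg' (np p).1) ?ltn_ord //.
    by rewrite (iso_bf F2 _ _ ig') bf_wvsv.
  by split=> //; rewrite -!(Q_wv N) -e ig'.
set g1 := (g * h)%g in fh; have ig1 : iso g1 by apply: isoM (Hiso Hh).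
have [w [e1 qw1]] := fix_wv g1 (1, 0) ig1 fh.
have [|m wm] := wd_trans (w := w).
  by rewrite qw1 qw10.
have [l le] : exists l, omega0 ^- m = omega0 ^+ (q.+1 * l).
  by apply: omega0_powS; rewrite invr_eq0 expf_neq0.
set K := (m + q.+1 * l)%N.
have K1 : omega0 ^+ K = 1 by rewrite exprD -le divff // expf_neq0.
pose D := (Dg (o0 N) ^+ K)%g; have HD' : H D by apply: HX.
have fD : fixes_below N.+3 D.
  move=> j b _; rewrite Dsv (_ : _ ^+ K = 1) ?scale1r // /dsc /=.
  by case: (j == o0 N); case: b; rewrite ?expr1n // ?exprVn K1 ?invr1.
have eD : wv (1, 0) ## D = wv w.
  rewrite Dwv /K iterD wm; congr (wv (iter m _ _)).
  by rewrite mulnC; elim: (l) => // k IH; rewrite mulSn iterD IH wd_order.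
pose g2 := (g1 * D^-1)%g.
have gE : g = (g2 * (D * h^-1))%g by rewrite /g2 mulgA mulgVK mulgK.
have ig2 : iso g2 by apply: isoM (isoV (Hiso HD')).
have fg2 : fixes_below N.+3 g2.
  apply: fixbM => // j b jN; rewrite -{1}(fD j b jN); exact: vactK.
have e10 : wv (1, 0) ## g2 = wv (1, 0) by rewrite vactM e1 -eD vactK.
have [[a b] [e01 qab]] := fix_wv g2 (0, 1) ig2 fg2.
have b1 : b = 1.
  have := iso_bf F2 (wv (1, 0)) (wv (0, 1)) ig2; rewrite e10 e01 !bf_wv !cw_wv /=.
  by rewrite !mul0r !mul1r !addr0 => /(mulfI B0).
(* The image of [w_2] is [a w_1 + w_2], and its value gives [a (a + B) = 0]. *)
have aB : (a == 0) || (a == B).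
  move: qab; rewrite b1 /qw /= expr0n expr1n !mulr0 !mulr1 add0r addr0 => e.
  rewrite -[a == B]subr_eq0 -mulf_eq0; apply/eqP.
  apply: (eqF F2 (c := - (a * B))); apply: (addrI omega0).
  by rewrite -{2}e; ring.
have wvE' w' : wv w' = w'.1 *: wv (1, 0) + w'.2 *: wv (0, 1) :> V.
  by rewrite -!wvZ -wvD /= !(mulr0, mulr1, addr0, add0r) -surjective_pairing.
exists (D * h^-1)%g; split; first by apply: HM => //; apply: HV.
case/orP: aB => /eqP aB; [left|right]; rewrite {1}gE.
  suff -> : g2 = 1%g by rewrite mul1g.
  apply: vact_ext => [[j c]|w']; first by rewrite fg2 // vact1.
  by rewrite vact1 (wvE' w') vactD !vactZ e10 e01 b1 aB.
congr (_ * _)%g.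
have Q1 : Q (wv (1, 0)) != 0.
  by rewrite Q_wv qw10 oner_eq0.
apply: vact_ext => [[j c]|w']; rewrite actR // /Rf.
  by rewrite fg2 // bf_svwv mul0r scale0r addr0.
rewrite (wvE' w') vactD !vactZ e10 e01 b1 aB -(wvE' w') bf_wv cw_wv Q_wv qw10 /=.
rewrite mulr0 divr1 add0r mulr1 (wvE' w') (wvE' (B, 1)) /=.
by apply/rowP => k; rewrite !mxE; ring.
Qed.
End Surjectivity.

(** * The presented group *)

Section Presentation.
Variables (F : finFieldType) (N : nat) (omega0 A B C : F).
Hypothesis F2 : 2%N \in [pchar F].
Hypothesis w0 : omega0 != 0.
Hypothesis B0 : B != 0.
Hypothesis BC : B = C * omega0.
Hypothesis AE : A = 1 + B * C.
Variables (RS : set (free_group 2)) (RO : set (free_group 5)).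
Local Notation n := N.+4.
Local Notation dim := (n.-1.*2.+2).
Local Notation I := 'I_N.+3.
Local Notation GL := {'GL_dim[F]}.
Local Notation Pg := (@Pg F N).
Local Notation Zg := (@Zg F N B).
Local Notation Dg := (@Dg F N omega0 A B C).
Local Notation Ex := (xroot omega0 B).
Local Notation Ey := (@yroot F N omega0 B).
Local Notation o0 := (o0 N).
Local Notation o1 := (o1 N).
Local Notation o2 := (o2 N).
Implicit Types (i j : I) (s t : {perm I}).
Local Open Scope group_scope.
Hypothesis presS : presents (RS `|` [set (free_gen ord0 ^+ 2)%g])%classic (sym_gens n).
Hypothesis presO : presents RO (omega6_gens n omega0 A B C).

Let rho : {perm I} := sym_cycle n.
Let us : {perm I} := tperm o0 o1.

Let rhoE i j : j = i.+1 :> nat -> rho i = j.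
Proof.
by move=> e; apply: val_inj; rewrite permE /= -e modn_small // ltn_ord.
Qed.
Let usE : sym_swap n = us.
Proof. by congr (tperm _ _); apply: val_inj; rewrite /= inordK. Qed.
Let us_fix i : (1 < i)%N -> us i = i.
Proof. by move=> i1; rewrite tpermD // -val_eqE /= ltn_eqF // ltnW. Qed.
Let rho0 : rho o0 = o1. Proof. exact: rhoE. Qed.
Let rho1 : rho o1 = o2. Proof. exact: rhoE. Qed.
Let us2 : us o2 = o2. Proof. exact: us_fix. Qed.
Let o3_val : (0 < N)%N -> rho o2 = 3%N :> nat.
Proof. by move=> N0; rewrite permE /= modn_small. Qed.

Lemma swapJ_cycle : us ^ rho = tperm o1 o2.
Proof. by rewrite tpermJ rho0 rho1. Qed.
Lemma cycle_swap0 : (rho * us) o0 = o0.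
Proof. by rewrite permM rho0 tpermR. Qed.
Lemma cycle_swap1 : (rho * us) o1 = o2.
Proof. by rewrite permM rho1 us2. Qed.
Lemma swapJ_cycle_swap : us ^ (rho * us) = tperm o0 o2.
Proof. by rewrite tpermJ cycle_swap0 cycle_swap1. Qed.
Lemma swapJ_cycle2 : us ^ (rho ^+ 2) = tperm o2 (rho o2).
Proof. by rewrite tpermJ !permM rho0 rho1. Qed.
Lemma cycle_swap_step i j : (0 < i)%N -> j = i.+1 :> nat -> (rho * us) i = j.
Proof. by move=> i0 ji; rewrite permM (rhoE ji) us_fix // ji. Qed.
Lemma cycle_swap_swap0 : (rho * us * us ^ rho) o0 = o0.
Proof. by rewrite swapJ_cycle permM cycle_swap0 tpermD. Qed.
Lemma cycle_swap_swap1 : (rho * us * us ^ rho) o1 = o1.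
Proof. by rewrite swapJ_cycle permM cycle_swap1 tpermR. Qed.
Lemma cycle_swap_swap_step i j : (1 < i)%N -> j = i.+1 :> nat ->
  (rho * us * us ^ rho) i = j.
Proof.
move=> i1 ji; rewrite swapJ_cycle permM (cycle_swap_step (ltnW i1) ji).
by rewrite tpermD // -val_eqE /= ji ltn_eqF // ltnW.
Qed.

Definition gens6 : 6.-tuple GL :=
  [tuple sigma_g F N; tau_g N B; delta_g N omega0 A B C; z_g N B; U_g F N; Pg rho].
Local Notation ev := (free_lift gens6).
Let evM : {morph ev : x y / x * y} := free_liftM gens6.

Let ev_sigma : ev gsigma = Ex (o0, true) (o1, false) 1%R.
Proof.
by rewrite free_lift_gen (tnth_nth 1) /= inordK //= (sigmaE N omega0 B F2) /xroot scale1r.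
Qed.
Let ev_tau : ev gtau = Ey (o0, true) (1, 0)%R.
Proof. by rewrite free_lift_gen (tnth_nth 1) /= inordK //= (tauE N omega0 B F2). Qed.
Let ev_delta : ev gdelta = Dg o0.
Proof. by rewrite free_lift_gen (tnth_nth 1) /= inordK //= DgE tperm1 Pg1 conjg1. Qed.
Let ev_z : ev gz = Zg o0.
Proof. by rewrite free_lift_gen (tnth_nth 1) /= inordK //= ZgE tperm1 Pg1 conjg1. Qed.
Let ev_U : ev gU = Pg us.
Proof. by rewrite free_lift_gen (tnth_nth 1) /= inordK //= UE. Qed.
Let ev_V : ev gV = Pg rho.
Proof. by rewrite free_lift_gen (tnth_nth 1) /= inordK. Qed.

Lemma ZgJ i s : Zg i ^ Pg s = Zg (s i).
Proof.
apply: vact_ext => [p|w]; rewrite conjgE !vactM PgV.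
  rewrite actP_sv !(Zg_sv _ F2) actP_sv; congr sv.
  case: p => j b; rewrite /perm_sv /flip /= (can2_eq (permKV s) (permK s)).
  by case: eqP => _ /=; rewrite /np /= permKV.
by rewrite actP_wv !(Zg_wv _ F2) actP_wv.
Qed.
Lemma DgJ i s : Dg i ^ Pg s = Dg (s i).
Proof.
apply: vact_ext => [p|w]; rewrite conjgE !vactM PgV.
  rewrite actP_sv !(Dg_sv F2 w0 AE) vactZ actP_sv.
  by case: p => j b; rewrite /perm_sv /dsc /= permKV (can2_eq (permKV s) (permK s)).
by rewrite actP_wv !(Dg_wv F2 w0 AE) actP_wv.
Qed.

(** The conjugating words of the relators, evaluated in any group to which both
the free group and the symmetric group map: it serves for the matrices and again
for the presented group. *)
Lemma swap_cycle_words (K : groupType) (h : {perm I} -> K) (f : free_group 6 -> K) :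
  {morph h : s t / s * t} -> {morph f : x y / x * y} -> f gU = h us -> f gV = h rho ->
  [/\ f (gU ^ gV) = h (tperm o1 o2), f (gV * gU) = h (rho * us),
      f (gV ^+ 2) = h (rho ^+ 2), f (gV * gU * gU ^ gV) = h (rho * us * us ^ rho) &
      f (gU ^ (gV * gU)) = h (tperm o0 o2)].
Proof.
move=> hM fM fU fV.
have UV : f (gU ^ gV) = h (us ^ rho) by rewrite (hom_conj _ _ fM) fU fV -(hom_conj _ _ hM).
have VU : f (gV * gU) = h (rho * us) by rewrite fM fU fV hM.
split=> //.
- by rewrite UV swapJ_cycle.
- by rewrite !expgS !expg0 !mulg1 fM fV hM.
- by rewrite fM VU UV -hM.
by rewrite (hom_conj _ _ fM) VU fU -swapJ_cycle_swap (hom_conj _ _ hM).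
Qed.

Let ev_comm x y : commute (ev x) (ev y) -> ev [~ x, y] = 1.
Proof. by move=> c; rewrite (hom_comm _ _ evM); apply/eqP/commgP. Qed.

(** The conjugating words are permutations of the indices. So the relators say that
root and torus elements at given indices commute with one another or with a
permutation, apart from one Chevalley commutator relation. *)
Lemma ev_relator r : r \in explicit_relators n -> ev r = 1.
Proof.
have [eUV eVU eV2 eVUUV eUVU] :=
  swap_cycle_words (@PgM F N) evM ev_U ev_V.
have evJ x y : ev (x ^ y) = ev x ^ ev y by apply: hom_conj.
have z_fix s : s o0 = o0 -> commute (Zg o0) (Pg s).
  by move=> e; apply/commute_fix; rewrite ZgJ e.
have d_fix s : s o0 = o0 -> commute (Dg o0) (Pg s).
  by move=> e; apply/commute_fix; rewrite DgJ e.
have t_fix s : s o0 = o0 -> commute (Ey (o0, true) (1, 0)%R) (Pg s).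
  by move=> e; apply/commute_fix; rewrite EyJP // /perm_sv /= e.
pose sg := Ex (o0, true) (o1, false) 1%R.
have sgJ s : sg ^ Pg s = Ex (s o0, true) (s o1, false) 1%R by rewrite ExJP.
have s_fix s : s o0 = o0 -> s o1 = o1 -> commute sg (Pg s).
  by move=> e e'; apply/commute_fix; rewrite sgJ e e'.
have rho2_0 : (rho ^+ 2) o0 = o2 by rewrite permM rho0 rho1.
have rho2_1 : (rho ^+ 2) o1 = rho o2 by rewrite permM rho1.
have sg_commute g : iso omega0 B g -> sv F (o0, true) ## g = sv F (o0, true) ->
    sv F (o1, false) ## g = sv F (o1, false) -> commute sg g.
  by move=> ig e e'; apply/commute_fix; rewrite ExJ // e e'.
suff all1 : all (fun r => ev r == 1) (explicit_relators n) by move=> /(allP all1)/eqP.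
rewrite /explicit_relators !all_cat; apply/and5P; split; last (apply/and5P; split).
- rewrite /= andbT; apply/andP; split; apply/eqP; apply: ev_comm.
    by rewrite ev_z eUV; apply: z_fix; rewrite tpermD.
  by rewrite ev_delta eUV; apply: d_fix; rewrite tpermD.
- case: ifP => // _; rewrite /= andbT; apply/andP; split; apply/eqP; apply: ev_comm.
    by rewrite ev_z eVU; apply: z_fix; rewrite cycle_swap0.
  by rewrite ev_delta eVU; apply: d_fix; rewrite cycle_swap0.
- case: ifP => // N0; rewrite /= andbT; apply/eqP; apply: ev_comm.
  rewrite ev_sigma evJ eV2 ev_U -(hom_conj _ _ (@PgM F N)) swapJ_cycle2.
  by apply: s_fix; rewrite tpermD // -val_eqE /= o3_val.
- case: ifP => // _; rewrite /= andbT; apply/eqP; apply: ev_comm.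
  rewrite ev_sigma eVUUV; apply: s_fix; [exact: cycle_swap_swap0|exact: cycle_swap_swap1].
- rewrite /= andbT; apply/andP; split; apply/eqP; apply: ev_comm; rewrite ev_sigma evJ eV2.
    rewrite ev_z ZgJ rho2_0; apply/commute_fix; rewrite ExJZ //.
  rewrite ev_delta DgJ rho2_0; apply/commute_fix; rewrite ExJD //.
  by rewrite /dsc /= !mul1r.
- rewrite /= andbT; apply/andP; split; apply/eqP; apply: ev_comm; last first.
    by rewrite ev_tau eUV; apply: t_fix; rewrite tpermD.
  rewrite ev_tau evM !evJ (hom_inv _ evM) eV2 ev_V ev_delta DgJ conjVg DgJ rho2_0 rho0.
  apply/commute_fix; rewrite conjgM EyJD //.
  have -> : Ey (o0, true) (dsc omega0 o2 (o0, true) * (wd A B C (1, 0)).1,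
                dsc omega0 o2 (o0, true) * (wd A B C (1, 0)).2)%R =
            Ey (o0, true) (1, 0)%R ^ Dg o1 by rewrite EyJD.
  by rewrite conjgK.
- case: ifP => // _; rewrite /= andbT; apply/eqP; apply: ev_comm.
  by rewrite ev_tau eVU; apply: t_fix; rewrite cycle_swap0.
- rewrite /= andbT; apply/and3P; split; apply/eqP.
  + rewrite evM (hom_inv _ evM) (hom_comm _ _ evM) !evJ eVU ev_sigma ev_V -/sg !sgJ.
    rewrite rho0 rho1 cycle_swap0 cycle_swap1 /commg /sg ExJ //; last exact: Ex_iso.
    rewrite !Ex_sv //= !(mul0r, scale0r, addr0, mul1r, scale1r).
    by rewrite -E_add ?Q_sv ?bf_sv0 // /xroot !scale1r mulKg mulgV.
  + apply: ev_comm; rewrite evJ eVU ev_sigma sgJ cycle_swap0 cycle_swap1; exact: Ex_commute.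
  apply: ev_comm; rewrite evJ eUVU ev_sigma sgJ tpermL tpermD //.
  by rewrite /sg Ex_swap // [X in commute _ X]Ex_swap //; apply: Ex_commute.
apply/andP; split.
- case: ifP => // N0; rewrite /= andbT; apply/eqP; apply: ev_comm.
  rewrite evJ eV2 ev_sigma sgJ rho2_0 rho2_1; have e3 := o3_val N0.
  have n23 : o2 != rho o2 by rewrite -val_eqE /= e3.
  have e01 : (rho o2 == o0) = false by rewrite -val_eqE /= e3.
  have e02 : (rho o2 == o1) = false by rewrite -val_eqE /= e3.
  apply: sg_commute; rewrite ?Ex_sv //=; first exact: Ex_iso.
    by rewrite /np !xpair_eqE /= ?e01 ?andbF !mul0r !scale0r !addr0.
  by rewrite /np !xpair_eqE /= ?e02 ?andbF !mul0r !scale0r !addr0.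
rewrite /= andbT; apply/eqP; apply: ev_comm.
rewrite evJ ev_sigma ev_V ev_tau sgJ rho0 rho1.
apply/commute_sym/commute_fix; rewrite EyJ //; last exact: Ex_iso.
by rewrite Ex_wv // Ex_sv //= !mul0r !scale0r !addr0.
Qed.

Local Notation G := (presented (relators n RS RO)).
Local Notation pi := (@presented_pi (free_group 6) (relators n RS RO)).
Let piM : {morph pi : x y / x * y}.
Proof. exact: presented_pi_morph. Qed.
Local Notation gens5 := [tuple gsigma; gtau; gdelta; gz; gU].
Local Notation gens2' := [tuple gU; gV].

Lemma ev_relators r : relators n RS RO r -> ev r = 1.
Proof.
case=> [[[w RSw <-]|[w ROw <-]]|]; last exact: ev_relator.
- have w1 : free_lift (sym_gens n) w = 1.
    by apply/presS; apply: normal_closure_sub; left.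
  rewrite (hom_free_lift _ _ evM) -(hom_one (@PgM F N)) -w1 (hom_free_lift _ _ (@PgM F N)).
  by congr (free_lift _ w); apply: val_inj; rewrite /= usE ev_U ev_V.
rewrite (hom_free_lift _ _ evM).
have /presO <- : normal_closure RO w by apply: normal_closure_sub.
by congr (free_lift _ w); apply: val_inj; rewrite /= !free_lift_gen !(tnth_nth 1) /= !inordK.
Qed.

Definition mx_of (a : G) : GL := ev (presented_repr a).
Lemma mx_of_pi u : mx_of (pi u) = ev u.
Proof.
have /presented_piP e := presented_reprK (pi u).
apply: (mulIg (ev u)^-1); rewrite mulgV -(hom_inv _ evM) -evM.
exact: normal_closure_kernel evM ev_relators e.
Qed.
Lemma mx_ofM : {morph mx_of : a b / a * b}.
Proof.
by move=> a b; rewrite -[a]presented_reprK -[b]presented_reprK -piM !mx_of_pi evM.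
Qed.

Lemma pi_omega6 w : free_lift (omega6_gens n omega0 A B C) w = 1 ->
  pi (free_lift gens5 w) = 1.
Proof.
move=> /presO; apply: (@normal_closure_kernel _ _ (fun u => pi (free_lift gens5 u))) => [x y|r Rr].
  by rewrite free_liftM piM.
by apply: presented_pi_rel; left; right; exists r.
Qed.

Lemma perm_word s : exists w, free_lift (sym_gens n) w = s.
Proof.
have lM := free_liftM (sym_gens n).
apply: (@cycle_gen _ (fun s => exists w, free_lift (sym_gens n) w = s) _ _ _ 0 rho) => //.
- by exists 1; apply: hom_one lM.
- by move=> _ _ [u <-] [v <-]; exists (u * v); rewrite lM.
- by move=> _ [u <-]; exists u^-1; rewrite (hom_inv _ lM).
- move=> i j i0 j1; exists (free_gen ord0); rewrite free_lift_gen (tnth_nth 1) /= usE.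
  by congr (tperm _ _); apply: val_inj.
move=> i j l _ ij jl; split; [|exact: rhoE|exact: rhoE].
by exists (free_gen (inord 1)); rewrite free_lift_gen (tnth_nth 1) /= inordK.
Qed.

Definition perm_image (s : {perm I}) : G :=
  pi (free_lift gens2' (xget 1 [set w | free_lift (sym_gens n) w = s]%classic)).
Local Notation psi := perm_image.

(** The relation [U ^+ 2] is a consequence of the presentation of [Omega^-(6,q)],
where [U] is an involution. Hence any choice of words gives a homomorphism from
the symmetric group to the presented group. *)
Lemma perm_imageE w : pi (free_lift gens2' w) = psi (free_lift (sym_gens n) w).
Proof.
rewrite /perm_image; set w' := xget _ _.
have e : free_lift (sym_gens n) w' = free_lift (sym_gens n) w.
  exact: (@xgetPex _ 1 [set w' | free_lift (sym_gens n) w' = free_lift (sym_gens n) w]%classic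
          (perm_word _)).
rewrite !(hom_free_lift _ _ piM).
apply: (presents_lift presS) (esym e) => r [RSr|->].
  by rewrite -(hom_free_lift _ _ piM); apply: presented_pi_rel; left; left; exists r.
have := @pi_omega6 (free_gen (inord 4) ^+ 2).
rewrite !expgS !expg0 !mulg1 !free_liftM !free_lift_gen !(tnth_nth 1) /= inordK //= => <-.
  by rewrite piM.
by rewrite -/(U_g F N) UE -PgM tperm2 Pg1.
Qed.

Lemma perm_imageM : {morph psi : s t / s * t}.
Proof.
move=> s t; have [u <-] := perm_word s; have [v <-] := perm_word t.
by rewrite -free_liftM -!perm_imageE free_liftM piM.
Qed.
Lemma perm_image_swap : pi gU = psi us.
Proof.
have := perm_imageE (free_gen (inord 0)).
by rewrite !free_lift_gen !(tnth_nth 1) /= inordK //= usE.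
Qed.
Lemma perm_image_cycle : pi gV = psi rho.
Proof.
have := perm_imageE (free_gen (inord 1)).
by rewrite !free_lift_gen !(tnth_nth 1) /= inordK.
Qed.
Lemma mx_perm_image s : mx_of (psi s) = Pg s.
Proof.
have [w <-] := perm_word s; rewrite -perm_imageE mx_of_pi.
rewrite (hom_free_lift _ _ evM) (hom_free_lift _ _ (@PgM F N)).
by congr (free_lift _ w); apply: val_inj; rewrite /= usE ev_U ev_V.
Qed.

Local Notation sg := (pi gsigma).
Local Notation tg := (pi gtau).
Local Notation dg := (pi gdelta).
Local Notation zg := (pi gz).
Local Notation gens1 := (gens1 tg dg zg).
Local Notation gens2 := (gens2 sg tg dg zg psi).
Local Notation gens3 := (gens3 sg tg dg zg psi).

Let piJ x y : pi (x ^ y) = pi x ^ pi y.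
Proof. exact: hom_conj. Qed.
Let psiJ s t : psi (s ^ t) = psi s ^ psi t.
Proof. exact: hom_conj perm_imageM. Qed.
Let words := swap_cycle_words perm_imageM piM perm_image_swap perm_image_cycle.

Let dies x := pi x == 1.
Let rel_fix x y : dies [~ x, y] -> pi x ^ pi y = pi x.
Proof. by move=> r; apply/commute_fix/commgP; rewrite -(hom_comm _ _ piM). Qed.

Lemma pi_explicit : all dies (explicit_relators n).
Proof. by apply/allP => r Er; apply/eqP/presented_pi_rel; right. Qed.
Let rels : [/\ all dies [:: [~ gz, gU ^ gV]; [~ gdelta, gU ^ gV]],
  (0 < N)%N -> all dies [:: [~ gz, gV * gU]; [~ gdelta, gV * gU]],
  (0 < N)%N -> all dies [:: [~ gsigma, gU ^ (gV ^+ 2)]],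
  (1 < N)%N -> all dies [:: [~ gsigma, gV * gU * gU ^ gV]] &
  all dies [:: [~ gsigma, gz ^ (gV ^+ 2)]; [~ gsigma, gdelta ^ (gV ^+ 2)]]].
Proof.
have := pi_explicit; rewrite /explicit_relators !all_cat.
by case/and5P=> r1 r2 r3 r4 /andP[r5 _]; split=> // N0; rewrite !ltnS N0 in r2 r3 r4.
Qed.
Let rels' : [/\ all dies [:: [~ gtau, gdelta ^ (gV ^+ 2) * (gdelta^-1) ^ gV]; [~ gtau, gU ^ gV]],
  (0 < N)%N -> all dies [:: [~ gtau, gV * gU]],
  all dies [:: [~ gsigma, gsigma ^ gV] * (gsigma ^ (gV * gU))^-1;
               [~ gsigma, gsigma ^ (gV * gU)]; [~ gsigma, gsigma ^ (gU ^ (gV * gU))]],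
  (0 < N)%N -> all dies [:: [~ gsigma, gsigma ^ (gV ^+ 2)]] &
  all dies [:: [~ gsigma ^ gV, gtau]]].
Proof.
have := pi_explicit; rewrite /explicit_relators !all_cat.
by case/and5P=> _ _ _ _ /and5P[_ r1 r2 r3 /andP[r4 r5]]; split=> // N0; rewrite !ltnS N0 in r2 r4.
Qed.

Lemma gens1_fix_swap x : gens1 x -> x ^ psi (tperm o1 o2) = x.
Proof.
have [<- _ _ _ _] := words; have [/and3P[rz rd _] _ _ _ _] := rels.
have [/and3P[_ rt _] _ _ _ _] := rels'.
by case=> ->; apply: rel_fix.
Qed.
Lemma gens1_fix_cycle x : (0 < N)%N -> gens1 x -> x ^ psi (rho * us) = x.
Proof.
have [_ <- _ _ _] := words; move=> N0.
have [_ /(_ N0)/and3P[rz rd _] _ _ _] := rels.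
have [_ /(_ N0)/andP[rt _] _ _ _] := rels'.
by case=> ->; apply: rel_fix.
Qed.
(** The stabiliser of the first index is generated by [U ^ V] and [V * U], which
centralise [tau], [delta] and [z] by the given relations. *)
Lemma gens1_fix s : s o0 = o0 -> forall x, gens1 x -> x ^ psi s = x.
Proof.
move=> s0 x gx; have psi1 := hom_one perm_imageM.
apply: (@cycle_gen _ (fun s => x ^ psi s = x) _ _ _ 1 (rho * us) _ _ s).
- by rewrite psi1 conjg1.
- by move=> s' t e e'; rewrite perm_imageM conjgM e e'.
- by move=> s' e; rewrite (hom_inv _ perm_imageM) -{1}e conjgK.
- move=> i j i1 j2; have -> : i = o1 by apply: val_inj.
  by have -> : j = o2 by [apply: val_inj]; apply: gens1_fix_swap.
- move=> i j l i1 ji lj; split; [|exact: cycle_swap_step|].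
    by apply: gens1_fix_cycle => //; move: (ltn_ord l) i1; rewrite lj ji; lia.
  by apply: cycle_swap_step; rewrite // ji.
by move=> i i0; have -> : i = o0 by [apply/val_inj/eqP; rewrite -leqn0 -ltnS].
Qed.

(** The pointwise stabiliser of the first two indices is generated by
[U ^ (V ^+ 2)] and [V * U * U ^ V]. *)
Lemma sigma_fix s : s o0 = o0 -> s o1 = o1 -> sg ^ psi s = sg.
Proof.
move=> s0 s1; have psi1 := hom_one perm_imageM.
have [_ _ eV2 eVUUV _] := words.
apply: (@cycle_gen _ (fun s => sg ^ psi s = sg) _ _ _ 2 (rho * us * us ^ rho) _ _ s).
- by rewrite psi1 conjg1.
- by move=> s' t e e'; rewrite perm_imageM conjgM e e'.
- by move=> s' e; rewrite (hom_inv _ perm_imageM) -{1}e conjgK.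
- move=> i j i2 j3; have N0 : (0 < N)%N by move: (ltn_ord j); rewrite j3.
  have -> : i = o2 by apply: val_inj.
  have -> : j = rho o2 by apply: val_inj; rewrite /= o3_val.
  rewrite -swapJ_cycle2 psiJ -eV2 -perm_image_swap -(piJ gU); apply: rel_fix.
  by have [_ _ /(_ N0)/andP[]] := rels.
- move=> i j l i2 ji lj; split; [|exact: cycle_swap_swap_step|]; last first.
    by apply: cycle_swap_swap_step; rewrite // ji ltnW.
  have N1 : (1 < N)%N by move: (ltn_ord l) i2; rewrite lj ji; lia.
  by rewrite -eVUUV; apply: rel_fix; have [_ _ _ /(_ N1)/andP[]] := rels.
move=> i; rewrite ltnS leq_eqVlt ltnS leqn0 => /orP[]/eqP e.
  by have -> : i = o1 by apply: val_inj.
by have -> : i = o0 by apply: val_inj.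
Qed.

(** Conjugates of [tau], [delta], [z] depend only on the index to which the first
one is moved; so each given relation holds for every permutation with the same
effect on the indices involved. *)
Lemma gens1_cong s t x : s o0 = t o0 -> gens1 x -> x ^ psi s = x ^ psi t.
Proof.
move=> st gx; have e : x ^ psi (s * t^-1) = x.
  by apply: gens1_fix => //; rewrite permM st permK.
by rewrite -[x in RHS]e -conjgM -perm_imageM mulgVK.
Qed.
Lemma sigma_cong s t : s o0 = t o0 -> s o1 = t o1 -> sg ^ psi s = sg ^ psi t.
Proof.
move=> st0 st1; have e : sg ^ psi (s * t^-1) = sg.
  by apply: sigma_fix; rewrite permM ?st0 ?st1 permK.
by rewrite -[in RHS]e -conjgM -perm_imageM mulgVK.
Qed.

Let rho2_0 : (rho ^+ 2) o0 = o2. Proof. by rewrite permM rho0 rho1. Qed.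
Let rho2_1 : (rho ^+ 2) o1 = rho o2. Proof. by rewrite permM rho1. Qed.

Lemma sigma_z : commute sg (zg ^ psi (tperm o0 o2)).
Proof.
have [_ _ eV2 _ _] := words.
rewrite (@gens1_cong _ (rho ^+ 2)) ?tpermL ?rho2_0 //; last exact: Or33.
apply/commute_fix; rewrite -eV2 -(piJ _ (gV ^+ 2)); apply: rel_fix.
by have [_ _ _ _ /and3P[]] := rels.
Qed.
Lemma sigma_delta : commute sg (dg ^ psi (tperm o0 o2)).
Proof.
have [_ _ eV2 _ _] := words.
rewrite (@gens1_cong _ (rho ^+ 2)) ?tpermL ?rho2_0 //; last exact: Or32.
apply/commute_fix; rewrite -eV2 -(piJ _ (gV ^+ 2)); apply: rel_fix.
by have [_ _ _ _ /and3P[]] := rels.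
Qed.
Lemma sigma_cycle_swap : sg ^ psi (tperm o1 o2) = pi (gsigma ^ (gV * gU)).
Proof.
have [_ eVU _ _ _] := words; rewrite piJ eVU.
by apply: sigma_cong; rewrite ?cycle_swap0 ?cycle_swap1 ?tpermL // tpermD.
Qed.
Lemma sigma_chevalley s : s o0 = o1 -> s o1 = o2 ->
  [~ sg, sg ^ psi s] = sg ^ psi (tperm o1 o2).
Proof.
move=> s0 s1; rewrite (@sigma_cong s rho) ?rho0 ?rho1 // -perm_image_cycle -(piJ gsigma gV).
rewrite sigma_cycle_swap -(hom_comm _ _ piM).
apply: (mulIg (pi (gsigma ^ (gV * gU)))^-1); rewrite mulgV -(hom_inv _ piM) -piM.
by apply/eqP; have [_ _ /and4P[]] := rels'.
Qed.
Lemma sigma_commute_same : commute sg (sg ^ psi (tperm o1 o2)).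
Proof.
by rewrite sigma_cycle_swap; apply/commute_fix/rel_fix; have [_ _ /and4P[]] := rels'.
Qed.
(** The given relation is for the permutation [V ^+ 2]; the pairs of indices
disjoint from the first two are moved onto each other by permutations that fix
the first two, and these centralise [sigma]. *)
Lemma sigma_commute_disjoint s : s o0 != o0 -> s o0 != o1 -> s o1 != o0 -> s o1 != o1 ->
  commute sg (sg ^ psi s).
Proof.
move=> n00 n01 n10 n11; have [_ _ eV2 _ _] := words.
have gt1 (i : I) : i != o0 -> i != o1 -> (1 < i)%N.
  by rewrite -!val_eqE /=; case: (i : nat) => [|[]].
(* Three indices are too few for [s]. *)
have N0 : (0 < N)%N.
  rewrite lt0n; apply/eqP => N0; have := perm_inj (s := s) (x1 := o0) (x2 := o1).
  have := ltn_ord (s o0); have := ltn_ord (s o1).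
  have := gt1 _ n00 n01; have := gt1 _ n10 n11.
  move=> h1 h2 h3 h4 /(_ _)H; have : s o0 = s o1 by apply: val_inj => /=; lia.
  by move/H.
have e3 := o3_val N0.
have n23 : o2 != rho o2 by rewrite -val_eqE /= e3.
have n03 : rho o2 != o0 by rewrite -val_eqE /= e3.
have n13 : rho o2 != o1 by rewrite -val_eqE /= e3.
(* [t] fixes the first two indices and moves the next two as [s] moves those. *)
pose u := tperm o2 (s o0); pose t := u * tperm (u (rho o2)) (s o1).
have u0 : u o0 = o0 by rewrite /u tpermD.
have u1 : u o1 = o1 by rewrite /u tpermD.
have t0 : t o0 = o0.
  rewrite permM u0 tpermD //.
  by rewrite -[o0 in _ != o0]u0 (inj_eq perm_inj).
have t1 : t o1 = o1.
  rewrite permM u1 tpermD //.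
  by rewrite -[o1 in _ != o1]u1 (inj_eq perm_inj).
have t2 : t o2 = s o0.
  have u2 : u o2 = s o0 by rewrite /u tpermL.
  rewrite permM u2 tpermD ?(inj_eq perm_inj) //.
  by rewrite -u2 (inj_eq perm_inj) eq_sym.
have t3 : t (rho o2) = s o1 by rewrite permM tpermL.
rewrite (@sigma_cong s (rho ^+ 2 * t)); first last.
- by rewrite permM rho2_1 t3.
- by rewrite permM rho2_0 t2.
rewrite perm_imageM conjgM -{1}(sigma_fix t0 t1); apply: commuteJ.
rewrite -eV2 -(piJ _ (gV ^+ 2)); apply/commute_fix/rel_fix.
by have [_ _ _ /(_ N0)/andP[]] := rels'.
Qed.
Lemma sigma_tau s : s o0 = o1 -> s o1 = o2 -> commute (sg ^ psi s) tg.
Proof.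
move=> s0 s1; rewrite (@sigma_cong s rho) ?rho0 ?rho1 // -perm_image_cycle -(piJ gsigma gV).
by apply/commute_fix/rel_fix; have [_ _ _ _ /andP[]] := rels'.
Qed.

Local Notation M := mx_of.
Lemma mx_sigma : M sg = sigma_g F N.
Proof. by rewrite mx_of_pi free_lift_gen (tnth_nth 1) /= inordK. Qed.
Lemma mx_tau : M tg = tau_g N B.
Proof. by rewrite mx_of_pi free_lift_gen (tnth_nth 1) /= inordK. Qed.
Lemma mx_delta : M dg = delta_g N omega0 A B C.
Proof. by rewrite mx_of_pi free_lift_gen (tnth_nth 1) /= inordK. Qed.
Lemma mx_z : M zg = z_g N B.
Proof. by rewrite mx_of_pi free_lift_gen (tnth_nth 1) /= inordK. Qed.

Lemma mx_inj6 x : gen gens2 x -> M x = 1 -> x = 1.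
Proof.
move=> /(@gen_free _ _ _ [tuple of map pi gens5])[y Sy|w ->].
  have tn (k : 'I_5) : tnth [tuple of map pi gens5] k = pi (tnth gens5 k) by rewrite tnth_map.
  have Uy : psi (tperm o0 o1) = pi gU by rewrite perm_image_swap.
  case: Sy => [[]||] ->; [exists (inord 1)|exists (inord 2)|exists (inord 3)|
    exists (inord 0)|exists (inord 4); rewrite Uy]; by rewrite tn (tnth_nth 1) /= inordK.
rewrite -(hom_free_lift _ _ piM) mx_of_pi (hom_free_lift _ _ evM) => w1.
apply: pi_omega6; rewrite -w1; congr (free_lift _ w); apply: val_inj.
by rewrite /= !free_lift_gen !(tnth_nth 1) /= !inordK.
Qed.

Lemma gens3_all x : gen gens3 x.
Proof.
rewrite -[x]presented_reprK -[presented_repr x]free_liftE (hom_free_lift _ _ piM).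
apply: gen_free_lift => i; rewrite tnth_map tnth_mktuple.
rewrite -[i]inord_val; case: (i : nat) (ltn_ord i) => [|[|[|[|[|[|//]]]]]] _.
- exact: Or32.
- exact/Or31/Or31.
- exact/Or31/Or32.
- exact/Or31/Or33.
- by apply/Or33; exists us; exact: perm_image_swap.
by apply/Or33; exists rho; exact: perm_image_cycle.
Qed.

Lemma mx_even x : even_iso omega0 B (M x).
Proof.
have M1 := hom_one mx_ofM; elim: (gens3_all x) => {x} [x|| x y _ gx _ gy|x _ gx].
- case=> [[]||[s]] ->; rewrite ?mx_sigma ?mx_tau ?mx_delta ?mx_z ?mx_perm_image.
  + exact: even_tau.
  + exact: even_delta.
  + exact: even_z.
  + exact: even_sigma.
  exact: even_Pg.
- by rewrite M1; exact: even_iso1.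
- by rewrite mx_ofM; exact: even_isoM.
by rewrite (hom_inv _ mx_ofM); exact: even_isoV.
Qed.

Variable q : nat.
Hypothesis omega0_pow : forall a : F, a != 0%R -> exists k, a = (omega0 ^+ k)%R.
Hypothesis omega0_powS : forall a : F, a != 0%R -> exists k, a = (omega0 ^+ (q.+1 * k))%R.
Hypothesis wact_trans : forall (b : bool) w, w != (0, 0)%R ->
  exists k, w = iter k (wact A B C (if b then omega0 else omega0^-1%R)) (1, 0)%R.
Hypothesis wd_order : forall w : F * F, iter q.+1 (wd A B C) w = w.
Hypothesis wd_trans : forall w, qw omega0 B w = 1%R ->
  exists k, w = iter k (wd A B C) (1, 0)%R.
Hypothesis qw0 : forall w, qw omega0 B w = 0%R -> w = (0, 0)%R.
Hypothesis omega0_q : (omega0 ^+ q = omega0)%R.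
Hypothesis omega0_q1 : (omega0 ^+ q.-1 = 1)%R.
Hypothesis omega0_order : forall m, (omega0 ^+ m = 1)%R -> (q.-1 %| m)%N.
Hypothesis q_gt1 : (1 < q)%N.

Lemma mx_ker x : M x = 1 -> x = 1.
Proof.
exact: (gens_inj F2 w0 BC AE omega0_pow wact_trans omega0_q wd_order omega0_powS
  (ltnW q_gt1) q_gt1 omega0_q1 omega0_order mx_ofM perm_imageM mx_sigma mx_tau mx_delta
  mx_z mx_perm_image mx_inj6 gens1_fix sigma_fix sigma_z sigma_delta sigma_chevalley
  sigma_commute_same sigma_commute_disjoint sigma_tau (gens3_all x)).
Qed.

Lemma mx_inj : injective M.
Proof.
move=> x y e; apply: (mulIg y^-1); rewrite mulgV; apply: mx_ker.
by rewrite mx_ofM (hom_inv _ mx_ofM) e mulgV.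
Qed.

(** An isometry outside the image would be a reflection times an element of the
image, and so have odd parity. *)
Lemma mx_range g : g \in Omega_minus n omega0 B <-> exists x, M x = g.
Proof.
have M1 := hom_one mx_ofM; split=> [|[x <-]]; last first.
  have eM := mx_even x; rewrite inE (negbT (even_iso_oddr eM)) andbT.
  by apply/forallP => v; apply/eqP; apply: eM.1.
rewrite inE => /andP[/forallP ig og].
have {}ig : iso omega0 B g by move=> v; apply/eqP; exact: ig.
have [||||||||h [[x <-] [->|e]]] := @iso_decomp _ _ q _ _ _ _ F2 w0 B0 AE omega0_pow omega0_powS
  wd_order wd_trans qw0 (fun g => exists x, M x = g) _ _ _ _ _ _ _ _ g ig.
- by exists 1.
- by move=> _ _ [x <-] [y <-]; exists (x * y); apply: mx_ofM.
- by move=> _ [x <-]; exists x^-1; rewrite (hom_inv _ mx_ofM).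
- by move=> _ [x <-]; apply: (mx_even x).1.
- move=> p r a pr.
  have [y [_ e]] := ex_x F2 w0 BC AE omega0_pow mx_ofM perm_imageM mx_sigma mx_delta mx_z
    mx_perm_image gens1_fix sigma_fix a pr.
  by exists y.
- move=> p w.
  have [y [_ e]] := ex_y F2 w0 BC AE wact_trans mx_ofM perm_imageM mx_tau mx_delta mx_z
    mx_perm_image p w.
  by exists y.
- by move=> i; eexists; apply: (Md mx_ofM mx_delta mx_perm_image i).
- by move=> i; eexists; apply: (Mz mx_ofM mx_z mx_perm_image i).
- by exists x.
case/negP: og; rewrite e -/(oddr _).
have Q1 : Qform (n := n) omega0 B (wv (1, 0)%R) != 0%R.
  by rewrite Q_wv qw10 oner_eq0.
have := even_iso_oddr_R F2 B0 (mx_even x) Q1.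
by rewrite -(oddrJ _ (M x)) conjgE -mulgA mulKg.
Qed.
End Presentation.

Close Scope ring_scope.

Theorem theorem11p10 (e q n : nat) (F L : finFieldType)
    (iota : {rmorphism F -> L}) (omega : L) (omega0 A B C : F)
    (RS : set (free_group 2)) (RO : set (free_group 5)) :
  (0 < e)%N -> q = (2 ^ e)%N -> (4 <= n)%N ->
  #|F| = q -> #|L| = (q ^ 2)%N ->
  ((q ^ 2).-1).-primitive_root%R omega ->
  (iota omega0 = omega ^+ q.+1)%R ->
  (iota A = omega ^+ q.-1 + omega ^- q.-1 + 1)%R ->
  (iota B = omega + omega ^+ q)%R ->
  (iota C = omega^-1 + omega ^- q)%R ->
  presents (RS `|` [set (free_gen ord0 ^+ 2)%g])%classic (sym_gens n) ->
  presents RO (omega6_gens n omega0 A B C) ->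
  isomorphic_to (presented (relators n RS RO)) (Omega_minus n omega0 B).
Proof.
move=> e0 q2; case: n => [|[|[|[|N]]]] // _ cardF cardL omegaP omega0E AE BE CE.
move=> presS presO.
have F2 : (2%N \in [pchar F])%R := pchar_GFq q2 cardF.
have w0 : omega0 != 0%R := omega0_neq0 omegaP omega0E.
have B0 : B != 0%R := B_neq0 e0 q2 cardF cardL omegaP omega0E BE.
have BC : (B = C * omega0)%R.
  apply: BC_rel; eassumption.
have AB : (A = 1 + B * C)%R by apply: A_rel; eassumption.
have pw a : a != 0%R -> exists k, (a = omega0 ^+ k)%R.
  by move=> ?; apply: omega0_pow; eassumption.
have pwS a : a != 0%R -> exists k, (a = omega0 ^+ (q.+1 * k))%R.
  by move=> ?; apply: omega0_powS; eassumption.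
have wdo : forall w, iter q.+1 (wd A B C) w = w.
  by move=> w; apply: wd_order; eassumption.
have wat (b : bool) w : w != (0, 0)%R ->
    exists k, w = iter k (wact A B C (if b then omega0 else omega0^-1%R)) (1, 0)%R.
  by move=> ?; apply: wact_trans; eassumption.
have wdt w : qw omega0 B w = 1%R -> exists k, w = iter k (wd A B C) (1, 0)%R.
  by move=> ?; apply: wd_trans; eassumption.
have qw_0 w : qw omega0 B w = 0%R -> w = (0, 0)%R.
  by move=> ?; apply: qw0; eassumption.
have q1 := q_gt1 e0 q2.
have M_mul := mx_ofM F2 w0 BC AB presS presO.
pose f : {multiplicative presented (relators N.+4 RS RO) -> {'GL_(N.+4.-1.*2.+2)[F]}} :=
  HB.pack (mx_of omega0 A B C (RS := RS) (RO := RO)) (isMultiplicative.Build _ _ _ M_mul).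
have wq := exprq cardF omega0.
have wq1 := omega0_q1 e0 q2 cardF omegaP omega0E.
have wo := omega0_order e0 q2 cardF cardL omegaP omega0E.
exists f; split.
  exact: (mx_inj F2 w0 B0 BC AB presS presO pw pwS wat wdo wq wq1 wo q1).
exact: (mx_range F2 w0 B0 BC AB presS presO pw pwS wat wdo wdt qw_0).
Qed.
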